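(* Let $0<\alpha<1$, $\kappa>0$, $\epsilon>0$, $\sigma\in(0,1)$. Let $\Phi$ be a solution on $\Omega\times(0,T]$, $\Omega=(0,L)^2$, with periodic boundary conditions and initial data $\Phi_0$, of the time-fractional Allen-Cahn equation $$\partial_t^\alpha\Phi=-\kappa\mu,\qquad \mu=\Phi^3-\Phi-\epsilon^2\Delta\Phi,$$ and assume the regularity $$\|\Phi(t)\|_{W^{4,\infty}(\Omega)}\le C_\phi,\qquad \|\Phi^{(\ell)}(t)\|_{W^{0,\infty}(\Omega)}\le C_\phi\big(1+t^{\sigma-\ell}\big)\quad\text{for }0<t\le T,\ \ell=1,2,$$ where $\Phi^{(\ell)}$ is the $\ell$-th time derivative. Let $0=t_0<t_1<\cdots<t_N=T$ be a time mesh with steps $\tau_k=t_k-t_{k-1}$, maximum step $\tau=\max_{1\le k\le N}\tau_k$, step ratios $r_k=\tau_k/\tau_{k-1}$ for $2\le k\le N$, and $r_*:=\min_{2\le k\le N}\{1,r_k\}$. Suppose that $$\tau_n\le \frac{1}{\sqrt[\alpha]{\kappa\,\Gamma(2-\alpha)}}\quad\text{for }1\le n\le N$$ (so that the scheme below is uniquely solvable and energy stable), and let $\phi^n\in\mathbb{V}_h$ be the solution of the L1 scheme $$\sum_{k=1}^{n}a_{n-k}^{(n)}\big(\phi_h^{k}-\phi_h^{k-1}\big)=-\kappa\big[(\phi_h^n)^3-\phi_h^n-\epsilon^2\Delta_h\phi_h^n\big],\quad 1\le n\le N,\qquad \phi_h^0=\Phi_0(\mathbf{x}_h),$$ with periodic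 boundary conditions. If the maximum step size satisfies $$\tau\le \frac{1}{\sqrt[\alpha]{2\kappa\epsilon^{-1}c_3\,\Gamma(2-\alpha)}},$$ then the numerical solution is convergent in the discrete $L^2$ norm: $$\|\Phi^n-\phi^n\|\le C_\phi\,E_\alpha\big(2\kappa\epsilon^{-1}c_3t_n^\alpha/r_*\big)\Big(\frac{\tau_1^\sigma}{\sigma}+\frac{1}{1-\alpha}\max_{2\le k\le n}t_k^\alpha t_{k-1}^{\sigma-2}\tau_k^{2-\alpha}+h^2\Big)\quad\text{for }1\le n\le N .$$ In particular, when the time mesh satisfies the following condition: for a mesh parameter $\gamma\ge1$ there exists a mesh-independent constant $C_\gamma>0$ such that $\tau_k\le\tau\min\{1,C_\gamma t_k^{1-1/\gamma}\}$ for $1\le k\le N$ and $t_k\le C_\gamma t_{k-1}$ for $2\le k\le N$, it holds that $$\|\Phi^n-\phi^n\|\le\frac{C_\phi}{\sigma(1-\alpha)}E_\alpha\big(2\kappa\epsilon^{-1}c_3t_n^\alpha/r_*\big)\Big(\tau^{\min\{2-\alpha,\gamma\sigma\}}+h^2\Big)\quad\text{for }1\le n\le N,$$ and the optimal (temporal) accuracy $O(\tau^{2-\alpha})$ can be achieved when $\gamma\ge\max\{1,(2-\alpha)/\sigma\}$.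
   Context: $\partial_t^\alpha$ is the Caputo derivative, $(\partial_t^\alpha v)(t)=\int_0^t\omega_{1-\alpha}(t-s)v'(s)\,\mathrm{d}s$ with $\omega_\beta(t):=t^{\beta-1}/\Gamma(\beta)$. $E_\alpha(z):=\sum_{k=0}^\infty \frac{z^k}{\Gamma(1+k\alpha)}$ is the Mittag-Leffler function. The maximum over $2\le k\le n$ is read as $0$ when $n=1$. The initial data $\Phi_0$ is assumed to have the required regularity, and $\Phi(\cdot,t)$ is regarded as an $L$-periodic function. Spatial grid: $h=L/M$ for an integer $M$, grid points $\mathbf{x}_h=(ih,jh)$, $\Omega_h$ is the set of grid points of one period ($1\le i,j\le M$), and $\mathbb{V}_h$ is the space of real grid functions that are $L$-periodic in each coordinate direction. $\langle v,w\rangle:=h^2\sum_{\mathbf{x}_h\in\Omega_h}v_hw_h$, $\|v\|:=\sqrt{\langle v,v\rangle}$, $\|v\|_{\ell^p}:=\big(h^2\sum_{\mathbf{x}_h\in\Omega_h}|v_h|^p\big)^{1/p}$. $\Delta_h$ is the standard second-order central difference Laplacian and $\nabla_h$ the corresponding discrete gradient, with $\langle-\Delta_hv,w\rangle=\langle\nabla_hv,\nabla_hw\rangle$ on $\mathbb{V}_h$. $\Phi^n\in\mathbb{V}_h$ is the grid function $\Phi_h^n=\Phi(\mathbf{x}_h,t_n)$. Powers of grid functions are pointwise. L1 kernels: $a_{n-k}^{(n)}:=\frac{1}{\tau_k}\int_{t_{k-1}}^{t_k}\omega_{1-\alpha}(t_n-s)\,\mathrm{d}s$ for $1\le k\le n$.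 Constants: $c_\Omega$ is the constant in the discrete Sobolev inequality $\|v\|_{\ell^6}\le c_\Omega\|v\|^{1/3}\big(\|\nabla_hv\|+\|v\|\big)^{2/3}$ for $v\in\mathbb{V}_h$; $c_0$ is a constant (depending on $\Omega$, $\epsilon$ and the initial value) with $\|\phi^n\|_{\ell^6}\le c_0$ for all $n\ge 1$; $c_1$ is a positive constant with $\|\Phi^n\|_{\ell^6}\le c_1$; and $$c_2:=c_\Omega(c_0^2+c_0c_1+c_1^2),\qquad c_3:=2+c_2^{3/2}.$$ These constants may depend on $\Omega$, $\epsilon$ and the initial value, but not on $h$, the times $t_n$, the steps $\tau_n$ or the ratios $r_n$. $C_\phi$ denotes a generic positive constant, not necessarily the same at different occurrences, which depends on the given data and on the solution, but is independent of $h$, the times $t_n$, the step sizes $\tau_n$ and the step ratios $r_n$. *)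

(* Defs.v *)
From HB Require Import structures.
From mathcomp Require Import all_boot all_order all_algebra.
From mathcomp Require Import all_classical all_reals all_analysis.

Set Implicit Arguments.
Unset Strict Implicit.
Unset Printing Implicit Defensive.

Import Order.TTheory GRing.Theory Num.Theory.
Import numFieldNormedType.Exports.

Local Open Scope classical_set_scope.
Local Open Scope ring_scope.

(* Euler's integral; only used for z > 0. *)
Definition Gamma (R : realType) (z : R) : R :=
  \int[@lebesgue_measure R]_(s in `]0, +oo[) (s `^ (z - 1) * expR (- s)).

Definition mittag_leffler (R : realType) (alpha z : R) : R :=
  limn (series (fun k => z ^+ k / Gamma (1 + k%:R * alpha))).

Definition omega (R : realType) (beta t : R) : R := t `^ (beta - 1) / Gamma beta.

Definition caputo (R : realType) (alpha : R) (v : R -> R) (t : R) : R :=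
  \int[@lebesgue_measure R]_(s in `]0, t[) (omega (1 - alpha) (t - s) * derive1 v s).

Definition dx (R : realType) (u : R * R -> R) : R * R -> R :=
  'D_((1, 0) : R * R) u.

Definition dy (R : realType) (u : R * R -> R) : R * R -> R :=
  'D_((0, 1) : R * R) u.

Definition laplacian (R : realType) (u : R * R -> R) (p : R * R) : R :=
  dx (dx u) p + dy (dy u) p.

Fixpoint Ck (R : realType) (k : nat) (u : R * R -> R) : Prop :=
  continuous u /\
  if k is k'.+1 then
    [/\ forall p, derivable u p ((1, 0) : R * R),
        forall p, derivable u p ((0, 1) : R * R),
        Ck k' (dx u) & Ck k' (dy u)]
  else True.

Definition compactly_supported (R : realType) (u : R * R -> R) : Prop :=
  exists2 K : set (R * R), compact K & forall p, ~ K p -> u p = 0.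

Definition periodic2 (R : realType) (L : R) (u : R * R -> R) : Prop :=
  forall x y, u (x + L, y) = u (x, y) /\ u (x, y + L) = u (x, y).

(* g is the weak derivative of u of order i in x and j in y, tested against
   C^(i+j) functions of compact support (the class of Gilbarg and Trudinger).
   The integrals are over the whole plane, so that for a periodic u this is a
   weak derivative on the torus: it sees jumps across the cell boundary. *)
Definition weak_partial (R : realType) (i j : nat) (u g : R * R -> R) : Prop :=
  forall psi : R * R -> R, Ck (i + j) psi -> compactly_supported psi ->
    \int[(@lebesgue_measure R \x @lebesgue_measure R)%E]_p
       (u p * iter i (@dx R) (iter j (@dy R) psi) p) =
    (-1) ^+ (i + j) *
    \int[(@lebesgue_measure R \x @lebesgue_measure R)%E]_p (g p * psi p).

(* The W^{k,oo} norm of the periodic function u, i.e. the largest L^oo norm of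
   a weak derivative of order at most k, is at most C. *)
Definition Wkoo_le (R : realType) (k : nat) (u : R * R -> R) (C : R) : Prop :=
  forall i j, (i + j <= k)%N ->
    exists g : R * R -> R,
      [/\ measurable_fun setT g, weak_partial i j u g &
          ('N[(@lebesgue_measure R \x @lebesgue_measure R)%E]_(+oo)
             [EFin \o g] <= C%:E)%E].

(* Phi t p is the value at time t and point p of the plane.  Classical periodic
   solution on (0,T]; continuity on [0,T] ties Phi to its initial value. *)
Record allen_cahn_solution (R : realType) (alpha kappa eps L T : R)
    (Phi0 : R * R -> R) (Phi : R -> R * R -> R) : Prop := {
  ac_initial : Phi 0 = Phi0;
  ac_periodic : forall t, 0 <= t <= T -> periodic2 L (Phi t);
  ac_time_continuous :
    forall p, {within `[0, T], continuous (fun t => Phi t p)};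
  ac_time_derivable :
    forall t p, 0 < t < T -> derivable (fun s => Phi s p) t 1;
  ac_space : forall t, 0 < t <= T -> Ck 2 (Phi t);
  ac_equation : forall t p, 0 < t <= T ->
    let mu := Phi t p ^+ 3 - Phi t p - eps ^+ 2 * laplacian (Phi t) p in
    caputo alpha (fun s => Phi s p) t = - kappa * mu }.

(* Time derivatives are pointwise and taken on the open interval, which avoids
   one-sided derivatives at T; their spatial W^{0,oo} norm is the supremum over
   all points, which is the L^oo norm as these functions are continuous in p. *)
Record allen_cahn_regular (R : realType) (sigma T C : R)
    (Phi : R -> R * R -> R) : Prop := {
  reg_space : forall t, 0 < t <= T -> Wkoo_le 4 (Phi t) C;
  reg_time_derivable : forall t p, 0 < t < T ->
    derivable (fun s => Phi s p) t 1 /\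
    derivable (derive1 (fun s => Phi s p)) t 1;
  reg_time : forall l t p, (1 <= l <= 2)%N -> 0 < t < T ->
    `| derive1n l (fun s => Phi s p) t | <= C * (1 + t `^ (sigma - l%:R)) }.

(* v i j is the value at the grid point (i h, j h), h = L / M. *)
Definition grid_periodic (R : realType) (M : nat) (v : int -> int -> R) : Prop :=
  forall i j, v (i + M%:Z) j = v i j /\ v i (j + M%:Z) = v i j.

Definition grid_restrict (R : realType) (h : R) (u : R * R -> R) :
  int -> int -> R := fun i j => u (i%:~R * h, j%:~R * h).

Definition grid_inner (R : realType) (M : nat) (h : R) (v w : int -> int -> R) : R :=
  h ^+ 2 * \sum_(1 <= i < M.+1) \sum_(1 <= j < M.+1)
    v i%:Z j%:Z * w i%:Z j%:Z.

Definition grid_norm (R : realType) (M : nat) (h : R) (v : int -> int -> R) : R :=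
  Num.sqrt (grid_inner M h v v).

Definition grid_lp (R : realType) (M : nat) (h : R) (p : nat)
    (v : int -> int -> R) : R :=
  (h ^+ 2 * \sum_(1 <= i < M.+1) \sum_(1 <= j < M.+1) `|v i%:Z j%:Z| ^+ p)
    `^ (p%:R^-1).

Definition grid_dx (R : realType) (h : R) (v : int -> int -> R) :
  int -> int -> R := fun i j => (v (i + 1) j - v i j) / h.

Definition grid_dy (R : realType) (h : R) (v : int -> int -> R) :
  int -> int -> R := fun i j => (v i (j + 1) - v i j) / h.

Definition grid_grad_norm (R : realType) (M : nat) (h : R)
    (v : int -> int -> R) : R :=
  Num.sqrt (grid_inner M h (grid_dx h v) (grid_dx h v) +
            grid_inner M h (grid_dy h v) (grid_dy h v)).

Definition grid_laplacian (R : realType) (h : R) (v : int -> int -> R) :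
  int -> int -> R := fun i j =>
  (v (i + 1) j - 2 * v i j + v (i - 1) j) / h ^+ 2 +
  (v i (j + 1) - 2 * v i j + v i (j - 1)) / h ^+ 2.

Definition discrete_sobolev (R : realType) (L cOmega : R) : Prop :=
  forall (M : nat) (v : int -> int -> R), (0 < M)%N -> grid_periodic M v ->
    let h := L / M%:R in
    grid_lp M h 6 v <=
      cOmega * grid_norm M h v `^ (1 / 3) *
      (grid_grad_norm M h v + grid_norm M h v) `^ (2 / 3).

Record time_mesh (R : realType) (T : R) (N : nat) (t : nat -> R) : Prop := {
  mesh_start : t 0%N = 0;
  mesh_end : t N = T;
  mesh_incr : forall k, (k < N)%N -> t k < t k.+1 }.

(* For k >= 1. *)
Definition step (R : realType) (t : nat -> R) (k : nat) : R := t k - t k.-1.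

Definition max_step (R : realType) (N : nat) (t : nat -> R) : R :=
  \big[Num.max/0]_(1 <= k < N.+1) step t k.

Definition min_ratio (R : realType) (N : nat) (t : nat -> R) : R :=
  \big[Num.min/1]_(2 <= k < N.+1) (step t k / step t k.-1).

(* l1_kernel alpha t n k is the kernel a_{n-k}^{(n)}, for 1 <= k <= n. *)
Definition l1_kernel (R : realType) (alpha : R) (t : nat -> R) (n k : nat) : R :=
  (step t k)^-1 *
  \int[@lebesgue_measure R]_(s in `[t k.-1, t k]) omega (1 - alpha) (t n - s).

Record l1_scheme (R : realType) (alpha kappa eps L : R) (Phi0 : R * R -> R)
    (M N : nat) (t : nat -> R) (phi : nat -> int -> int -> R) : Prop := {
  l1_periodic : forall n, (n <= N)%N -> grid_periodic M (phi n);
  l1_initial : phi 0%N = grid_restrict (L / M%:R) Phi0;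
  l1_equation : forall n i j, (1 <= n <= N)%N ->
    \sum_(1 <= k < n.+1) l1_kernel alpha t n k * (phi k i j - phi k.-1 i j) =
    - kappa * (phi n i j ^+ 3 - phi n i j -
               eps ^+ 2 * grid_laplacian (L / M%:R) (phi n) i j) }.

Definition c2 (R : realType) (cOmega c0 c1 : R) : R :=
  cOmega * (c0 ^+ 2 + c0 * c1 + c1 ^+ 2).

Definition c3 (R : realType) (cOmega c0 c1 : R) : R :=
  2 + c2 cOmega c0 c1 `^ (3 / 2).

Definition graded_mesh (R : realType) (gamma Cgamma : R) (N : nat)
    (t : nat -> R) : Prop :=
  (forall k, (1 <= k <= N)%N ->
     step t k <= max_step N t * Num.min 1 (Cgamma * t k `^ (1 - gamma^-1))) /\
  (forall k, (2 <= k <= N)%N -> t k <= Cgamma * t k.-1).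

(* A grid, a time mesh and a numerical solution phi subject to both step-size
   restrictions and to the a priori bounds defining c0 and c1. *)
Record admissible (R : realType) (alpha kappa eps L T : R)
    (Phi0 : R * R -> R) (Phi : R -> R * R -> R) (cOmega c0 c1 : R)
    (M N : nat) (t : nat -> R) (phi : nat -> int -> int -> R) : Prop := {
  adm_grid : (0 < M)%N;
  adm_mesh : time_mesh T N t;
  adm_solvable : forall n, (1 <= n <= N)%N ->
    step t n <= 1 / (kappa * Gamma (2 - alpha)) `^ alpha^-1;
  adm_scheme : l1_scheme alpha kappa eps L Phi0 M N t phi;
  adm_c0 : forall n, (1 <= n <= N)%N -> grid_lp M (L / M%:R) 6 (phi n) <= c0;
  adm_c1 : forall n, (1 <= n <= N)%N ->
    grid_lp M (L / M%:R) 6 (grid_restrict (L / M%:R) (Phi (t n))) <= c1;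
  adm_max_step : max_step N t <=
    1 / (2 * kappa * eps^-1 * c3 cOmega c0 c1 * Gamma (2 - alpha)) `^ alpha^-1 }.

(* || Phi^n - phi^n || *)
Definition l2_error (R : realType) (L : R) (Phi : R -> R * R -> R) (M : nat)
    (t : nat -> R) (phi : nat -> int -> int -> R) (n : nat) : R :=
  grid_norm M (L / M%:R)
    (fun i j => grid_restrict (L / M%:R) (Phi (t n)) i j - phi n i j).

(* Main.v *)
Require Import Defs.
From HB Require Import structures.
From mathcomp Require Import all_boot all_order all_algebra.
From mathcomp Require Import all_classical all_reals all_analysis.
From mathcomp Require Import measurable_realfun ess_sup_inf.
From mathcomp Require Import ring lra.

Set Implicit Arguments.
Unset Strict Implicit.
Unset Printing Implicit Defensive.

Import Order.TTheory GRing.Theory Num.Theory.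
Import numFieldNormedType.Exports.

Local Open Scope classical_set_scope.
Local Open Scope ring_scope.

(** The error is controlled pointwise rather than in energy. The discrete barrier
w_0 = 0, w_k = exp (mu t_k) satisfies, for large mu and small steps,
L1 w >= (c/2) t^(-alpha) + kappa w, the first term coming from the jump of w at 0.
At a grid point where |Phi^n - phi^n| is maximal the discrete Laplacian and the
monotone cubic term have favourable signs, so a multiple of w, corrected by the
interpolation defects of the cells, dominates the error; the truncation error of
the L1 formula decays like t^(-alpha) up to those defects. If some step is not
small, the right-hand side is bounded below and the l^6 bounds suffice. The
Mittag-Leffler factor is bounded below by its constant term.

The spatial regularity only provides weak fourth derivatives. Testing them with a
B-spline bounds iterated second differences of Phi, which gives the second-order
consistency of the five-point Laplacian. *)

(** * The L1 operator and its comparison principle *)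

(** The obstacle is the memory of the truncation error: at step [j] every past cell leaves a defect,
    weighted by a difference of consecutive L1 kernels, and these must be controlled uniformly in
    the mesh. The weights are exactly those that Abel summation produces in [l1_op]. With [G k] the
    defect of cell [k], the operator applied to [- G] returns the whole history sum and leaves only
    [2 * a j j * G j], a local quantity of size [t j ^ (- alpha)] times the mesh term. The
    first-cell error has the same decay in [t j], and the spatial error is brought to it by
    [t j <= T]; hence the barrier is designed to produce [t j ^ (- alpha)]. The threshold that
    separates small from large steps depends on the data alone, so a mesh that violates it has a
    right-hand side above a fixed positive number. The lower bound of the Mittag-Leffler factor
    needs convergence of its series, hence growth of [Gamma]. *)

Lemma ler_powRN (R : realType) (r x y : R) : 0 <= r -> 0 < x -> x <= y ->
  y `^ (- r) <= x `^ (- r).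
Proof.
move=> r0 x0 xy; rewrite !powRN lef_pV2 ?posrE ?powR_gt0//; last exact: lt_le_trans xy.
by rewrite ge0_ler_powR// nnegrE ltW// (lt_le_trans x0).
Qed.

Definition l1_op (R : realType) (a : nat -> nat -> R) (u : nat -> R) (j : nat) : R :=
  \sum_(1 <= k < j.+1) a j k * (u k - u k.-1).

Lemma sum_by_parts (R : realType) (b u : nat -> R) m :
  \sum_(1 <= k < m.+2) b k * (u k - u k.-1) =
  b m.+1 * u m.+1 - \sum_(1 <= k < m.+1) (b k.+1 - b k) * u k - b 1%N * u 0%N.
Proof.
elim: m => [|m IH]; first by rewrite big_nat1 big_geq// subr0 mulrBr.
by rewrite big_nat_recr//= IH [in RHS]big_nat_recr//=; ring.
Qed.

(** Abel summation isolates the current value. If the kernels increase in [k], every past value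
    enters with a nonpositive coefficient, and this sign structure carries the comparison
    argument. *)
Lemma l1_opE (R : realType) (a : nat -> nat -> R) u j : (0 < j)%N ->
  l1_op a u j = a j j * u j -
    \sum_(1 <= k < j) (a j k.+1 - a j k) * u k - a j 1%N * u 0%N.
Proof. by case: j => // j _; exact: sum_by_parts. Qed.

(** By [l1_opE], nonnegative past values only lower the operator. The sign of [z j] itself is left
    open: it is what the comparison deduces. *)
Lemma l1_op_le_diag (R : realType) (a : nat -> nat -> R) z j : (0 < j)%N ->
  (forall k, (1 <= k < j)%N -> a j k <= a j k.+1) -> 0 <= a j 1%N ->
  (forall k, (k < j)%N -> 0 <= z k) ->
  l1_op a z j <= a j j * z j.
Proof.
move=> j0 amono a1 z0; rewrite l1_opE// -addrA gerDl -opprD oppr_le0.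
apply: addr_ge0; last by rewrite mulr_ge0// z0.
rewrite big_seq_cond; apply: sumr_ge0 => k; rewrite andbT mem_index_iota => kj.
by rewrite mulr_ge0// ?subr_ge0 ?amono// z0//; case/andP: kj.
Qed.

Lemma l1_opD (R : realType) (a : nat -> nat -> R) u v j :
  l1_op a (fun k => u k + v k) j = l1_op a u j + l1_op a v j.
Proof. by rewrite /l1_op -big_split; apply: eq_bigr => k _ /=; ring. Qed.

Lemma l1_opZ (R : realType) (a : nat -> nat -> R) c u j :
  l1_op a (fun k => c * u k) j = c * l1_op a u j.
Proof. by rewrite /l1_op mulr_sumr; apply: eq_bigr => k _ /=; ring. Qed.

Lemma telescope_diff (R : realType) (w : nat -> R) m j : (m <= j)%N ->
  \sum_(m.+1 <= k < j.+1) (w k - w k.-1) = w j - w m.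
Proof.
move=> mj; rewrite big_add1/= -(telescope_sumr w mj).
by apply: eq_bigr => k _.
Qed.

(* Only the steps within [theta] of [t j] are used: there the kernel exceeds
   [c * theta^(-alpha)], and [w] at least halves over that window. The first
   step, where [w] jumps from 0, yields the [t_j^(-alpha)] term. *)
Lemma l1_op_barrier (R : realType) (alpha c lam : R) :
  0 < alpha -> 0 < c -> 0 < lam ->
  exists delta mu : R, [/\ 0 < delta, 0 < mu &
  forall (a : nat -> nat -> R) (t : nat -> R) (n : nat),
    t 0%N = 0 -> (forall k, (k < n)%N -> t k < t k.+1) ->
    (forall k, (1 <= k <= n)%N -> t k - t k.-1 <= delta) ->
    (forall j k, (1 <= k <= j)%N -> (j <= n)%N ->
       c * (t j - t k.-1) `^ (- alpha) <= a j k) ->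
    forall j, (1 <= j <= n)%N ->
      c / 2 * t j `^ (- alpha) + lam * expR (mu * t j) <=
      l1_op a (fun k => if k is 0 then 0 else expR (mu * t k)) j].
Proof.
move=> al0 c0 lam0.
(* [theta] makes the kernel bound equal to [4 * lam] at the edge of the window: one factor 2 pays
   for the loss of half of [w] there, the other for averaging with the first jump. *)
pose theta := (4 * lam / c) `^ (- alpha^-1).
have q0 : 0 < 4 * lam / c by rewrite divr_gt0// mulr_gt0.
have th0 : 0 < theta by rewrite powR_gt0.
have thal : c * theta `^ (- alpha) = 4 * lam.
  rewrite /theta -powRrM mulrNN mulVf ?gt_eqF// powRr1 ?ltW//.
  by rewrite mulrC divfK ?gt_eqF.
pose mu := 2 / theta.
have mu0 : 0 < mu by rewrite divr_gt0.
(* Steps of at most [theta / 2] put the first node [m] of the window at or before [t j - theta / 2],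
   unless [m = 0], where [w] vanishes. As [mu * (theta / 2) = 1], [w] then grows from [m] to [j] by
   a factor of at least e, hence 2. *)
exists (theta / 2), mu; split; rewrite ?divr_gt0//.
move=> a t n t0 tinc step ker j /andP[j1 jn].
set w := (fun k : nat => _).
have wE k : (0 < k)%N -> w k = expR (mu * t k) by case: k.
have tmono k l : (k <= l)%N -> (l <= n)%N -> t k <= t l.
  move=> /subnK <-; elim: (l - k)%N => [//|m IH] mn.
  by rewrite (le_trans (IH _))// ?(ltnW mn)// addSn ltW// tinc.
have tpos k : (0 < k)%N -> (k <= n)%N -> 0 < t k.
  move=> k0 kn; rewrite -t0; apply: (lt_le_trans (tinc 0%N _)).
    exact: leq_trans kn.
  exact: tmono.
have tdiff k : (1 <= k <= j)%N -> 0 < t j - t k.-1.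
  case: k => // k /andP[_ kj]; rewrite subr_gt0 /=.
  apply: (lt_le_trans (tinc k _)); first exact: leq_trans jn.
  exact: tmono.
have incr k : (1 <= k <= j)%N -> 0 <= w k - w k.-1.
  case: k => // -[|k] /andP[_ kj] /=; first by rewrite subr0 expR_ge0.
  rewrite subr_ge0 ler_expR ler_pM2l// tmono//; exact: leq_trans jn.
have a0 k : (1 <= k <= j)%N -> 0 <= a j k.
  by move=> kj; apply: le_trans (ker j k kj jn); rewrite mulr_ge0 ?powR_ge0 ?ltW.
have hw0 : 0 < w j by rewrite wE// expR_gt0.
have first_jump : c * t j `^ (- alpha) <= l1_op a w j.
  rewrite /l1_op big_ltn// -[leLHS]addr0; apply: lerD.
    have := ker j 1%N _ jn; rewrite /= t0 subr0 j1 => /(_ isT) h.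
    rewrite subr0; apply: le_trans (h) _; rewrite ler_peMr ?a0 ?j1//.
    by rewrite -expR0 ler_expR mulr_ge0 ?ltW// tpos// (leq_trans j1).
  rewrite big_seq_cond; apply: sumr_ge0 => k; rewrite andbT mem_index_iota.
  move=> /andP[k2 kj]; have k1 : (1 <= k <= j)%N by rewrite (ltnW k2).
  by apply: mulr_ge0; [exact: a0|exact: incr].
have window : 2 * lam * w j <= l1_op a w j.
  have [m /andP[mj mth] mmin] :
      exists2 m, (m < j)%N && (t j - theta <= t m) &
        (m = 0%N \/ t m.-1 < t j - theta).
    have ex : exists m, (m < j)%N && (t j - theta <= t m).
      exists j.-1; rewrite ltn_predL j1/=.
      rewrite lerBlDr -lerBlDl (le_trans (step j _)) ?j1//.
      by rewrite ler_pdivrMr// ler_peMr ?ltW// ltr1n.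
    exists (ex_minn ex); first by case: ex_minnP.
    case: ex_minnP => -[|m] /andP[mj _] hm; first by left.
    right; rewrite ltNge /=; apply/negP => tm.
    have := hm m; rewrite tm (ltnW mj) => /(_ isT).
    by rewrite ltnn.
  have hm : w m <= w j / 2.
    case: mmin => [->|]; first by rewrite /= divr_ge0// ltW.
    case: (posnP m) => [->|m0 tm]; first by rewrite /= divr_ge0// ltW.
    rewrite !wE// ler_pdivlMr//.
    have tmj : t m <= t j - theta / 2.
      have := step m; rewrite m0 (leq_trans (ltnW mj) jn) => /(_ isT).
      move: tm; lra.
    apply: (@le_trans _ _ (expR (mu * t m) * expR 1)).
      rewrite ler_pM2l ?expR_gt0//.
      by have := @expR_ge1Dx R 1; lra.
    rewrite -expRD ler_expR.
    apply: (@le_trans _ _ (mu * (t j - theta / 2) + 1)).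
      by rewrite lerD2r ler_pM2l.
    suff -> : mu * (t j - theta / 2) + 1 = mu * t j by [].
    by rewrite /mu; field; rewrite gt_eqF.
  rewrite /l1_op (@big_cat_nat _ _ _ m.+1)//=; last by rewrite ltnS ltnW.
  apply: (@le_trans _ _ (0 + 4 * lam * (w j - w m))).
    have h := ler_wpM2l (ltW lam0) hm.
    by move: h; move: (w m) (w j) => x y; lra.
  apply: lerD.
    rewrite big_seq_cond; apply: sumr_ge0 => k; rewrite andbT mem_index_iota.
    move=> /andP[k1 km]; have kj : (1 <= k <= j)%N.
      by rewrite k1 (leq_trans _ (ltnW mj)).
    by apply: mulr_ge0; [exact: a0|exact: incr].
  rewrite -telescope_diff ?(ltnW mj)// mulr_sumr big_seq_cond [leRHS]big_seq_cond.
  apply: ler_sum => k; rewrite andbT mem_index_iota => /andP[mk kj].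
  have k1 : (1 <= k <= j)%N by rewrite (leq_trans _ mk).
  apply: ler_wpM2r; first exact: incr.
  apply: le_trans (ker j k k1 jn); rewrite -thal ler_pM2l//.
  apply: ler_powRN; [exact: ltW|exact: tdiff|].
  have : t m <= t k.-1.
    apply: tmono; first by rewrite -ltnS prednK//; case/andP: k1.
    by rewrite (leq_trans (leq_pred _))// (leq_trans _ jn)//.
  by move: mth; lra.
(* The claim is the arithmetic mean of [first_jump] and [window]. *)
by rewrite -(wE j)//; move: first_jump window; lra.
Qed.

(** * Maximum principle on the periodic grid *)

Lemma grid_periodic_modn (R : realType) M (v : int -> int -> R) (i j : int) :
  (0 < M)%N -> grid_periodic M v ->
  exists a b : 'I_M, v i j = v (Posz a) (Posz b).
Proof.
move=> M0 vper.
have shift_l (k : int) i' j' : v (i' + k * M%:Z) j' = v i' j'.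
  elim: k => [|n IH|n IH]; first by rewrite mul0r addr0.
    by rewrite intS mulrDl mul1r addrCA addrC (vper _ _).1.
  by rewrite -IH -[LHS](vper _ _).1; congr v; ring.
have shift_r (k : int) i' j' : v i' (j' + k * M%:Z) = v i' j'.
  elim: k => [|n IH|n IH]; first by rewrite mul0r addr0.
    by rewrite intS mulrDl mul1r addrCA addrC (vper _ _).2.
  by rewrite -IH -[LHS](vper _ _).2; congr v; ring.
have red (k : int) : exists2 a : 'I_M, k = Posz a + (k %/ M%:Z)%Z * M%:Z & True.
  have lt_mod : (k %% M%:Z)%Z < M%:Z by rewrite ltz_pmod.
  have ge_mod : 0 <= (k %% M%:Z)%Z by rewrite modz_ge0 // -lt0n.
  case e : (k %% M%:Z)%Z lt_mod ge_mod => [m|//] lt_mod _.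
  by exists (Ordinal (lt_mod : (m < M)%N)) => //=; rewrite -e addrC -divz_eq.
have [a ea _] := red i; have [b eb _] := red j.
by exists a, b; rewrite {1}ea {1}eb shift_l shift_r.
Qed.

Lemma grid_max (R : realType) M (v : int -> int -> R) :
  (0 < M)%N -> grid_periodic M v ->
  exists i0 j0, forall i j, `|v i j| <= `|v i0 j0|.
Proof.
move=> M0 vper.
pose f (p : 'I_M * 'I_M) := `|v (Posz p.1) (Posz p.2)|.
have [p _ pmax] := @arg_maxP _ _ _ (Ordinal M0, Ordinal M0) xpredT f isT.
exists (Posz p.1), (Posz p.2) => i j.
have [a [b ->]] := grid_periodic_modn i j M0 vper.
exact: (pmax (a, b)).
Qed.

(** [s] stands for the sign of the extremal value, so that maxima and minima are treated at once;
    [|s| <= 1] admits [s = 0], the case of a vanishing grid function. *)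
Lemma grid_laplacian_max (R : realType) h (v : int -> int -> R) i0 j0 (s : R) :
  `|s| <= 1 -> s * v i0 j0 = `|v i0 j0| ->
  (forall i j, `|v i j| <= `|v i0 j0|) -> s * grid_laplacian h v i0 j0 <= 0.
Proof.
move=> s1 sv vmax.
have sle i j : s * v i j <= `|v i0 j0|.
  apply: le_trans (ler_norm _) _; rewrite normrM.
  by apply: le_trans (vmax i j); rewrite ler_piMl.
rewrite /grid_laplacian -mulrDl mulrA mulr_le0_ge0 ?invr_ge0 ?sqr_ge0//.
have := sle (i0 + 1) j0; have := sle (i0 - 1) j0.
have := sle i0 (j0 + 1); have := sle i0 (j0 - 1).
by move: sv; lra.
Qed.

(* At a maximum point of |e^j| the discrete Laplacian and the monotone cubic
   term have favourable signs, so the error obeys the linear L1 inequality. *)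
Lemma l1_scheme_comparison (R : realType) M (h kappa eps r : R)
    (a : nat -> nat -> R) (e : nat -> int -> int -> R) (U V : int -> int -> R)
    (rho : int -> int -> R) (W : nat -> R) j :
  (0 < M)%N -> (0 < j)%N -> 0 < kappa -> kappa < a j j ->
  (forall k, (1 <= k < j)%N -> a j k <= a j k.+1) -> 0 <= a j 1%N ->
  grid_periodic M (e j) ->
  (forall x y, e j x y = U x y - V x y) ->
  (forall x y, l1_op a (fun k => e k x y) j =
     - kappa * (U x y ^+ 3 - V x y ^+ 3 - e j x y -
                eps ^+ 2 * grid_laplacian h (e j) x y) + rho x y) ->
  (forall x y, `|rho x y| <= r) ->
  kappa * W j + r <= l1_op a W j ->
  (forall k x y, (k < j)%N -> `|e k x y| <= W k) ->
  forall x y, `|e j x y| <= W j.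
Proof.
move=> M0 j0 k0 kaj amono a1 eper eUV eeq rhor Wsup IH x y.
have [i0 [l0 emax]] := grid_max M0 eper.
apply: le_trans (emax x y) _.
pose s : R := Num.sg (e j i0 l0).
have s1 : `|s| <= 1 by rewrite /s normr_sg; case: eqP.
have se : s * e j i0 l0 = `|e j i0 l0| by rewrite -normrEsg.
have lap := grid_laplacian_max h s1 se emax.
(* The difference of cubes is [U - V] times a sum of squares, so its sign is that of the error. *)
have cube : 0 <= s * (U i0 l0 ^+ 3 - V i0 l0 ^+ 3).
  have -> : s * (U i0 l0 ^+ 3 - V i0 l0 ^+ 3) = s * e j i0 l0 *
      ((U i0 l0 + V i0 l0 / 2) ^+ 2 + 3 / 4 * V i0 l0 ^+ 2).
    by rewrite eUV; field.
  by rewrite mulr_ge0 ?se// addr_ge0 ?sqr_ge0// mulr_ge0 ?sqr_ge0// divr_ge0.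
pose z k := W k + (- s) * e k i0 l0.
have zpos k : (k < j)%N -> 0 <= z k.
  move=> kj; rewrite /z mulNr subr_ge0 (le_trans (ler_norm _))// normrM.
  by rewrite (le_trans _ (IH k i0 l0 kj))// ler_piMl.
have := l1_op_le_diag j0 amono a1 zpos.
rewrite /z l1_opD l1_opZ mulNr eeq.
have srho : - r <= s * - rho i0 l0.
  rewrite mulrN lerN2 (le_trans (ler_norm _))// normrM.
  by rewrite (le_trans _ (rhor i0 l0))// ler_piMl.
have e2 : 0 <= kappa * eps ^+ 2 by rewrite mulr_ge0 ?sqr_ge0// ltW.
have lap2 := mulr_ge0_le0 e2 lap.
have cube2 := mulr_ge0 (ltW k0) cube.
(* The destabilising linear term costs [kappa * |e|]; it is absorbed because the diagonal kernel
   exceeds [kappa]. *)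
move=> main; suff : 0 <= (a j j - kappa) * (W j - `|e j i0 l0|).
  by rewrite pmulr_rge0 ?subr_gt0// subr_ge0.
rewrite -se; move: main Wsup srho lap2 cube2.
move: (grid_laplacian _ _ _ _) (l1_op a W j) (W j) (e j i0 l0) (rho i0 l0) => A B C D E'.
move: (U i0 l0 ^+ 3) (V i0 l0 ^+ 3) (a j j) => F G' H'.
move=> main Wsup srho lap2 cube2.
by lra.
Qed.

(** * Truncation error of the L1 formula *)

(** The integrands in view blow up at an endpoint, so the fundamental theorem is applied on closed
    intervals [I n] that exhaust the open one, and monotone convergence passes to the limit. A bound
    on the increments of [F] replaces its boundary values. *)
Lemma integral_oo_le_primitive (R : realType) (f F : R -> R) (a b K : R) :
  a < b -> (forall x, a < x < b -> 0 <= f x) ->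
  {in `]a, b[, continuous f} ->
  (forall x, a < x < b -> is_derive x 1 F (f x)) ->
  (forall x y, a < x -> x < y -> y < b -> F y - F x <= K) ->
  (\int[@lebesgue_measure R]_(x in `]a, b[) (f x)%:E <= K%:E)%E.
Proof.
move=> ab f0 cf dF FK.
(* The denominator starts at 3 so that [d n] stays below half the length and [I n] is a proper
   interval. *)
pose d n : R := (b - a) / n.+3%:R.
have d0 n : 0 < d n by rewrite divr_gt0// subr_gt0.
have d2 n : d n < (b - a) / 2.
  by rewrite /d ltr_pM2l ?subr_gt0// ltf_pV2 ?posrE// ltr_nat.
pose I (n : nat) : set R := `[a + d n, b - d n]%classic.
have Iab n : I n `<=` `]a, b[.
  move=> x; rewrite /I /= !in_itv /= => /andP[ax xb].
  by have := d0 n; move: ax xb => ? ? ?; apply/andP; split; lra.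
have UI : \bigcup_n I n = `]a, b[%classic.
  apply/seteqP; split=> x; first by move=> [n _]; exact: Iab.
  rewrite /= in_itv /= => /andP[ax xb].
  pose m := Num.min (x - a) (b - x).
  have m0 : 0 < m by rewrite /m lt_min !subr_gt0 ax xb.
  pose n := Num.trunc ((b - a) / m).
  exists n => //; rewrite /I /= in_itv /=.
  have dm : d n <= m.
    rewrite /d ler_pdivrMr// mulrC -ler_pdivrMr//.
    have := truncnS_gt ((b - a) / m).
    rewrite -/n => /ltW h; apply: le_trans h _.
    by rewrite ler_nat; apply/leqW/leqW.
  have : m <= x - a by rewrite /m ge_min lexx.
  have : m <= b - x by rewrite /m ge_min lexx orbT.
  by move: dm => ? ? ?; apply/andP; split; lra.
have ndI : nondecreasing_seq I.
  move=> n m nm; rewrite subsetEset => x; rewrite /I /= !in_itv /=.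
  have : d m <= d n.
    rewrite /d ler_pM2l ?subr_gt0// lef_pV2 ?posrE// ler_nat.
    by rewrite !ltnS.
  by move=> ? /andP[? ?]; apply/andP; split; lra.
have cI n : {within I n, continuous f}.
  by apply: continuous_in_subspaceT => x; rewrite inE => /Iab xI; apply: cf.
have mf n : measurable_fun (I n : set R) (EFin \o f : R -> \bar R).
  apply/measurable_EFinP; apply: subspace_continuous_measurable_fun; last exact: cI.
  exact: measurable_itv.
have f0I n x : I n x -> (0 <= (EFin \o f) x)%E.
  by move=> /Iab /=; rewrite in_itv lee_fin /= => xI; exact: f0.
have cvgI : (\int[@lebesgue_measure R]_(x in I n) (f x)%:E @[n --> \oo] -->
    \int[@lebesgue_measure R]_(x in \bigcup_n I n) (f x)%:E)%E.
  apply: ge0_nondecreasing_set_cvg_integral => //.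
  by move=> n; exact: measurable_itv.
rewrite -UI -(cvg_lim _ cvgI)//; apply: lime_le.
  apply: ereal_nondecreasing_is_cvgn.
  apply: ge0_nondecreasing_set_nondecreasing_integral => //.
  by move=> n; exact: measurable_itv.
apply: nearW => n; rewrite /I.
have cF x : a < x < b -> {for x, continuous F}.
  move=> xab; apply/differentiable_continuous/derivable1_diffP.
  by apply: ex_derive; exact: dF.
have lt1 : a + d n < b - d n by have := d2 n; lra.
rewrite (@continuous_FTC2 _ f F)//.
- rewrite lee_fin; apply: FK; rewrite ?ltrDl ?gtrDl ?oppr_lt0//.
- exact: cI.
- split.
  + move=> x; rewrite in_itv /= => /andP[ax xb].
    apply: ex_derive; apply: dF.
    by have := d0 n; move=> ?; apply/andP; split; lra.
  + by apply: cvg_at_right_filter; apply: cF; have := d0 n; have := d2 n;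
      move=> *; apply/andP; split; lra.
  + by apply: cvg_at_left_filter; apply: cF; have := d0 n; have := d2 n;
      move=> *; apply/andP; split; lra.
- move=> x; rewrite in_itv /= => /andP[ax xb].
  rewrite derive1E; apply: derive_val; apply: dF.
  by have := d0 n; move=> ?; apply/andP; split; lra.
Qed.

Lemma integrable_oo_primitive (R : realType) (f F : R -> R) (a b K : R) :
  a < b -> (forall x, a < x < b -> 0 <= f x) ->
  {in `]a, b[, continuous f} ->
  (forall x, a < x < b -> is_derive x 1 F (f x)) ->
  (forall x y, a < x -> x < y -> y < b -> F y - F x <= K) ->
  (@lebesgue_measure R).-integrable `]a, b[ (EFin \o f) /\
  \int[@lebesgue_measure R]_(x in `]a, b[) f x <= K.
Proof.
move=> ab f0 cf dF FK.
have le_int := integral_oo_le_primitive ab f0 cf dF FK.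
have fin : (@lebesgue_measure R).-integrable `]a, b[ (EFin \o f).
  apply/integrableP; split.
    apply/measurable_EFinP; apply: open_continuous_measurable_fun => //.
    by move=> x; rewrite inE => xab; apply: cf.
  apply: le_lt_trans (ltry K); apply: le_trans le_int.
  rewrite le_eqVlt; apply/orP; left; apply/eqP; apply: eq_integral => x.
  by rewrite inE /= in_itv /= => xab; rewrite ger0_norm// f0.
split=> //.
have fn : (\int[@lebesgue_measure R]_(x in `]a, b[) (f x)%:E)%E \is a fin_num.
  exact: (integrable_fin_num _ fin).
by rewrite -lee_fin /Rintegral fineK.
Qed.

Lemma is_derive_powR_subl (R : realType) (b p x : R) : x < b ->
  is_derive x 1 (fun s => (b - s) `^ p) (- (p * (b - x) `^ (p - 1))).
Proof.
move=> xb; rewrite -subr_gt0 in xb.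
have db : is_derive x 1 (fun s => b - s) (-1).
  by apply: is_derive_eq; rewrite add0r mul1r.
have := @is_derive1_comp R (@powR R ^~ p) (fun s => b - s) x _ _ (is_derive1_powR p xb) db.
by rewrite mulrN1.
Qed.

Lemma is_derive_powR_subr (R : realType) (a p x : R) : a < x ->
  is_derive x 1 (fun s => (s - a) `^ p) (p * (x - a) `^ (p - 1)).
Proof.
move=> ax; rewrite -subr_gt0 in ax.
have da : is_derive x 1 (fun s => s - a) 1.
  by apply: is_derive_eq; rewrite subr0.
have := @is_derive1_comp R (@powR R ^~ p) (fun s => s - a) x _ _ (is_derive1_powR p ax) da.
by rewrite mulr1.
Qed.

Lemma is_derive_continuous (R : realType) (f : R -> R) (x l : R) :
  is_derive x 1 f l -> {for x, continuous f}.
Proof.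
by move=> h; apply/differentiable_continuous/derivable1_diffP; exact: ex_derive.
Qed.

Lemma integrable_powR_left (R : realType) (a b p : R) : a < b -> 0 < p ->
  (@lebesgue_measure R).-integrable `]a, b[ (EFin \o (fun s => (s - a) `^ (p - 1))) /\
  \int[@lebesgue_measure R]_(s in `]a, b[) (s - a) `^ (p - 1) <= (b - a) `^ p / p.
Proof.
move=> ab p0.
apply: (@integrable_oo_primitive _ _ (fun s => p^-1 * (s - a) `^ p)) => //.
- by move=> x _; exact: powR_ge0.
- move=> x; rewrite in_itv /= => /andP[ax _].
  exact: (is_derive_continuous (is_derive_powR_subr (p - 1) ax)).
- move=> x /andP[ax _]; have h := is_derive_powR_subr p ax.
  apply: is_derive_eq.
  by rewrite /GRing.scale /= mulrA mulVf ?mul1r ?gt_eqF.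
- move=> x y ax xy yb; rewrite -mulrBr mulrC ler_pM2r ?invr_gt0// lerBlDr.
  apply: (@le_trans _ _ ((b - a) `^ p)); last by rewrite lerDl powR_ge0.
  by apply: ge0_ler_powR; rewrite ?nnegrE ?subr_ge0 ?lerD2r ?ltW// (lt_trans ax).
Qed.

Lemma integrable_powR_right (R : realType) (a b p : R) : a < b -> 0 < p ->
  (@lebesgue_measure R).-integrable `]a, b[ (EFin \o (fun s => (b - s) `^ (p - 1))) /\
  \int[@lebesgue_measure R]_(s in `]a, b[) (b - s) `^ (p - 1) <= (b - a) `^ p / p.
Proof.
move=> ab p0.
apply: (@integrable_oo_primitive _ _ (fun s => (- p^-1) * (b - s) `^ p)) => //.
- by move=> x _; exact: powR_ge0.
- move=> x; rewrite in_itv /= => /andP[_ xb].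
  exact: (is_derive_continuous (is_derive_powR_subl (p - 1) xb)).
- move=> x /andP[_ xb]; have h := is_derive_powR_subl p xb.
  apply: is_derive_eq.
  by rewrite /GRing.scale /= mulrNN mulrA mulVf ?mul1r ?gt_eqF.
- move=> x y ax xy yb; rewrite -mulrBr mulNr -mulrN opprB mulrC ler_pM2r ?invr_gt0// lerBlDr.
  apply: (@le_trans _ _ ((b - a) `^ p)); last by rewrite lerDl powR_ge0.
  by apply: ge0_ler_powR; rewrite ?nnegrE ?subr_ge0 ?lerD2l ?lerN2 ?ltW// (lt_trans xy).
Qed.

Lemma integrable_ooZ (R : realType) (f : R -> R) (a b k : R) :
  (@lebesgue_measure R).-integrable `]a, b[ (EFin \o f) ->
  (@lebesgue_measure R).-integrable `]a, b[ (EFin \o (fun x => k * f x)).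
Proof.
move=> fint; rewrite (_ : EFin \o _ = (fun x => k%:E * (EFin \o f) x)%E); last first.
  by apply/funext => x /=; rewrite EFinM.
exact: integrableZl.
Qed.

Lemma integrable_ooD (R : realType) (f g : R -> R) (a b : R) :
  (@lebesgue_measure R).-integrable `]a, b[ (EFin \o f) ->
  (@lebesgue_measure R).-integrable `]a, b[ (EFin \o g) ->
  (@lebesgue_measure R).-integrable `]a, b[ (EFin \o (fun x => f x + g x)).
Proof.
move=> fint gint; rewrite (_ : EFin \o _ = ((EFin \o f) \+ (EFin \o g))%E); last first.
  by apply/funext => x /=; rewrite EFinD.
exact: integrableD.
Qed.

Lemma integrable_ooB (R : realType) (f g : R -> R) (a b : R) :
  (@lebesgue_measure R).-integrable `]a, b[ (EFin \o f) ->
  (@lebesgue_measure R).-integrable `]a, b[ (EFin \o g) ->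
  (@lebesgue_measure R).-integrable `]a, b[ (EFin \o (fun x => f x - g x)).
Proof.
move=> fint gint; rewrite (_ : EFin \o _ = ((EFin \o f) \- (EFin \o g))%E); last first.
  by apply/funext => x /=; rewrite EFinB.
exact: integrableB.
Qed.

Lemma integrable_oo_cst (R : realType) (a b r : R) :
  (@lebesgue_measure R).-integrable `]a, b[ (EFin \o cst r).
Proof.
apply: measurable_bounded_integrable => //=.
  by rewrite lebesgue_measure_itv /=; case: ifP => // _; exact: ltry.
exists `|r|; split; first exact: num_real.
by move=> x rx y _ /=; exact: ltW.
Qed.

Lemma Rintegral_oo_cst (R : realType) (a b r : R) : a <= b ->
  \int[@lebesgue_measure R]_(x in `]a, b[) r = r * (b - a).
Proof.
move=> ab; rewrite Rintegral_cst//= lebesgue_measure_itv /= lte_fin.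
move: ab; rewrite le_eqVlt => /predU1P[->|->]; last by rewrite -EFinB.
by rewrite ltxx subrr.
Qed.

Lemma integrable_ooS (R : realType) (f : R -> R) (a b a' b' : R) :
  a <= a' -> b' <= b -> (@lebesgue_measure R).-integrable `]a, b[ (EFin \o f) ->
  (@lebesgue_measure R).-integrable `]a', b'[ (EFin \o f).
Proof.
move=> aa bb; apply: integrableS => //.
by apply: subset_itv; rewrite bnd_simp.
Qed.

Lemma Rintegral_oo_split (R : realType) (f : R -> R) (a b c : R) :
  a < b -> b < c -> (@lebesgue_measure R).-integrable `]a, c[ (EFin \o f) ->
  \int[@lebesgue_measure R]_(x in `]a, c[) f x =
  \int[@lebesgue_measure R]_(x in `]a, b[) f x +
  \int[@lebesgue_measure R]_(x in `]b, c[) f x.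
Proof.
move=> ab bc fint.
have fab := integrable_ooS (lexx a) (ltW bc) fint.
have fbc := integrable_ooS (ltW ab) (lexx c) fint.
have fac : (@lebesgue_measure R).-integrable (`]a, b] `|` `]b, c[)%classic (EFin \o f).
  by rewrite -itv_bndbnd_setU// ?bnd_simp// ltW.
rewrite (@itv_bndbnd_setU _ _ _ (BRight b))// ?bnd_simp ?ltW//.
rewrite Rintegral_setU//; last first.
  apply/disj_setPS => x [] /=; rewrite !in_itv /= => /andP[_ xb] /andP[bx _].
  by move: (lt_le_trans bx xb); rewrite ltxx.
congr (_ + _); rewrite /Rintegral; congr fine.
apply: integral_itv_bndoo; exact: (measurable_int _ fab).
Qed.

(** * Cell integrals of the weakly singular kernel *)

Section kernel.
Context (R : realType) (alpha c T : R).
Hypotheses (alpha01 : 0 < alpha < 1) (c0 : 0 < c).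
Local Notation mu := (@lebesgue_measure R).
Local Notation W s := (c * (T - s) `^ (- alpha)).

Let al0 : 0 < alpha. Proof. by case/andP: alpha01. Qed.
Let al1 : 0 < 1 - alpha. Proof. by rewrite subr_gt0; case/andP: alpha01. Qed.

Lemma kernel_integrable (a b : R) : a < b -> b <= T ->
  mu.-integrable `]a, b[ (EFin \o (fun s => W s)).
Proof.
move=> ab bT.
have [+ _] := integrable_powR_right (lt_le_trans ab bT) al1.
rewrite [1 - alpha - 1](_ : _ = - alpha); last by ring.
move=> /(integrable_ooS (lexx a) bT) fint.
exact: integrable_ooZ.
Qed.

Lemma kernel_integral_ge (a b : R) : a < b -> b <= T ->
  W a * (b - a) <= \int[mu]_(s in `]a, b[) W s.
Proof.
move=> ab bT; rewrite -Rintegral_oo_cst; last exact: ltW.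
apply: le_Rintegral => //.
- exact: integrable_oo_cst.
- exact: kernel_integrable.
- move=> s; rewrite /= in_itv /= => /andP[sa sb]; rewrite ler_pM2l//.
  apply: ler_powRN; rewrite ?ltW// ?subr_gt0//; first exact: lt_le_trans bT.
  by rewrite ler_ltB.
Qed.

Lemma kernel_integral_le (a b : R) : a < b -> b < T ->
  \int[mu]_(s in `]a, b[) W s <= W b * (b - a).
Proof.
move=> ab bT; rewrite -Rintegral_oo_cst; last exact: ltW.
apply: le_Rintegral => //.
- exact: kernel_integrable (ltW bT).
- exact: integrable_oo_cst.
- move=> s; rewrite /= in_itv /= => /andP[sa sb]; rewrite ler_pM2l//.
  by apply: ler_powRN; rewrite ?ltW// ?subr_gt0// ?ler_ltB// ltW.
Qed.

Lemma kernel_integral_diag (a : R) : a < T ->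
  \int[mu]_(s in `]a, T[) W s <= c / (1 - alpha) * (T - a) `^ (1 - alpha).
Proof.
move=> aT.
have [+] := integrable_powR_right aT al1.
rewrite [1 - alpha - 1](_ : _ = - alpha); last by ring.
move=> fint fle; rewrite RintegralZl//.
by rewrite mulrAC -mulrA ler_pM2l.
Qed.

(* [T - s >= (T / b) * (b - s)] for [0 <= s <= b <= T]. *)
Lemma kernel_rescale (b s : R) : 0 < b -> b <= T -> 0 < s < b ->
  W s <= (T / b) `^ (- alpha) * (c * (b - s) `^ (- alpha)).
Proof.
move=> b0 bT /andP[s0 sb].
have T0 : 0 < T by exact: lt_le_trans bT.
rewrite [leRHS]mulrCA ler_pM2l// -powRM; last 2 first.
- by rewrite divr_ge0// ltW.
- by rewrite subr_ge0 ltW.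
apply: ler_powRN; [exact: ltW| |].
  by rewrite mulr_gt0 ?divr_gt0// subr_gt0.
rewrite mulrBr divfK ?gt_eqF// lerD2l lerN2; apply: ler_peMl; first exact: ltW.
by rewrite ler_pdivlMr// mul1r.
Qed.

(** After [kernel_rescale] the singularity sits at [b] and integrates to a multiple of
    [b ^ (1 - alpha)]. The powers of [b] recombine and leave the decay [T ^ (- alpha)], even when
    [b = T]. *)
Lemma kernel_integral_first (b : R) : 0 < b -> b <= T ->
  \int[mu]_(s in `]0, b[) W s <= c / (1 - alpha) * T `^ (- alpha) * b.
Proof.
move=> b0 bT.
have T0 : 0 < T by exact: lt_le_trans bT.
have [+] := integrable_powR_right b0 al1.
rewrite [1 - alpha - 1](_ : _ = - alpha); last by ring.
move=> fint fle.
apply: (@le_trans _ _ (\int[mu]_(s in `]0, b[)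
   ((T / b) `^ (- alpha) * c * (b - s) `^ (- alpha)))).
  apply: le_Rintegral => //; first exact: kernel_integrable.
    exact: integrable_ooZ.
  by move=> s; rewrite /= in_itv /= -mulrA; exact: kernel_rescale.
rewrite RintegralZl//.
apply: (@le_trans _ _ ((T / b) `^ (- alpha) * c * (b `^ (1 - alpha) / (1 - alpha)))).
  rewrite subr0 in fle; apply: ler_wpM2l fle.
  by rewrite mulr_ge0 ?powR_ge0 ?ltW.
have bE : b `^ (1 - alpha) = b * b `^ (- alpha).
  by rewrite powRD ?powRr1 ?ltW// gt_eqF ?implybT.
have TE : (T / b) `^ (- alpha) * b `^ (- alpha) = T `^ (- alpha).
  by rewrite -powRM ?divr_ge0 ?ltW// divfK ?gt_eqF.
rewrite -TE bE le_eqVlt; apply/orP; left; apply/eqP.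
by field; rewrite gt_eqF.
Qed.

End kernel.

Lemma Rintegral_dominated (R : realType) (f g : R -> R) (a b : R) :
  measurable_fun `]a, b[ f -> (forall x, a < x < b -> `|f x| <= g x) ->
  (@lebesgue_measure R).-integrable `]a, b[ (EFin \o g) ->
  (@lebesgue_measure R).-integrable `]a, b[ (EFin \o f) /\
  `|\int[@lebesgue_measure R]_(x in `]a, b[) f x| <=
    \int[@lebesgue_measure R]_(x in `]a, b[) g x.
Proof.
move=> mf fg gint.
have fint : (@lebesgue_measure R).-integrable `]a, b[ (EFin \o f).
  apply: le_integrable gint => //; first exact/measurable_EFinP.
  move=> x; rewrite /= in_itv lee_fin /= => xab; apply: le_trans (fg x xab) _.
  exact: ler_norm.
split=> //; apply: le_trans; first exact: le_normr_Rintegral.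
by apply: le_Rintegral => //; exact: integrable_norm.
Qed.

(** * Truncation error cell by cell: [T] is the current node, [Te] the end of the interval on which
    [v] is regular *)

Section truncation.
Context (R : realType) (alpha sigma c C1 C2 Te T : R) (v dv ddv : R -> R).
Hypotheses (alpha01 : 0 < alpha < 1) (sigma01 : 0 < sigma < 1) (c0 : 0 < c).
Hypotheses (vcont : {within `[0, Te], continuous v}) (T0 : 0 < T) (TTe : T <= Te).
Hypothesis (dvP : forall s : R, 0 < s < Te -> is_derive s 1 v (dv s)).
Hypothesis (ddvP : forall s : R, 0 < s < Te -> is_derive s 1 dv (ddv s)).
Hypothesis (dv_le : forall s : R, 0 < s < Te -> `|dv s| <= C1 * s `^ (sigma - 1)).
Hypothesis (ddv_le : forall s : R, 0 < s < Te -> `|ddv s| <= C2 * s `^ (sigma - 2)).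
Local Notation mu := (@lebesgue_measure R).
Local Notation W s := (c * (T - s) `^ (- alpha)).
Local Notation avg a b := ((b - a)^-1 * \int[mu]_(s in `]a, b[) W s).

Let sg0 : 0 < sigma. Proof. by case/andP: sigma01. Qed.
Let al0 : 0 < alpha. Proof. by case/andP: alpha01. Qed.
Let al1 : 0 < 1 - alpha. Proof. by rewrite subr_gt0; case/andP: alpha01. Qed.
Let Te0 : 0 < Te. Proof. exact: lt_le_trans TTe. Qed.

Let C10 : 0 <= C1.
Proof.
have h : 0 < Te / 2 < Te by have := Te0; lra.
have := le_trans (normr_ge0 _) (dv_le h).
by rewrite pmulr_lge0// powR_gt0//; case/andP: h.
Qed.

Let C20 : 0 <= C2.
Proof.
have h : 0 < Te / 2 < Te by have := Te0; lra.
have := le_trans (normr_ge0 _) (ddv_le h).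
by rewrite pmulr_lge0// powR_gt0//; case/andP: h.
Qed.

Let v_within (a b : R) : 0 <= a -> b <= Te -> {within `[a, b], continuous v}.
Proof.
move=> a0 bT; apply: continuous_subspaceW vcont.
by apply: subset_itv; rewrite bnd_simp.
Qed.

Let dv_continuous (s : R) : 0 < s < Te -> {for s, continuous dv}.
Proof. by move=> sT; exact: is_derive_continuous (ddvP sT). Qed.

Let dv_measurable (a b : R) : 0 <= a -> b <= Te -> measurable_fun `]a, b[ dv.
Proof.
move=> a0 bT; apply: open_continuous_measurable_fun => //.
move=> s; rewrite inE /= in_itv /= => /andP[ls sb]; apply: dv_continuous.
by rewrite (le_lt_trans a0)// (lt_le_trans sb).
Qed.

Let W_measurable (a b : R) : a < b -> b <= T -> measurable_fun `]a, b[ (fun s => W s).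
Proof.
by move=> ab bT; have /integrableP[/measurable_EFinP] := kernel_integrable c alpha01 ab bT.
Qed.

(** [v] is merely continuous at 0. On [[x, b]] with [x > 0] the derivative bound makes
    [K * s ^ sigma - v] and [K * s ^ sigma + v] nondecreasing for [K = C1 / sigma]; then [x] tends
    to 0. *)
Lemma increment_first (b : R) : 0 < b -> b <= Te -> `|v b - v 0| <= C1 / sigma * b `^ sigma.
Proof.
move=> b0 bT.
have incr x : 0 < x -> x < b -> `|v b - v x| <= C1 / sigma * b `^ sigma.
  move=> x0 xb; pose K := C1 / sigma.
  have side (e : R) : `|e| <= 1 -> e * (v b - v x) <= K * b `^ sigma.
    move=> e1.
    have [||y] := @MVT R (fun s => K * s `^ sigma - e * v s)
      (fun s => K * (sigma * s `^ (sigma - 1)) - e * dv s) x b xb.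
    - move=> s; rewrite in_itv /= => /andP[xs sb].
      have s0 := lt_trans x0 xs.
      have h1 := is_derive1_powR sigma s0.
      have h2 : is_derive s 1 v (dv s) by apply: dvP; rewrite s0 (lt_le_trans sb).
      exact: is_deriveB.
    - have vc : {within `[x, b], continuous (fun s => e * v s)}.
        move=> s; apply: cvgM; first exact: cvg_cst.
        exact: (v_within (ltW x0) bT).
      have pc : {within `[x, b], continuous (fun s => K * s `^ sigma)}.
        apply: continuous_in_subspaceT => s; rewrite inE /= in_itv /= => /andP[xs _].
        apply: cvgM; first exact: cvg_cst.
        exact: is_derive_continuous (is_derive1_powR sigma (lt_le_trans x0 xs)).
      by move=> s; apply: cvgB; [exact: pc|exact: vc].
    rewrite in_itv /= => /andP[xy yb] mvt.
    have y0 := lt_trans x0 xy.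
    have dy : 0 <= K * (sigma * y `^ (sigma - 1)) - e * dv y.
      rewrite subr_ge0 mulrA divfK ?gt_eqF//.
      have := dv_le (s := y); rewrite y0 (lt_le_trans yb bT) => /(_ isT).
      apply: le_trans; rewrite (le_trans (ler_norm _))// normrM.
      by rewrite ler_piMl.
    have := mulr_ge0 dy (ltW (_ : 0 < b - x)); rewrite subr_gt0 -mvt => /(_ xb).
    have : 0 <= K * x `^ sigma by rewrite mulr_ge0 ?powR_ge0// divr_ge0// ltW.
    by rewrite mulrBr; lra.
  rewrite ler_norml; apply/andP; split; last first.
    by have := side 1; rewrite normr1 mul1r; apply.
  by have := side (-1); rewrite normrN1 mulN1r lerNl; apply.
have [_ v0 _] := (continuous_within_itvP v Te0).1 vcont.
apply/ler_addgt0Pr => e e0.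
near (0 : R)^'+ => x.
have x0 : 0 < x by near: x; exact: nbhs_right_gt.
have xb : x < b by near: x; exact: nbhs_right_lt.
have vx : `|v 0 - v x| <= e.
  by near: x; move/cvgrPdist_le : v0; apply.
rewrite (_ : v b - v 0 = (v b - v x) + (v x - v 0)); last by ring.
apply: le_trans (ler_normD _ _) _; apply: lerD; first exact: incr.
by rewrite distrC.
Unshelve. all: by end_near. Qed.

(** The mean slope is the value of [dv] at an interior point, so the difference is an increment of
    [dv], controlled by [ddv]. As [sigma < 2], the weight [s ^ (sigma - 2)] is largest at the left
    end [a]. *)
Lemma slope_oscillation (a b s : R) : 0 < a -> a < b -> b <= Te -> a < s < b ->
  `|dv s - (v b - v a) / (b - a)| <= C2 * a `^ (sigma - 2) * (b - a).
Proof.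
move=> a0 ab bT /andP[ls sb].
have in0T x : a < x -> x < b -> 0 < x < Te.
  by move=> ax xb; rewrite (lt_trans a0) ?(lt_le_trans xb).
have [||y] := @MVT R v dv a b ab.
- by move=> x; rewrite in_itv /= => /andP[ax xb]; apply: dvP; exact: in0T.
- exact: v_within (ltW a0) bT.
rewrite in_itv /= => /andP[ay yb] ->; rewrite mulfK ?gt_eqF ?subr_gt0//.
have lip x z : a < x -> x < z -> z < b ->
    `|dv z - dv x| <= C2 * a `^ (sigma - 2) * (b - a).
  move=> ax xz zb.
  have [||w] := @MVT R dv ddv x z xz.
  - move=> w; rewrite in_itv /= => /andP[xw wz].
    by apply: ddvP; apply: in0T; [exact: lt_trans xw|exact: lt_trans zb].
  - apply: continuous_in_subspaceT => w; rewrite inE /= in_itv /= => /andP[xw wz].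
    apply: dv_continuous; apply: in0T; [exact: lt_le_trans xw|exact: le_lt_trans zb].
  rewrite in_itv /= => /andP[xw wz] ->.
  have aw := lt_trans ax xw.
  rewrite normrM; apply: ler_pM => //.
    apply: le_trans (ddv_le (in0T w aw (lt_trans wz zb))) _.
    rewrite ler_wpM2l// -[sigma - 2]opprK; apply: ler_powRN => //; last exact: ltW.
    by move: sigma01; lra.
  by rewrite ger0_norm ?subr_ge0 ?ltW// ler_ltB// ltW.
case: (ltgtP s y) => [sy|ys|->].
- by rewrite distrC; exact: lip.
- exact: lip.
- rewrite subrr normr0 mulr_ge0 ?subr_ge0 ?(ltW ab)//.
  by rewrite mulr_ge0 ?powR_ge0.
Qed.

Lemma integral_slope (a b : R) : 0 < a -> a < b -> b < Te ->
  mu.-integrable `]a, b[ (EFin \o dv) /\ \int[mu]_(s in `]a, b[) dv s = v b - v a.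
Proof.
move=> a0 ab bT.
have cdv : {within `[a, b], continuous dv}.
  apply: continuous_in_subspaceT => s; rewrite inE /= in_itv /= => /andP[xs sb].
  by apply: dv_continuous; rewrite (lt_le_trans a0)//= (le_lt_trans sb).
have cv s : a <= s <= b -> {for s, continuous v}.
  move=> /andP[xs sb]; apply: (@is_derive_continuous _ _ _ (dv s)).
  by apply: dvP; rewrite (lt_le_trans a0)//= (le_lt_trans sb).
have iab : mu.-integrable `[a, b] (EFin \o dv).
  by apply: continuous_compact_integrable => //; exact: segment_compact.
split.
  by apply: integrableS iab => //; apply: subset_itv; rewrite bnd_simp.
have mdv : measurable_fun `]a, b[ (EFin \o dv).
  by apply/measurable_EFinP; apply: dv_measurable; exact: ltW.
rewrite /Rintegral -(integral_itv_bndoo true false mdv).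
rewrite (@continuous_FTC2 _ dv v)//.
- split.
  + move=> s; rewrite in_itv /= => /andP[xs sb]; apply: ex_derive; apply: dvP.
    by rewrite (lt_trans a0)//= (lt_trans sb).
  + by apply: cvg_at_right_filter; apply: cv; rewrite lexx ltW.
  + by apply: cvg_at_left_filter; apply: cv; rewrite lexx ltW.
- move=> s; rewrite in_itv /= => /andP[xs sb]; rewrite derive1E.
  by apply: derive_val; apply: dvP; rewrite (lt_trans a0)//= (lt_trans sb).
Qed.

Let W_ge0 (s : R) : 0 <= W s. Proof. by rewrite mulr_ge0 ?powR_ge0// ltW. Qed.

Let deviation_measurable (a b m : R) : 0 <= a -> b <= Te ->
  measurable_fun `]a, b[ (fun s => dv s - m).
Proof.
move=> a0 bT; apply: measurable_funB; [exact: dv_measurable|exact: measurable_cst].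
Qed.

(* [W * dv - avg * slope] integrates [W * (dv - slope)] over the cell. *)
Let split_slope (a b m : R) : a < b -> b <= T ->
  mu.-integrable `]a, b[ (EFin \o (fun s => W s * (dv s - m))) ->
  mu.-integrable `]a, b[ (EFin \o (fun s => W s * dv s)) /\
  \int[mu]_(s in `]a, b[) (W s * dv s) =
  \int[mu]_(s in `]a, b[) (W s * (dv s - m)) + m * \int[mu]_(s in `]a, b[) W s.
Proof.
move=> ab bT dint.
have Wint := kernel_integrable c alpha01 ab bT.
have mWint := integrable_ooZ m Wint.
have eqf : (fun s => W s * dv s) = (fun s => W s * (dv s - m) + m * W s).
  by apply/funext => s; ring.
rewrite eqf; split.
  exact: integrable_ooD.
by rewrite RintegralD// RintegralZl.
Qed.

(** The kernel is singular at [T], so no cancellation is sought: the oscillation of [dv] is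
    multiplied by the full mass of the kernel on the cell. *)
Lemma truncation_last (a : R) : 0 < a -> a < T ->
  mu.-integrable `]a, T[ (EFin \o (fun s => W s * dv s)) /\
  `|\int[mu]_(s in `]a, T[) (W s * dv s) - avg a T * (v T - v a)| <=
    C2 * a `^ (sigma - 2) * (T - a) ^+ 2 * avg a T.
Proof.
move=> a0 aT.
pose m := (v T - v a) / (T - a); pose K := C2 * a `^ (sigma - 2) * (T - a).
have Wint := kernel_integrable c alpha01 aT (lexx T).
have mprod : measurable_fun `]a, T[ (fun s => W s * (dv s - m)).
  apply: measurable_funM; first exact: W_measurable.
  by apply: deviation_measurable => //; exact: ltW.
have dom s : a < s < T -> `|W s * (dv s - m)| <= K * W s.
  move=> sT; rewrite normrM mulrC [`|c * _|]ger0_norm; last exact: W_ge0.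
  by apply: ler_wpM2r => //; exact: slope_oscillation.
have [dint] := Rintegral_dominated mprod dom
  (integrable_ooZ K Wint).
rewrite RintegralZl// => dle.
have [fint ->] := split_slope aT (lexx T) dint; split=> //.
have T_a : T - a != 0 by rewrite gt_eqF// subr_gt0.
have -> : avg a T * (v T - v a) = m * \int[mu]_(s in `]a, T[) W s.
  by rewrite /m; ring.
rewrite addrK; apply: le_trans dle _.
by rewrite /K le_eqVlt; apply/orP; left; apply/eqP; field.
Qed.

(** Away from [T], the deviation [dv - m] from the mean slope has zero integral, so the kernel may
    be replaced by its own deviation from [avg a b]. This yields the factor [W b - avg a b], which
    is at most a difference of consecutive L1 kernels; the treatment of the history rests on it. *)
Lemma truncation_middle (a b : R) : 0 < a -> a < b -> b < T ->
  mu.-integrable `]a, b[ (EFin \o (fun s => W s * dv s)) /\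
  `|\int[mu]_(s in `]a, b[) (W s * dv s) - avg a b * (v b - v a)| <=
    2 * C2 * a `^ (sigma - 2) * (b - a) ^+ 2 * (W b - avg a b).
Proof.
move=> a0 ab bT.
have bTe : b < Te := lt_le_trans bT TTe.
pose m := (v b - v a) / (b - a); pose K := C2 * a `^ (sigma - 2) * (b - a).
pose w := avg a b.
have b_a : b - a != 0 by rewrite gt_eqF// subr_gt0.
have b_a0 : 0 < b - a by rewrite subr_gt0.
have Wint := kernel_integrable c alpha01 ab (ltW bT).
have wE : \int[mu]_(s in `]a, b[) W s = w * (b - a).
  by rewrite /w mulrAC mulVf// mul1r.
have wWb : w <= W b.
  by rewrite /w ler_pdivrMl// mulrC; exact: kernel_integral_le.
have mdev : measurable_fun `]a, b[ (fun s => dv s - m).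
  by apply: deviation_measurable; exact: ltW.
have dev s : a < s < b -> `|dv s - m| <= K.
  by move=> sab; apply: slope_oscillation => //; exact: ltW.
have K0 : 0 <= K by rewrite !mulr_ge0 ?powR_ge0// ltW.
have cint r := integrable_oo_cst a b r.
have [devint _] := Rintegral_dominated mdev dev (cint K).
have WintK r : mu.-integrable `]a, b[ (EFin \o (fun s => r * W s)).
  exact: integrable_ooZ.
have mprod : measurable_fun `]a, b[ (fun s => (W s - w) * (dv s - m)).
  apply: measurable_funM => //; apply: measurable_funB.
    by apply: W_measurable => //; exact: ltW.
  exact: measurable_cst.
(* From [W s <= W b] and [w <= W b], [|W s - w|] is at most [2 * (W b - w) + (w - W s)], whose last
   part integrates to zero. The point where [W] crosses its mean need not be located. *)
pose g s := (2 * (W b - w) + w) * K - K * W s.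
have gint : mu.-integrable `]a, b[ (EFin \o g).
  exact: (integrable_ooB (cint _) (WintK K)).
have gE : \int[mu]_(s in `]a, b[) g s = 2 * K * (b - a) * (W b - w).
  rewrite RintegralB//; last exact: cint.
  by rewrite Rintegral_oo_cst ?(ltW ab)// RintegralZl// wE; ring.
have dom s : a < s < b -> `|(W s - w) * (dv s - m)| <= g s.
  move=> /[dup] sab /andP[_ sb]; rewrite normrM.
  apply: (@le_trans _ _ (`|W s - w| * K)); first by apply: ler_wpM2l => //; exact: dev.
  rewrite /g [K * _]mulrC -mulrBl; apply: ler_wpM2r => //.
  have WsWb : W s <= W b.
    rewrite ler_pM2l//; apply: ler_powRN; rewrite ?subr_gt0 ?(ltW al0)//.
    by move: sb; lra.
  by move: WsWb wWb; rewrite /=; case: (ler0P (c * (T - s) `^ (- alpha) - w)) => _; lra.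
have [pint ple] := Rintegral_dominated mprod dom gint.
have eqf : (fun s => W s * (dv s - m)) =
    (fun s => (W s - w) * (dv s - m) + w * (dv s - m)).
  by apply/funext => s; ring.
have wdint : mu.-integrable `]a, b[ (EFin \o (fun s => w * (dv s - m))).
  exact: integrable_ooZ.
have dint : mu.-integrable `]a, b[ (EFin \o (fun s => W s * (dv s - m))).
  rewrite eqf; exact: integrable_ooD.
have [fint ->] := split_slope ab (ltW bT) dint; split=> //.
have -> : w * (v b - v a) = m * \int[mu]_(s in `]a, b[) W s.
  by rewrite wE /m; field.
rewrite addrK eqf RintegralD//.
have -> : \int[mu]_(s in `]a, b[) (w * (dv s - m)) =
    w * \int[mu]_(s in `]a, b[) (dv s - m) by rewrite RintegralZl.
have [dvint dvE] := integral_slope a0 ab bTe.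
have -> : \int[mu]_(s in `]a, b[) (dv s - m) = 0.
  rewrite RintegralB//; last exact: cint.
  by rewrite dvE Rintegral_oo_cst ?(ltW ab)// /m; field.
rewrite mulr0 addr0; apply: le_trans ple _; rewrite gE.
by rewrite /K -/w le_eqVlt; apply/orP; left; apply/eqP; ring.
Qed.

(** [dv] may be singular at 0 and, if [b = T], the kernel is singular at [b]. Splitting at the
    midpoint leaves one singular factor on each half. The integral and its averaged replacement are
    bounded separately, both by a multiple of [T ^ (- alpha) * b ^ sigma]. *)
Lemma truncation_first (b : R) : 0 < b -> b <= T ->
  mu.-integrable `]0, b[ (EFin \o (fun s => W s * dv s)) /\
  `|\int[mu]_(s in `]0, b[) (W s * dv s) - avg 0 b * (v b - v 0)| <=
    C1 * c * (2 `^ alpha / sigma + 2 `^ (1 - sigma) / (1 - alpha) +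
              (sigma * (1 - alpha))^-1) * T `^ (- alpha) * b `^ sigma.
Proof.
move=> b0 bT.
have bTe : b <= Te := le_trans bT TTe.
pose Q := (T / b) `^ (- alpha).
have QE : Q * b `^ (- alpha) = T `^ (- alpha).
  by rewrite /Q -powRM ?divr_ge0 ?(ltW b0) ?(ltW T0)// divfK ?gt_eqF.
pose h := b / 2; have h0 : 0 < h by rewrite divr_gt0.
(* [A] and [B] freeze the regular factor of each half at the midpoint [h]. This is the origin of the
   powers of 2 in the constant; its third summand comes from the averaged term. *)
pose A := C1 * c * Q * h `^ (- alpha).
pose B := C1 * c * Q * h `^ (sigma - 1).
have Q0 : 0 <= Q by exact: powR_ge0.
have A0 : 0 <= A by rewrite !mulr_ge0 ?powR_ge0// ltW.
have B0 : 0 <= B by rewrite !mulr_ge0 ?powR_ge0// ltW.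
have [lint lle] := integrable_powR_left b0 sg0.
have [+] := integrable_powR_right b0 al1.
rewrite [1 - alpha - 1](_ : _ = - alpha); last by ring.
move=> rint rle.
pose g s := A * (s - 0) `^ (sigma - 1) + B * (b - s) `^ (- alpha).
have Alint := integrable_ooZ A lint.
have Brint := integrable_ooZ B rint.
have gint : mu.-integrable `]0, b[ (EFin \o g).
  exact: (integrable_ooD Alint Brint).
have dom s : 0 < s < b -> `|W s * dv s| <= g s.
  move=> /[dup] s0b /andP[s0 sb]; rewrite normrM ger0_norm; last exact: W_ge0.
  have dvs : `|dv s| <= C1 * s `^ (sigma - 1).
    by apply: dv_le; rewrite s0 (lt_le_trans sb).
  apply: le_trans (ler_pM (W_ge0 s) (normr_ge0 _) (kernel_rescale alpha01 c0 b0 bT s0b) dvs) _.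
  rewrite -/Q /g subr0 /A /B.
  have -> : Q * (c * (b - s) `^ (- alpha)) * (C1 * s `^ (sigma - 1)) =
    C1 * c * Q * ((b - s) `^ (- alpha) * s `^ (sigma - 1)) by ring.
  rewrite -[leRHS](_ : C1 * c * Q * (h `^ (- alpha) * s `^ (sigma - 1) +
    h `^ (sigma - 1) * (b - s) `^ (- alpha)) = _); last by ring.
  apply: ler_wpM2l.
    by rewrite !mulr_ge0// ltW.
  have p1 : 0 <= s `^ (sigma - 1) by exact: powR_ge0.
  have p2 : 0 <= (b - s) `^ (- alpha) by exact: powR_ge0.
  have [sh|hs] := leP s h.
    apply: (@le_trans _ _ (h `^ (- alpha) * s `^ (sigma - 1))).
      apply: ler_wpM2r => //; apply: ler_powRN => //; first exact: ltW.
      by move: sh; rewrite /h; lra.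
    by rewrite lerDl mulr_ge0// powR_ge0.
  apply: (@le_trans _ _ (h `^ (sigma - 1) * (b - s) `^ (- alpha))).
    rewrite mulrC; apply: ler_wpM2r => //.
    rewrite -[sigma - 1]opprK; apply: ler_powRN => //; last exact: ltW.
    by case/andP: sigma01 => ? ?; lra.
  by rewrite lerDr mulr_ge0// powR_ge0.
have mf : measurable_fun `]0, b[ (fun s => W s * dv s).
  by apply: measurable_funM; [exact: W_measurable|exact: dv_measurable].
have [fint fle] := Rintegral_dominated mf dom gint; split=> //.
apply: le_trans (ler_normB _ _) _.
have gle : \int[mu]_(s in `]0, b[) g s <=
    C1 * c * (2 `^ alpha / sigma + 2 `^ (1 - sigma) / (1 - alpha)) *
      T `^ (- alpha) * b `^ sigma.
  rewrite RintegralD// !RintegralZl//.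
  rewrite subr0 in lle rle.
  apply: le_trans (lerD (ler_wpM2l A0 lle) (ler_wpM2l B0 rle)) _.
  have bE : b `^ (1 - alpha) = b * b `^ (- alpha).
    by rewrite powRD ?powRr1 ?(ltW b0)// (gt_eqF b0) implybT.
  have b1 : b * b `^ (sigma - 1) = b `^ sigma by rewrite mulr_powRB1 ?ltW.
  have hE (p : R) : h `^ p = b `^ p * 2 `^ (- p).
    rewrite /h powRM ?(ltW b0) ?invr_ge0//; congr (_ * _).
    by rewrite -powR_inv1// -powRrM mulN1r.
  rewrite /A /B !hE bE -QE -b1 opprK opprB.
  have al1' := al1; have sg0' := sg0.
  by rewrite le_eqVlt; apply/orP; left; apply/eqP; field; rewrite !gt_eqF.
have avgle : `|avg 0 b * (v b - v 0)| <=
    C1 * c * (sigma * (1 - alpha))^-1 * T `^ (- alpha) * b `^ sigma.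
  rewrite subr0 normrM ger0_norm; last first.
    by rewrite mulr_ge0 ?invr_ge0 ?(ltW b0)// Rintegral_ge0.
  have inc := increment_first b0 bTe.
  have first := kernel_integral_first alpha01 c0 b0 bT.
  apply: (@le_trans _ _ ((c / (1 - alpha) * T `^ (- alpha)) * (C1 / sigma * b `^ sigma))).
    apply: ler_pM => //; first by rewrite mulr_ge0 ?invr_ge0 ?(ltW b0)// Rintegral_ge0.
    by rewrite ler_pdivrMl// mulrC.
  rewrite le_eqVlt; apply/orP; left; apply/eqP.
  have al1' := al1; have sg0' := sg0.
  by field; rewrite !gt_eqF.
apply: le_trans (lerD (le_trans fle gle) avgle) _.
by rewrite le_eqVlt; apply/orP; left; apply/eqP; ring.
Qed.

End truncation.

(** The bound is shaped to be cancelled: its sum is, up to sign, the history part of [l1_op a G j]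
    in [l1_opE]. [G 1 = 0] because the first cell is accounted for by the [t j ^ (- alpha)] term;
    the factor 2 in [G] comes from the middle cells. *)
Lemma l1_truncation (R : realType) (alpha sigma c C1 C2 Te : R) (v dv ddv : R -> R)
    (a : nat -> nat -> R) (t G : nat -> R) (j : nat) :
  0 < alpha < 1 -> 0 < sigma < 1 -> 0 < c ->
  {within `[0, Te], continuous v} ->
  (forall s : R, 0 < s < Te -> is_derive s 1 v (dv s)) ->
  (forall s : R, 0 < s < Te -> is_derive s 1 dv (ddv s)) ->
  (forall s : R, 0 < s < Te -> `|dv s| <= C1 * s `^ (sigma - 1)) ->
  (forall s : R, 0 < s < Te -> `|ddv s| <= C2 * s `^ (sigma - 2)) ->
  (0 < j)%N -> t 0%N = 0 -> (forall k, (k < j)%N -> t k < t k.+1) -> t j <= Te ->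
  (forall k, (1 <= k <= j)%N -> a j k = (t k - t k.-1)^-1 *
     \int[@lebesgue_measure R]_(s in `]t k.-1, t k[) (c * (t j - s) `^ (- alpha))) ->
  (forall k, G k = if (2 <= k)%N then
    2 * C2 * t k.-1 `^ (sigma - 2) * (t k - t k.-1) ^+ 2 else 0) ->
  `|\int[@lebesgue_measure R]_(s in `]0, t j[) (c * (t j - s) `^ (- alpha) * dv s)
     - l1_op a (fun k => v (t k)) j| <=
  C1 * c * (2 `^ alpha / sigma + 2 `^ (1 - sigma) / (1 - alpha) +
    (sigma * (1 - alpha))^-1) * t j `^ (- alpha) * t 1%N `^ sigma +
  (a j j * G j + \sum_(1 <= k < j) (a j k.+1 - a j k) * G k).
Proof.
move=> al sg c0 vcont dvP ddvP dv_le ddv_le j0 t0 tinc tTe aE GE.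
set K := C1 * c * _.
have tlt k l : (k < l)%N -> (l <= j)%N -> t k < t l.
  elim: l => // l IH; rewrite ltnS leq_eqVlt => /predU1P[->|kl] lj; first exact: tinc.
  by apply: lt_trans (tinc l lj); apply: IH => //; exact: ltnW.
have tpos k : (0 < k)%N -> (k <= j)%N -> 0 < t k by rewrite -t0; exact: tlt.
have tj0 := tpos j j0 (leqnn j).
pose f s := c * (t j - s) `^ (- alpha) * dv s.
have [fint _] := truncation_first al sg c0 vcont tj0 tTe dvP ddvP dv_le tj0 (lexx _).
have C20 : 0 <= C2.
  have h : 0 < t j / 2 < Te by move: tj0 tTe; lra.
  have := le_trans (normr_ge0 _) (ddv_le _ h).
  by rewrite pmulr_lge0// powR_gt0//; case/andP: h.
have G0 k : 0 <= G k.
  rewrite GE; case: ifP => // _.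
  by rewrite mulr_ge0 ?sqr_ge0// mulr_ge0 ?powR_ge0// mulr_ge0.
have main m : (1 <= m < j)%N ->
  `|\int[@lebesgue_measure R]_(s in `]0, t m[) f s
     - \sum_(1 <= k < m.+1) a j k * (v (t k) - v (t k.-1))| <=
  K * t j `^ (- alpha) * t 1%N `^ sigma + \sum_(1 <= k < m.+1) (a j k.+1 - a j k) * G k.
  elim: m => // -[_ /= j1|m IH /= mj].
    rewrite !big_nat1 /= t0 [G 1%N]GE /= mulr0 addr0 aE ?j0//= t0.
    have := truncation_first al sg c0 vcont tj0 tTe dvP ddvP dv_le
      (tpos 1%N isT j0) (ltW (tlt _ _ j1 (leqnn j))).
    by move=> [_].
  have m1j := ltnW mj; have m2j := ltnW m1j.
  have tm0 := tpos m.+1 isT m2j.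
  have tmm := tlt _ _ (ltnSn m.+1) m1j.
  have tmj := tlt _ _ mj (leqnn j).
  rewrite (Rintegral_oo_split tm0 tmm); last first.
    by apply: integrable_ooS fint; [exact: lexx|exact: ltW].
  rewrite big_nat_recr//= [in leRHS]big_nat_recr//= [X in X <= _](_ : _ =
    `|(\int[@lebesgue_measure R]_(s in `]0, t m.+1[) f s
        - \sum_(1 <= k < m.+2) a j k * (v (t k) - v (t k.-1))) +
      (\int[@lebesgue_measure R]_(s in `]t m.+1, t m.+2[) f s
        - a j m.+2 * (v (t m.+2) - v (t m.+1)))|); last by congr `|_|; ring.
  rewrite [leRHS]addrA; apply: le_trans (ler_normD _ _) _; apply: lerD; first exact: IH.
  have [_] := truncation_middle al sg c0 vcont tj0 tTe dvP ddvP ddv_le tm0 tmm tmj.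
  rewrite -[(_ - _)^-1 * _]/((t m.+2 - t m.+2.-1)^-1 * _) -aE ?leqnn//.
  move=> h; apply: le_trans h _; rewrite GE /= mulrC; apply: ler_wpM2r.
    by have := G0 m.+2; rewrite GE.
  (* The kernel at the right end of a cell is at most its mean over the next cell, which turns the
     factor of [truncation_middle] into a kernel difference. *)
  rewrite lerD2r (aE m.+3)//=.
  have tm3 := tlt _ _ (ltnSn m.+2) mj.
  rewrite ler_pdivlMl ?subr_gt0// mulrC.
  apply: kernel_integral_ge => //.
  by case: (ltngtP m.+3 j) mj => // [h _|<- _]; [exact: ltW (tlt _ _ h _)|].
(* For [j = 1] the first cell is also the last, and [truncation_first] alone gives the claim. *)
case: j @f j0 t0 tinc tTe aE tlt tpos tj0 fint main => // -[|m] f _ t0 tinc tTe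
  aE tlt tpos tj0 fint main.
  have [_] := truncation_first al sg c0 vcont tj0 tTe dvP ddvP dv_le tj0 (lexx _).
  rewrite /l1_op big_nat1 big_geq// addr0 /= [G 1%N]GE /= mulr0 addr0 (aE 1%N)//= t0.
  by [].
have tm0 := tpos m.+1 isT (leqnSn _).
have tmm := tlt _ _ (ltnSn m.+1) (leqnn _).
rewrite (Rintegral_oo_split tm0 tmm)// /l1_op big_nat_recr//= [X in X <= _](_ : _ =
    `|(\int[@lebesgue_measure R]_(s in `]0, t m.+1[) f s
        - \sum_(1 <= k < m.+2) a m.+2 k * (v (t k) - v (t k.-1))) +
      (\int[@lebesgue_measure R]_(s in `]t m.+1, t m.+2[) f s
        - a m.+2 m.+2 * (v (t m.+2) - v (t m.+1)))|); last by congr `|_|; ring.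
rewrite [leRHS](_ : _ = (K * t m.+2 `^ (- alpha) * t 1%N `^ sigma +
    \sum_(1 <= k < m.+2) (a m.+2 k.+1 - a m.+2 k) * G k) + a m.+2 m.+2 * G m.+2); last by ring.
apply: le_trans (ler_normD _ _) _; apply: lerD; last first.
  have [_] := truncation_last al sg c0 vcont tj0 tTe dvP ddvP ddv_le tm0 tmm.
  rewrite -[(_ - _)^-1 * _]/((t m.+2 - t m.+2.-1)^-1 * _) -aE ?leqnn//.
  move=> h; apply: le_trans h _; rewrite GE /= mulrC; apply: ler_wpM2l.
    rewrite aE ?leqnn//; apply: mulr_ge0.
      by rewrite invr_ge0 subr_ge0 ltW.
    by apply: Rintegral_ge0 => s _; rewrite mulr_ge0 ?powR_ge0// ltW.
  have : 0 <= C2 * t m.+1 `^ (sigma - 2) * (t m.+2 - t m.+1) ^+ 2.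
    by rewrite mulr_ge0 ?sqr_ge0// mulr_ge0 ?powR_ge0.
  by rewrite -!mulrA; lra.
by have := main m.+1 (ltnSn _).
Qed.

(** * The Gamma and Mittag-Leffler functions *)

(** For [s > 1], one term of the exponential series at [s / 2] dominates [s ^ p]; the other half of
    the decay is kept for integrability. *)
Lemma powR_expR_le (R : realType) (p : R) : 0 <= p ->
  exists2 K : R, 0 <= K & forall s : R, 0 < s -> s `^ p * expR (- s) <= K * expR (- s / 2).
Proof.
move=> p0; pose n := Num.trunc p.
have pn : p <= n.+1%:R by exact/ltW/truncnS_gt.
pose K : R := (n.+1)`!%:R * 2 ^+ n.+1.
have K1 : 1 <= K.
  by rewrite /K -natrX -natrM ler1n muln_gt0 fact_gt0 expn_gt0.
exists K => [|s s0]; first exact: le_trans K1.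
have sp : s `^ p <= K * expR (s / 2).
  have hs : 0 <= s / 2 by rewrite divr_ge0// ltW.
  have [s1|s1] := leP s 1.
    apply: (@le_trans _ _ 1).
      have := ge0_ler_powR p0 _ _ s1; rewrite powR1 !nnegrE ler01 (ltW s0).
      exact.
    by apply: mulr_ege1 => //; have := expR_ge1Dx (s / 2); lra.
  apply: (@le_trans _ _ (s `^ n.+1%:R)); first by apply: ler_powR => //; exact: ltW.
  rewrite powR_mulrn; last exact: ltW.
  have := expR_ge1Dxn n hs; rewrite -lerBrDl => h.
  apply: (@le_trans _ _ (K * ((s / 2) ^+ n.+1 / (n.+1)`!%:R))).
    rewrite /K expr_div_n le_eqVlt; apply/orP; left; apply/eqP; field.
    by rewrite pnatr_eq0 -lt0n fact_gt0 expf_neq0.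
  apply: ler_wpM2l; first exact: le_trans K1.
  by apply: le_trans h _; rewrite gerBl.
apply: le_trans (ler_wpM2r (expR_ge0 _) sp) _.
by rewrite -mulrA -expRD; have -> : s / 2 + - s = - s / 2 by field.
Qed.

Lemma integrable_expR_half (R : realType) (K : R) : 0 <= K ->
  (@lebesgue_measure R).-integrable `]0, +oo[ (EFin \o (fun s => K * expR (- s / 2))).
Proof.
move=> K0.
have dexp (x : R) : is_derive x 1 (fun s => expR (- s / 2)) (expR (- x / 2) * - 2^-1).
  have d1 : is_derive x 1 (fun s : R => - s / 2) (- 2^-1).
    by apply: is_derive_eq; rewrite !scaler0 add0r /GRing.scale /= mulrN1.
  exact: (@is_derive1_comp R expR (fun s => - s / 2) x _ _ (is_derive_expR _) d1).
have dE (x : R) : is_derive x 1 (fun s => - (2 * K) * expR (- s / 2)) (K * expR (- x / 2)).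
  have d2 := dexp x.
  by apply: is_derive_eq; rewrite /GRing.scale /=; field.
have cE : continuous (fun s : R => - (2 * K) * expR (- s / 2)).
  by move=> x; apply: is_derive_continuous (dE x).
have cf : continuous (fun s : R => K * expR (- s / 2)).
  move=> x; apply: cvgM; first exact: cvg_cst.
  exact: is_derive_continuous (dexp x).
have ge0 (s : R) : 0 <= K * expR (- s / 2) by rewrite mulr_ge0 ?expR_ge0.
have lim0 : (fun s : R => - (2 * K) * expR (- s / 2)) s @[s --> +oo] --> (0 : R).
  rewrite -[X in _ --> X](mulr0 (- (2 * K))); apply: cvgM; first exact: cvg_cst.
  have h : (fun s : R => s / 2) s @[s --> +oo] --> +oo.
    by apply: gt0_cvgMly => //; exact: cvg_id.
  have := cvg_comp _ _ h (@cvgr_expR R).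
  apply: cvg_trans; apply: near_eq_cvg; apply: nearW => s /=.
  by rewrite mulNr.
have FTC := @ge0_continuous_FTC2y R _ _ 0 0 (fun x _ => ge0 x)
  (continuous_subspaceT cf) lim0 (fun x _ => @ex_derive _ _ _ _ _ _ _ (dE x))
  (cvg_at_right_filter (cE 0)).
suff cint : (@lebesgue_measure R).-integrable `[0, +oo[ (EFin \o (fun s => K * expR (- s / 2))).
  by apply: integrableS cint => //; apply: subset_itv; rewrite bnd_simp.
apply/integrableP; split.
  by apply/measurable_EFinP; apply: measurable_funTS; exact: continuous_measurable_fun.
under eq_integral => x _ do rewrite /= ger0_norm//.
rewrite FTC ?ltry//.
by move=> x _; rewrite derive1E; exact: derive_val.
Qed.

(** The real-valued integral collapses to 0 when the extended one is infinite, so lower bounds on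
    [Gamma] have to start from integrability. The majorant is [s ^ (z - 1)] on the unit interval
    plus an exponential. *)
Lemma integrable_Gamma (R : realType) (z : R) : 0 < z ->
  (@lebesgue_measure R).-integrable `]0, +oo[
    (EFin \o (fun s => s `^ (z - 1) * expR (- s))).
Proof.
move=> z0; pose p := Num.max 0 (z - 1).
have p0 : 0 <= p by rewrite /p le_max lexx.
have [K K0 hK] := powR_expR_le p0.
have [+ _] := @integrable_powR_left R 0 1 z ltr01 z0.
move=> near0.
have restr : (@lebesgue_measure R).-integrable `]0, +oo[
    (EFin \o ((fun s => s `^ (z - 1)) \_ `]0, 1[)).
  rewrite -restrict_EFin; apply/integrable_restrict => //.
  rewrite (_ : _ `&` _ = `]0, 1[%classic); last first.
    apply/seteqP; split => x /=; rewrite !in_itv /=; first by case.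
    by move=> /andP[-> ->].
  apply: eq_integrable near0 => //.
  by move=> x _ /=; rewrite subr0.
have dom : (@lebesgue_measure R).-integrable `]0, +oo[
    ((EFin \o ((fun s : R => s `^ (z - 1))%R \_ `]0%R, 1%R[)) \+
     (EFin \o (fun s : R => K * expR (- s / 2))%R))%E.
  by apply: integrableD => //; exact: integrable_expR_half.
apply: le_integrable dom => //.
  apply/measurable_EFinP; apply: open_continuous_measurable_fun.
    exact: interval_open.
  move=> x; rewrite inE /= in_itv /= andbT => x0; apply: cvgM.
    exact: is_derive_continuous (is_derive1_powR (z - 1) x0).
  apply: (@continuous_comp _ _ _ (fun s : R => - s) expR); last exact: continuous_expR.
  exact: opp_continuous.
move=> s /=; rewrite in_itv /= andbT => s0.
have g0 : 0 <= s `^ (z - 1) * expR (- s) by rewrite mulr_ge0 ?powR_ge0 ?expR_ge0.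
have e0 : 0 <= K * expR (- s / 2) by rewrite mulr_ge0 ?expR_ge0.
rewrite lee_fin ger0_norm//.
rewrite patchE; case: ifPn => [s1|].
  rewrite ger0_norm ?addr_ge0 ?powR_ge0//.
  apply: (@le_trans _ _ (s `^ (z - 1))); last by rewrite lerDl.
  by rewrite ler_piMr ?powR_ge0// -expR0 ler_expR oppr_le0 ltW.
rewrite notin_setE /= in_itv /= s0 /= => /negP; rewrite -leNgt => s1.
rewrite add0r ger0_norm//; apply: le_trans (hK s s0); apply: ler_wpM2r.
  exact: expR_ge0.
by apply: ler_powR => //; rewrite /p le_max lexx orbT.
Qed.

(** A window of length one turns a pointwise lower bound into a bound of the integral. The window at
    [A = 1] gives positivity; windows further out give growth beyond any prescribed geometric
    rate. *)
Lemma Gamma_ge (R : realType) (z A m : R) : 0 < z -> 0 <= A ->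
  (forall s, A < s < A + 1 -> m <= s `^ (z - 1) * expR (- s)) ->
  m <= Gamma z.
Proof.
move=> z0 A0 hm.
have gint := integrable_Gamma z0.
have sub : `]A, A + 1[ `<=` `]0, +oo[.
  by move=> x /=; rewrite !in_itv /= andbT => /andP[+ _]; exact: le_lt_trans.
have mA : m <= \int[@lebesgue_measure R]_(s in `]A, A + 1[) (s `^ (z - 1) * expR (- s)).
  rewrite -[m]mulr1 -[X in m * X](addrK A) [1 + A]addrC -Rintegral_oo_cst ?lerDl//.
  apply: le_Rintegral => //; first exact: integrable_oo_cst.
    exact: integrableS gint.
apply: le_trans mA _; rewrite /Gamma /Rintegral; apply: fine_le.
- by apply: integrable_fin_num => //; exact: integrableS gint.
- exact: integrable_fin_num.
- apply: ge0_subset_integral => //.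
    exact: (measurable_int _ gint).
  by move=> s _; rewrite lee_fin mulr_ge0 ?powR_ge0 ?expR_ge0.
Qed.

Lemma Gamma_gt0 (R : realType) (z : R) : 0 < z -> 0 < Gamma z.
Proof.
move=> z0; pose m : R := Num.min 1 (2 `^ (z - 1)) * expR (- 2).
have m0 : 0 < m by rewrite mulr_gt0 ?expR_gt0// lt_min ltr01 powR_gt0.
apply: lt_le_trans m0 _; apply: (Gamma_ge z0 ler01) => s /andP[s1 s2].
apply: ler_pM; rewrite ?expR_ge0//.
- have [z1|z1] := leP 1 z.
    rewrite ge_min; apply/orP; left; rewrite -{1}(powRr0 s).
    by apply: ler_powR; [exact: ltW|rewrite subr_ge0].
  rewrite ge_min; apply/orP; right; rewrite -[z - 1]opprK.
  by apply: ler_powRN; [rewrite opprB subr_ge0 ltW|exact: lt_trans s1|exact: ltW].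
- by rewrite ler_expR lerN2 ltW.
Qed.

(** All terms are nonnegative, so the sum dominates its term of index 0. This uses convergence,
    since [limn] carries no information about a divergent series; hence the geometric majorant. *)
Lemma mittag_leffler_ge (R : realType) (alpha z : R) : 0 < alpha -> 0 <= z ->
  (Gamma (1 : R))^-1 <= mittag_leffler alpha z.
Proof.
move=> al0 z0.
have term0 k : 0 <= z ^+ k / Gamma (1 + k%:R * alpha).
  rewrite divr_ge0 ?exprn_ge0// ltW// Gamma_gt0//.
  by rewrite ltr_wpDr// mulr_ge0// ltW.
(* With [A ^ alpha = 2 * (z + 1)], the power in the Gamma integrand beyond [A] beats [z ^ k] by a
   factor [2 ^ k]. *)
pose A := (2 * (z + 1)) `^ alpha^-1.
have q0 : 0 < 2 * (z + 1) by rewrite mulr_gt0// ltr_wpDl.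
have A0 : 0 < A by exact: powR_gt0.
have AE : A `^ alpha = 2 * (z + 1).
  by rewrite /A -powRrM mulVf ?gt_eqF// powRr1// ltW.
have term_le k : z ^+ k / Gamma (1 + k%:R * alpha) <= expR (A + 1) * (2^-1) ^+ k.
  have ka0 : 0 <= k%:R * alpha by rewrite mulr_ge0// ltW.
  have z10 : 0 < 1 + k%:R * alpha by rewrite ltr_wpDr.
  have G : (2 * (z + 1)) ^+ k * expR (- (A + 1)) <= Gamma (1 + k%:R * alpha).
    apply: (Gamma_ge z10 (ltW A0)) => s /andP[s1 s2].
    apply: ler_pM; rewrite ?expR_ge0 ?exprn_ge0 ?(ltW q0)//; last first.
      by rewrite ler_expR lerN2 ltW.
    rewrite -AE -powR_mulrn ?powR_ge0// -powRrM mulrC [1 + _]addrC addrK.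
    by apply: ge0_ler_powR; rewrite ?nnegrE ?(ltW A0) ?(ltW s1)//; apply/ltW/(lt_trans A0).
  rewrite ler_pdivrMr ?Gamma_gt0//.
  apply: (@le_trans _ _ (expR (A + 1) * 2^-1 ^+ k *
      ((2 * (z + 1)) ^+ k * expR (- (A + 1))))); last first.
    by apply: ler_wpM2l => //; rewrite mulr_ge0 ?expR_ge0// exprn_ge0.
  rewrite expRN exprMn.
  have -> : expR (A + 1) * 2^-1 ^+ k * (2 ^+ k * (z + 1) ^+ k * (expR (A + 1))^-1) =
      (z + 1) ^+ k.
    rewrite exprVn; field.
    by rewrite gt_eqF ?expR_gt0//= expf_neq0.
  by rewrite lerXn2r ?nnegrE// ?lerDl// ltW// ltr_wpDl.
have cv : cvgn (series (fun k => z ^+ k / Gamma (1 + k%:R * alpha))).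
  apply: (series_le_cvg term0 _ term_le).
    by move=> k; rewrite mulr_ge0 ?expR_ge0// exprn_ge0.
  have := @is_cvg_geometric_series R (expR (A + 1)) (2^-1).
  rewrite ger0_norm// invf_lt1 ?ltr1n// => /(_ isT); exact.
have nd : nondecreasing_seq (series (fun k => z ^+ k / Gamma (1 + k%:R * alpha))).
  by apply: nondecreasing_series => n _ _; exact: term0.
have := nondecreasing_cvgn_le nd cv 1%N.
by rewrite /series /= big_nat1 expr0 mul0r addr0 div1r.
Qed.

(** * Consistency of the discrete Laplacian *)

Section plane.
Context (R : realType).
Local Notation mu := (@lebesgue_measure R).
Local Notation mu2 := ((@lebesgue_measure R \x @lebesgue_measure R)%E).

(** The product sigma-algebra comes from rectangles, so an open set is exhibited as a countable
    union of boxes with rational centres and half-widths [1 / n.+1]; boxes not contained in [U] are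
    replaced by the empty set. *)
Lemma open_plane_measurable (U : set (R * R)) : open U -> measurable U.
Proof.
move=> oU.
pose box (q : rat * rat * nat) : set (R * R) :=
  `]ratr q.1.1 - q.2.+1%:R^-1, ratr q.1.1 + q.2.+1%:R^-1[%classic `*`
  `]ratr q.1.2 - q.2.+1%:R^-1, ratr q.1.2 + q.2.+1%:R^-1[%classic.
pose F q : set (R * R) := if pselect (box q `<=` U) then box q else set0.
suff -> : U = \bigcup_q F q.
  apply: countable_bigcupT_measurable => // q; rewrite /F.
  case: (pselect (box q `<=` U)) => [h|h]; last exact: measurable0.
  by apply: measurableX; exact: measurable_itv.
apply/seteqP; split=> [[x y] Uxy|p [q _]]; last first.
  by rewrite /F; case: (pselect (box q `<=` U)) => [h|h] //; exact: h.
have /nbhs_ballP[e /= e0 he] : nbhs (x, y) U by exact: open_nbhs_nbhs.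
pose n := Num.trunc (2 / e).
have n0 : 0 < n.+1%:R^-1 :> R by rewrite invr_gt0.
have ne : 2 * n.+1%:R^-1 < e.
  rewrite ltr_pdivrMr// mulrC -ltr_pdivrMr//.
  exact: truncnS_gt.
have [q1] : exists q, ratr q \in `]x - n.+1%:R^-1, x + n.+1%:R^-1[.
  by apply: rat_in_itvoo; rewrite ltrBlDr -addrA ltrDl addr_gt0.
have [q2] : exists q, ratr q \in `]y - n.+1%:R^-1, y + n.+1%:R^-1[.
  by apply: rat_in_itvoo; rewrite ltrBlDr -addrA ltrDl addr_gt0.
rewrite !in_itv /= => /andP[ya yb] /andP[xa xb].
exists (q1, q2, n) => //; rewrite /F; case: (pselect (box (q1, q2, n) `<=` U)) => [h|abs].
  by split; rewrite /= in_itv /= ltrBlDr ?xb ?yb /= -ltrBlDr.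
exfalso; apply: abs => -[x' y'] [] /=; rewrite !in_itv /= => /andP[x1 x2] /andP[y1 y2].
apply: he; move: n0 ne xa xb ya yb x1 x2 y1 y2.
move: (n.+1%:R^-1 : R) (ratr q1 : R) (ratr q2 : R) => d u w.
by move=> *; split => /=; rewrite /ball /= ltr_norml; apply/andP; split; lra.
Qed.

Lemma continuous_plane_measurable (f : R * R -> R) :
  continuous f -> measurable_fun setT f.
Proof.
move=> /continuousP cf.
apply: (measurability _ (RGenOpens.measurableE R)).
move=> _ [_ [a [b ->] <-]]; rewrite setTI; apply: open_plane_measurable.
by apply: cf; exact: interval_open.
Qed.

Let tr (a : R) (x : measurableTypeR R) : measurableTypeR R := x + a.

Let tr_measurable a : measurable_fun setT (tr a).
Proof.
apply: continuous_measurable_fun => x.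
by apply: cvgD; [exact: cvg_id|exact: cvg_cst].
Qed.

(** The translated measure agrees with Lebesgue measure on half-open intervals, which determine
    it. *)
Lemma lebesgue_translation (a : R) (A : set R) : measurable A ->
  mu ((fun x => x + a) @^-1` A) = mu A.
Proof.
move=> mA; apply/esym.
pose mphi := isMeasurableFun.Build _ _ _ _ _ (tr_measurable a).
pose phi : {mfun _ >-> _} := HB.pack (tr a) mphi.
apply: (@lebesgue_measure_unique R (pushforward mu phi)) => //.
move=> _ [[x y] _ <-] /=; rewrite /pushforward.
rewrite (_ : _ @^-1` _ = `]x - a, y - a]%classic); last first.
  by apply/seteqP; split=> z /=; rewrite !in_itv /= ltrBlDr lerBrDr.
rewrite !lebesgue_measure_itv /= !lte_fin ltrD2r; case: ifP => // _.
by rewrite -!EFinB; congr EFin; ring.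
Qed.

Let tr2 (a : R * R) (p : measurableTypeR R * measurableTypeR R) :
  measurableTypeR R * measurableTypeR R := p + a.

Let tr2_measurable a : measurable_fun setT (tr2 a).
Proof.
apply: measurable_fun_pair.
  exact: (measurableT_comp (tr_measurable a.1) measurable_fst).
exact: (measurableT_comp (tr_measurable a.2) measurable_snd).
Qed.

Lemma plane_translation (f : R * R -> R) (a : R * R) :
  measurable_fun setT f ->
  mu2.-integrable setT (EFin \o (fun p => f (p + a))) ->
  \int[mu2]_p f (p + a) = \int[mu2]_p f p.
Proof.
move=> mf fint.
pose mphi := isMeasurableFun.Build _ _ _ _ _ (tr2_measurable a).
pose phi : {mfun _ >-> _} := HB.pack (tr2 a) mphi.
have mE (X : set (R * R)) : measurable X -> mu2 X = pushforward mu2 phi X.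
  move=> mX; apply: (@product_measure_unique _ _ _ _ R mu mu (pushforward mu2 phi)) => //.
  move=> A B mA mB.
  have mtA : measurable ((fun x : R => x + a.1) @^-1` A).
    by rewrite -[X in measurable X]setTI; exact: (tr_measurable a.1).
  have mtB : measurable ((fun x : R => x + a.2) @^-1` B).
    by rewrite -[X in measurable X]setTI; exact: (tr_measurable a.2).
  transitivity (mu2 (((fun x : R => x + a.1) @^-1` A) `*`
    ((fun x : R => x + a.2) @^-1` B))); first by [].
  by rewrite product_measure1E//; congr (_ * _)%E; exact: lebesgue_translation.
rewrite /Rintegral; congr fine.
have mfe : measurable_fun setT (EFin \o f) by exact/measurable_EFinP.
have := @integral_pushforward _ _ _ _ R _ (tr2_measurable a) mu2 setT (EFin \o f) mfe fint measurableT.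
rewrite preimage_setT => <-; apply: eq_measure_integral => A mA _.
exact/esym/mE.
Qed.

(** An explicit box in place of an abstract compact set: a translation of size at most [B] just adds
    [B] to the radius. *)
Definition box_supported (A : R) (f : R * R -> R) :=
  forall p, A < `|p.1| \/ A < `|p.2| -> f p = 0.

Lemma box_supported_integrable (A : R) (f : R * R -> R) :
  continuous f -> box_supported A f -> mu2.-integrable setT (EFin \o f).
Proof.
move=> cf fA; pose B : set (R * R) := `[- A, A]%classic `*` `[- A, A]%classic.
have mB : measurable B by apply: measurableX; exact: measurable_itv.
have fin : (mu `[(- A)%R, A%R] < +oo)%E.
  by rewrite lebesgue_measure_itv /=; case: ifP => // _; exact: ltry.
have Bfin : (mu2 B < +oo)%E.
  by rewrite product_measure1E// lte_mul_pinfty// ge0_fin_numE.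
have fB : f = f \_ B.
  apply/funext => p; rewrite patchE; case: ifPn => //.
  rewrite notin_setE /B /= !in_itv /= -!ler_norml => h; apply: fA.
  have [h1|] := ltP A `|p.1|; first by left.
  have [h2|] := ltP A `|p.2|; first by right.
  by move=> h2 h1; exfalso; exact: h.
rewrite fB -restrict_EFin; apply/integrable_restrict => //; rewrite setTI.
apply: measurable_bounded_integrable => //.
- by apply: measurable_funTS; exact: continuous_plane_measurable.
- have cB : compact B by apply: compact_setX; exact: segment_compact.
  have := compact_bounded (continuous_compact (continuous_subspaceT cf) cB).
  move=> [M [Mr hM]]; exists M; split=> // x Mx p Bp.
  by apply: (hM x Mx); exists p.
Qed.

Lemma plane_tensor_integral (f g : R -> R) :
  continuous f -> continuous g -> (forall x, 0 <= f x) -> (forall x, 0 <= g x) ->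
  mu.-integrable setT (EFin \o f) -> mu.-integrable setT (EFin \o g) ->
  \int[mu2]_p (f p.1 * g p.2) = (\int[mu]_x f x) * (\int[mu]_y g y).
Proof.
move=> cf cg f0 g0 fint gint.
have cfg : continuous (fun p : R * R => f p.1 * g p.2).
  move=> p; apply: cvgM.
    by apply: continuous_comp; [exact: cvg_fst|exact: cf].
  by apply: continuous_comp; [exact: cvg_snd|exact: cg].
have mfg : measurable_fun setT (EFin \o (fun p : R * R => f p.1 * g p.2)).
  by apply/measurable_EFinP; exact: continuous_plane_measurable.
rewrite /Rintegral fubini_tonelli1//; last first.
  by move=> p; rewrite lee_fin mulr_ge0.
have gfin : (\int[mu]_y (g y)%:E)%E \is a fin_num by exact: integrable_fin_num.
rewrite (_ : (\int[mu]_x _)%E = (\int[mu]_x ((f x)%:E * \int[mu]_y (g y)%:E))%E).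
  rewrite -(fineK gfin) integralZr// fineM//.
  exact: integrable_fin_num.
apply: eq_integral => x _; rewrite /fubini_F /=.
under eq_integral do rewrite EFinM.
rewrite ge0_integralZl_EFin//.
  by move=> y _; rewrite lee_fin.
by apply/measurable_EFinP; exact: continuous_measurable_fun.
Qed.

End plane.

Section plane_differences.
Context (R : realType).
Local Notation mu2 := ((@lebesgue_measure R \x @lebesgue_measure R)%E).
Implicit Types (f u k : R * R -> R) (e p : R * R).

Definition cbox (A : R) f := continuous f /\ box_supported A f.

Lemma cbox_integrable A f : cbox A f -> mu2.-integrable setT (EFin \o f).
Proof. by case; exact: box_supported_integrable. Qed.

Lemma cboxD A f u : cbox A f -> cbox A u -> cbox A (fun p => f p + u p).
Proof.
move=> [cf sf] [cu su]; split=> [p|p pA]; first by apply: cvgD; [exact: cf|exact: cu].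
by rewrite sf// su// addr0.
Qed.

Lemma cboxMl A f u : continuous u -> cbox A f -> cbox A (fun p => u p * f p).
Proof.
move=> cu [cf sf]; split=> [p|p pA]; first by apply: cvgM; [exact: cu|exact: cf].
by rewrite sf// mulr0.
Qed.

Lemma cboxZ A f (c : R) : cbox A f -> cbox A (fun p => c * f p).
Proof. by apply: cboxMl => p; exact: cvg_cst. Qed.

Lemma continuous_translate f (a : R * R) : continuous f -> continuous (fun p => f (p + a)).
Proof.
move=> cf p; apply: (@continuous_comp _ _ _ (fun q : R * R => q + a) f); last exact: cf.
by apply: cvgD; [exact: cvg_id|exact: cvg_cst].
Qed.

Lemma cbox_translate A B f (a : R * R) : `|a.1| <= B -> `|a.2| <= B ->
  cbox A f -> cbox (A + B) (fun p => f (p + a)).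
Proof.
move=> a1 a2 [cf sf]; split; first exact: continuous_translate.
have key (x y : R) : `|y| <= B -> A + B < `|x| -> A < `|x + y|.
  by move=> yB; have := lerB_normD x y; lra.
by move=> p [h|h]; apply: sf; [left|right]; apply: key.
Qed.

Lemma cbox_le A B f : A <= B -> cbox A f -> cbox B f.
Proof.
by move=> AB [cf sf]; split=> // p [h|h]; apply: sf; [left|right]; exact: le_lt_trans h.
Qed.

Lemma plane_integralD A f u : cbox A f -> cbox A u ->
  \int[mu2]_p (f p + u p) = \int[mu2]_p f p + \int[mu2]_p u p.
Proof.
by move=> bf bu; rewrite RintegralD//; [exact: cbox_integrable bf|exact: cbox_integrable bu].
Qed.

Lemma plane_integralZ A f (c : R) : cbox A f ->
  \int[mu2]_p (c * f p) = c * \int[mu2]_p f p.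
Proof. by move=> bf; rewrite RintegralZl//; exact: cbox_integrable bf. Qed.

Definition second_diff e (s : R) f p := f (p + s *: e) - 2 * f p + f (p - s *: e).

Lemma second_diff_continuous e s f : continuous f -> continuous (second_diff e s f).
Proof.
move=> cf p; apply: cvgD; first apply: cvgB.
- exact: continuous_translate.
- by apply: cvgM; [exact: cvg_cst|exact: cf].
- exact: continuous_translate.
Qed.

Lemma second_diff_cbox A e s f : `|e.1| <= 1 -> `|e.2| <= 1 -> 0 <= s ->
  cbox A f -> cbox (A + s) (second_diff e s f).
Proof.
move=> e1 e2 s0 bf.
have se (x : R) : `|x| <= 1 -> `|s * x| <= s by move=> x1; rewrite normrM ger0_norm// ler_piMr.
have sN (x : R) : `|x| <= 1 -> `|- (s * x)| <= s by move=> x1; rewrite normrN se.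
apply: cboxD; last by apply: cbox_translate => //=; rewrite sN.
apply: cboxD; first by apply: cbox_translate => //=; rewrite se.
have := cboxZ (- 2) (cbox_le (_ : A <= A + s) bf); rewrite lerDl => /(_ s0) [cf sf].
have eqf : (fun p => - 2 * f p) = (fun p => - (2 * f p)) by apply/funext => p; ring.
by split; rewrite -eqf.
Qed.

(** Integration by parts without derivatives: translation invariance moves each shift of [k] onto
    [u] with the opposite sign, and the stencil is symmetric. *)
Lemma second_diff_adjoint A e s u k : `|e.1| <= 1 -> `|e.2| <= 1 -> 0 <= s ->
  continuous u -> cbox A k ->
  \int[mu2]_p (u p * second_diff e s k p) = \int[mu2]_p (second_diff e s u p * k p).
Proof.
move=> e1 e2 s0 cu bk.
have shift (a : R * R) : `|a.1| <= s -> `|a.2| <= s ->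
    \int[mu2]_p (u p * k (p + a)) = \int[mu2]_p (u (p - a) * k p).
  move=> a1 a2.
  have cua : continuous (fun p => u (p - a)) by exact: continuous_translate.
  have buk := cboxMl cua bk.
  have := cboxMl cu (cbox_translate a1 a2 bk).
  have eqf : (fun p => u p * k (p + a)) = (fun p => u (p + a - a) * k (p + a)).
    by apply/funext => p; rewrite addrK.
  rewrite eqf => b2.
  apply: (@plane_translation R (fun p => u (p - a) * k p)).
    by apply: continuous_plane_measurable; case: buk.
  exact: cbox_integrable b2.
have se (x : R) : `|x| <= 1 -> `|s * x| <= s by move=> x1; rewrite normrM ger0_norm// ler_piMr.
have sN (x : R) : `|x| <= 1 -> `|- (s * x)| <= s by move=> x1; rewrite normrN se.
have bk2 : cbox (A + s) k by apply: cbox_le bk; rewrite lerDl.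
have k1 : cbox (A + s) (fun p => k (p + s *: e)) by apply: cbox_translate => //=; rewrite se.
have k2 : cbox (A + s) (fun p => k (p - s *: e)) by apply: cbox_translate => //=; rewrite sN.
have cu1 : continuous (fun p => u (p + s *: e)) by exact: continuous_translate.
have cu2 : continuous (fun p => u (p - s *: e)) by exact: continuous_translate.
have -> : (fun p => u p * second_diff e s k p) =
    (fun p => (u p * k (p + s *: e) + u p * k (p - s *: e)) + (-2) * (u p * k p)).
  by apply/funext => p; rewrite /second_diff; ring.
have -> : (fun p => second_diff e s u p * k p) =
    (fun p => (u (p - s *: e) * k p + u (p + s *: e) * k p) + (-2) * (u p * k p)).
  by apply/funext => p; rewrite /second_diff; ring.
rewrite (plane_integralD (cboxD (cboxMl cu k1) (cboxMl cu k2)) (cboxZ _ (cboxMl cu bk2))).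
rewrite (plane_integralD (cboxMl cu k1) (cboxMl cu k2)).
rewrite (plane_integralD (cboxD (cboxMl cu2 bk) (cboxMl cu1 bk)) (cboxZ _ (cboxMl cu bk))).
rewrite (plane_integralD (cboxMl cu2 bk) (cboxMl cu1 bk)).
congr (_ + _ + _); first by apply: shift => /=; exact: se.
rewrite shift /=; [|exact: sN|exact: sN].
by under eq_Rintegral do rewrite opprK.
Qed.

Lemma essential_bound (g : R * R -> R) (C : R) : measurable_fun setT g ->
  ('N[mu2]_(+oo) [EFin \o g] <= C%:E)%E -> {ae mu2, forall p, `|g p| <= C}.
Proof.
move=> mg; rewrite unlock.
(* The norm of exponent infinity is defined by cases on whether the whole space has positive
   measure. *)
have -> : (0 < mu2 setT)%E.
  have T0 : (@lebesgue_measure R setT = +oo)%E.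
    by rewrite -set_itvE lebesgue_measure_itv.
  have mT : measurable (setT : set (measurableTypeR R)) by [].
  have := @product_measure1E _ _ _ _ R (@lebesgue_measure R) (@lebesgue_measure R)
    setT setT mT mT.
  by rewrite setXTT => ->; rewrite /= T0 mulyy ltry.
by move=> /ess_supP; apply: filterS => p; rewrite /= lee_fin.
Qed.

Lemma weighted_integral_bound A (g psi : R * R -> R) (C : R) : 0 <= C ->
  measurable_fun setT g -> {ae mu2, forall p, `|g p| <= C} ->
  cbox A psi -> (forall p, 0 <= psi p) ->
  `|\int[mu2]_p (g p * psi p)| <= C * \int[mu2]_p psi p.
Proof.
move=> C0 mg gC bpsi psi0.
have mpsi : measurable_fun setT psi by apply: continuous_plane_measurable; case: bpsi.
have mgp : measurable_fun setT (fun p => g p * psi p) by exact: measurable_funM.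
have Cint := cbox_integrable (cboxZ C bpsi).
have le : (\int[mu2]_p `|(g p * psi p)%:E| <= \int[mu2]_p (C * psi p)%:E)%E.
  apply: ae_ge0_le_integral => //.
  - by apply: measurableT_comp => //; exact/measurable_EFinP.
  - by move=> p _; rewrite lee_fin mulr_ge0.
  - by have /integrableP[] := Cint.
  - case: gC => N [mN N0 hN]; exists N; split=> // p /= hp; apply: hN => gp.
    by apply: hp => _; rewrite lee_fin normrM (ger0_norm (psi0 p)) ler_wpM2r.
have gint : mu2.-integrable setT (EFin \o (fun p => g p * psi p)).
  apply/integrableP; split; first exact/measurable_EFinP.
  apply: le_lt_trans le _; exact: integrable_lty.
apply: (le_trans (le_normr_Rintegral measurableT gint)).
rewrite -(plane_integralZ C bpsi) /Rintegral; apply: fine_le => //.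
- apply: integrable_fin_num => //; exact: integrable_norm.
- exact: integrable_fin_num.
Qed.

(** [psi] is meant to be a test function whose fourth derivative is the iterated second difference
    of [k]. Its mass supplies the scaling [s ^ 2 * r ^ 2], so a bound on the weak derivative [g]
    becomes one on averages of differences of [u]. *)
Lemma weak_second_diff_mean A (u g psi k : R * R -> R) e (s r C : R) :
  `|e.1| <= 1 -> `|e.2| <= 1 -> 0 <= s -> 0 <= r -> 0 <= C ->
  continuous u -> measurable_fun setT g -> {ae mu2, forall p, `|g p| <= C} ->
  cbox A psi -> (forall p, 0 <= psi p) -> cbox A k ->
  \int[mu2]_p (u p * second_diff e s (second_diff e r k) p) =
    \int[mu2]_p (g p * psi p) ->
  \int[mu2]_p psi p = s ^+ 2 * r ^+ 2 * \int[mu2]_p k p ->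
  `|\int[mu2]_p (second_diff e r (second_diff e s u) p * k p)| <=
    C * s ^+ 2 * r ^+ 2 * \int[mu2]_p k p.
Proof.
move=> e1 e2 s0 r0 C0 cu mg gC bpsi psi0 bk weak psik.
rewrite -(second_diff_adjoint e1 e2 r0 (second_diff_continuous cu) bk).
rewrite -(second_diff_adjoint e1 e2 s0 cu (second_diff_cbox e1 e2 r0 bk)) weak.
apply: le_trans (weighted_integral_bound C0 mg gC bpsi psi0) _.
by rewrite psik !mulrA.
Qed.

(** Averages against kernels shrinking to [p0] recover the value of a continuous function there, so
    a bound valid for all such averages holds pointwise. *)
Lemma concentrating_kernel_bound (w : R * R -> R) p0 (K : R) :
  continuous w ->
  (forall d : R, 0 < d -> exists k A, [/\ cbox A k, (forall p, 0 <= k p),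
     (forall p, d < `|p.1 - p0.1| \/ d < `|p.2 - p0.2| -> k p = 0),
     0 < \int[mu2]_p k p &
     `|\int[mu2]_p (w p * k p)| <= K * \int[mu2]_p k p]) ->
  `|w p0| <= K.
Proof.
move=> cw ker; apply/ler_addgt0Pr => eta eta0.
have /cvgrPdist_le/(_ eta eta0) := cw p0.
move=> /nbhs_ballP[d /= d0 hd].
have d20 : 0 < d / 2 by rewrite divr_gt0.
have [k [A [bk k0 supp kpos mean]]] := ker _ d20.
have near_p0 p : `|w p0 - w p| * k p <= eta * k p.
  have [p1|p1] := ltP (d / 2) `|p.1 - p0.1|; first by rewrite supp ?mulr0//; left.
  have [p2|p2] := ltP (d / 2) `|p.2 - p0.2|; first by rewrite supp ?mulr0//; right.
  apply: ler_wpM2r => //; apply: hd; split; rewrite /ball /= distrC; lra.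
have cdiff : continuous (fun p => w p0 - w p).
  by move=> p; apply: cvgB; [exact: cvg_cst|exact: cw].
have b1 := cboxMl cdiff bk; have b2 := cboxMl cw bk.
have b3 := cboxZ (w p0) bk.
have diff : `|\int[mu2]_p ((w p0 - w p) * k p)| <= eta * \int[mu2]_p k p.
  apply: (le_trans (le_normr_Rintegral measurableT (cbox_integrable b1))).
  rewrite -(plane_integralZ eta bk).
  apply: le_Rintegral => //.
  - exact: integrable_norm (cbox_integrable b1).
  - exact: cbox_integrable (cboxZ eta bk).
  - by move=> p _; rewrite normrM (ger0_norm (k0 p)).
have sum : w p0 * \int[mu2]_p k p =
    \int[mu2]_p ((w p0 - w p) * k p) + \int[mu2]_p (w p * k p).
  rewrite -(plane_integralZ (w p0) bk) -(plane_integralD b1 b2).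
  by apply: eq_Rintegral => p _; ring.
have := congr1 Num.norm sum; rewrite normrM (gtr0_norm kpos) => norm_eq.
rewrite -(ler_pM2r kpos) norm_eq mulrDl [leRHS]addrC.
by apply: le_trans (ler_normD _ _) _; exact: lerD.
Qed.

End plane_differences.

(** * Second differences and truncated powers on the line *)

Lemma second_order_ge0 (R : realType) (phi phi1 phi2 : R -> R) (h : R) :
  (forall s : R, is_derive s 1 phi (phi1 s)) ->
  (forall s : R, is_derive s 1 phi1 (phi2 s)) ->
  phi 0 = 0 -> phi1 0 = 0 -> (forall s, 0 <= s <= h -> 0 <= phi2 s) -> 0 <= h ->
  0 <= phi h.
Proof.
move=> d1 d2 p0 p10 p2 h0.
have cont (f df : R -> R) : (forall s : R, is_derive s 1 f (df s)) -> continuous f.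
  by move=> d s; exact: is_derive_continuous (d s).
have phi1_ge0 s : 0 <= s <= h -> 0 <= phi1 s.
  move=> /andP[s0 sh].
  have [|c] := MVT_segment s0 (fun x _ => d2 x).
    exact: continuous_subspaceT (cont _ _ d2).
  rewrite in_itv /= p10 !subr0 => /andP[c0 cs] ->; apply: mulr_ge0 => //; apply: p2.
  by rewrite c0 (le_trans cs).
have [|c] := MVT_segment h0 (fun x _ => d1 x).
  exact: continuous_subspaceT (cont _ _ d1).
rewrite in_itv /= p0 !subr0 => /andP[c0 cs] ->; apply: mulr_ge0 => //; apply: phi1_ge0.
by rewrite c0 cs.
Qed.

Lemma is_derive_translate (R : realType) (f : R -> R) (a x l : R) :
  is_derive (x + a) 1 f l -> is_derive x 1 (fun s => f (s + a)) l.
Proof.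
move=> df.
have da : is_derive x 1 (fun s : R => s + a) 1.
  by apply: is_derive_eq; rewrite addr0.
by have := @is_derive1_comp R f (fun s => s + a) x _ _ df da; rewrite mulr1.
Qed.

Lemma is_derive_reflect (R : realType) (f : R -> R) (a x l : R) :
  is_derive (a - x) 1 f l -> is_derive x 1 (fun s => f (a - s)) (- l).
Proof.
move=> df.
have da : is_derive x 1 (fun s : R => a - s) (-1).
  by apply: is_derive_eq; rewrite add0r mul1r.
by have := @is_derive1_comp R f (fun s => a - s) x _ _ df da; rewrite mulrN1.
Qed.

(** A criterion made for the square of the positive part: the remainder estimate treats the kink and
    all other points in the same way. *)
Lemma is_derive_quadratic_error (R : realType) (f : R -> R) (x l : R) :
  (forall h, `|f (x + h) - f x - h * l| <= h ^+ 2) -> is_derive x 1 f l.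
Proof.
move=> hf.
suff cv : h^-1 *: (f (h *: 1 + x) - f x) @[h --> 0^'] --> l.
  have dv : derivable f x 1 by apply/cvg_ex; exists l.
  by split=> //; rewrite /derive; exact/cvg_lim.
apply/cvgrPdist_le => e e0; near=> h.
have h0 : h != 0 by near: h; exact: nbhs_dnbhs_neq.
have he : `|h| <= e by near: h; exact: dnbhs0_le.
apply: le_trans he; rewrite /GRing.scale /= mulr1 addrC.
rewrite -(ler_pM2l (_ : 0 < `|h|)) ?normr_gt0// -normrM -expr2 real_normK ?num_real//.
rewrite -normrN; apply: le_trans (hf h); rewrite le_eqVlt; apply/orP; left; apply/eqP.
by congr `|_|; rewrite addrC [h + x]addrC; field.
Unshelve. all: by end_near. Qed.

Definition diff2 (R : realType) (s : R) (f : R -> R) (x : R) : R :=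
  f (x + s) - 2 * f x + f (x - s).

Lemma is_derive_diff2 (R : realType) (s : R) (f df : R -> R) (x : R) :
  (forall y : R, is_derive y 1 f (df y)) ->
  is_derive x 1 (diff2 s f) (diff2 s df x).
Proof.
move=> d; have d1 := is_derive_translate (d (x + s)).
have d2 := is_derive_translate (d (x - s)); have d3 := d x.
rewrite /diff2; apply: is_deriveD; apply: is_deriveB.
Qed.

Lemma diff2_ext (R : realType) (s : R) (f g : R -> R) (x : R) : 0 <= s ->
  (forall y, x - s <= y <= x + s -> f y = g y) -> diff2 s f x = diff2 s g x.
Proof. by move=> s0 fg; rewrite /diff2 !fg//; apply/andP; split; lra. Qed.

(** As a function of the step [t], the second difference vanishes to first order at 0 and has second
    derivative [f2 (x + t) + f2 (x - t)]. *)
Lemma diff2_ge0 (R : realType) (s : R) (f f1 f2 : R -> R) (x : R) : 0 <= s ->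
  (forall y : R, is_derive y 1 f (f1 y)) -> (forall y : R, is_derive y 1 f1 (f2 y)) ->
  (forall y, 0 <= f2 y) -> 0 <= diff2 s f x.
Proof.
move=> s0 d1 d2 f20.
pose phi t := f (t + x) - 2 * f x + f (x - t).
have -> : diff2 s f x = phi s by rewrite /diff2 /phi addrC addrA [s + x]addrC; ring.
apply: (@second_order_ge0 _ _ (fun t => f1 (t + x) - f1 (x - t))
  (fun t => f2 (t + x) + f2 (x - t))) => //.
- move=> t; have h1 := is_derive_translate (d1 (t + x)).
  have h2 := is_derive_reflect (d1 (x - t)).
  have h3 : is_derive t 1 (fun _ : R => 2 * f x) 0 by exact: is_derive_cst.
  by apply: is_derive_eq; rewrite subr0.
- move=> t; have h1 := is_derive_translate (d2 (t + x)).
  have h2 := is_derive_reflect (d2 (x - t)).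
  by apply: is_derive_eq; rewrite opprK.
- by rewrite /phi add0r subr0; ring.
- by rewrite add0r subr0 subrr.
- by move=> t _; rewrite addr_ge0.
Qed.

(** The truncated power of spline theory, normalised so that differentiation lowers the index. At
    index 0 it is the constant 1 and not a step function, so derivatives and vanishing on the left
    are stated for positive indices. *)
Definition tpow (R : realType) (n : nat) (x : R) : R := Num.max 0 x ^+ n / n`!%:R.

(** Writing the positive part to the power [n.+2] as [y ^ n] times its square confines the kink to
    the square. *)
Lemma is_derive_tpow (R : realType) (n : nat) (x : R) :
  is_derive x 1 (tpow n.+2) (tpow n.+1 x).
Proof.
pose m (y : R) : R := Num.max 0 y.
have dm2 : is_derive x 1 (fun y => m y ^+ 2) (2 * m x).
  apply: is_derive_quadratic_error => h; rewrite /m ler_norml.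
  have [x0|x0] := leP x 0; have [h0|h0] := leP (x + h) 0; apply/andP; split; nra.
have mE k y : m y ^+ k.+2 = y ^+ k * m y ^+ 2.
  rewrite /m; have [y0|y0] := leP y 0; first by rewrite !expr0n /= mulr0.
  by rewrite -exprD addn2.
have mE1 y : y * m y = m y ^+ 2.
  by rewrite /m; have [y0|y0] := leP y 0; rewrite ?mulr0 ?expr0n.
have dX : is_derive x 1 (fun y : R => y ^+ n) (n%:R * x ^+ n.-1).
  by split; [exact: exprn_derivable|rewrite exp_derive /GRing.scale /= mulr1].
have tE k y : tpow k y = m y ^+ k / k`!%:R by [].
have -> : tpow n.+2 = (fun y => (n.+2)`!%:R^-1 * (y ^+ n * m y ^+ 2)).
  by apply/funext => y; rewrite tE mE [LHS]mulrC.
apply: is_derive_eq; rewrite /GRing.scale /= tE.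
have -> : x ^+ n * (2 * m x) = 2 * m x ^+ n.+1.
  case: n {dX} => [|n]; first by rewrite expr0 mul1r expr1.
  by rewrite exprSr mulrCA -mulrA mE1 -mE.
have -> : m x ^+ 2 * (n%:R * x ^+ n.-1) = n%:R * m x ^+ n.+1.
  case: n {dX} => [|n]; first by rewrite !mul0r mulr0.
  by rewrite mulrCA [_ * x ^+ _]mulrC -mE.
rewrite (factS n.+1) natrM; field.
by rewrite -natrD !pnatr_eq0 -lt0n fact_gt0.
Qed.

Lemma tpow_right (R : realType) n (x : R) : 0 <= x -> tpow n x = x ^+ n / n`!%:R.
Proof. by move=> x0; rewrite /tpow max_r. Qed.

Lemma tpow_left (R : realType) n (x : R) : x <= 0 -> tpow n.+1 x = 0.
Proof. by move=> x0; rewrite /tpow max_l// expr0n mul0r. Qed.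

Lemma tpow_continuous (R : realType) n : continuous (@tpow R n.+1).
Proof.
case: n => [|n] x; last exact: is_derive_continuous (is_derive_tpow n x).
rewrite /tpow (_ : (fun _ => _) = (fun y : R => Num.max 0 y)); last first.
  by apply/funext => y; rewrite expr1 divr1.
have -> : (fun y : R => Num.max 0 y) = (fun y => 2^-1 * (y + `|y|)).
  apply/funext => y; have [y0|y0] := leP y 0.
    by rewrite ler0_norm// subrr mulr0.
  by rewrite gtr0_norm//; field.
apply: cvgM; first exact: cvg_cst.
by apply: cvgD; [exact: cvg_id|exact: norm_continuous].
Qed.

Lemma Rintegral_compact_primitive (R : realType) (f F : R -> R) (lo hi : R) :
  lo < hi -> continuous f -> (forall x : R, is_derive x 1 F (f x)) ->
  (forall x, x <= lo \/ hi <= x -> f x = 0) ->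
  (@lebesgue_measure R).-integrable setT (EFin \o f) /\
  \int[@lebesgue_measure R]_x f x = F hi - F lo.
Proof.
move=> lohi cf dF out.
have fE : f = f \_ `[lo, hi].
  apply/funext => x; rewrite patchE; case: ifPn => //.
  rewrite notin_setE /= in_itv /= => h; apply: out.
  have [h1|h1] := leP x lo; first by left.
  right; rewrite leNgt; apply/negP => h2; apply: h.
  by rewrite !ltW.
have iab : (@lebesgue_measure R).-integrable `[lo, hi] (EFin \o f).
  apply: continuous_compact_integrable; first exact: segment_compact.
  exact: continuous_subspaceT.
split.
  by rewrite fE -restrict_EFin; apply/integrable_restrict => //; rewrite setTI.
have cF : continuous F by move=> x; exact: is_derive_continuous (dF x).
rewrite fE -Rintegral_mkcond /Rintegral (@continuous_FTC2 _ f F)//.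
- exact: continuous_subspaceT.
- split.
  + by move=> x _; exact: ex_derive.
  + by apply: cvg_at_right_filter; exact: cF.
  + by apply: cvg_at_left_filter; exact: cF.
- by move=> x _; rewrite derive1E; exact: derive_val.
Qed.

(* [bump a b c x0 5] is a nonnegative C^4 B-spline centred at [x0]. Lowering [n]
   differentiates, so its fourth derivative is the iterated second difference, of
   steps [a] and [b], of the concentrated kernel [hat]. *)
Definition bump (R : realType) (a b c x0 : R) (n : nat) (x : R) : R :=
  diff2 a (diff2 b (diff2 c (tpow n))) (x - x0).

Definition hat (R : realType) (c x0 x : R) : R := diff2 c (tpow 1) (x - x0).

Section bumps.
Context (R : realType) (a b c x0 : R).
Hypotheses (a0 : 0 < a) (b0 : 0 < b) (c0 : 0 < c).

Lemma is_derive_bump n (x : R) : is_derive x 1 (bump a b c x0 n.+2) (bump a b c x0 n.+1 x).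
Proof.
apply: is_derive_translate; apply: is_derive_diff2 => y.
by apply: is_derive_diff2 => z; apply: is_derive_diff2 => w; exact: is_derive_tpow.
Qed.

Lemma diff2_continuous (s : R) (f : R -> R) : continuous f -> continuous (diff2 s f).
Proof.
move=> cf x; have ct (r : R) : {for x, continuous (fun y => f (y + r))}.
  apply: (@continuous_comp _ _ _ (fun y : R => y + r) f); last exact: cf.
  by apply: cvgD; [exact: cvg_id|exact: cvg_cst].
apply: cvgD; last exact: ct.
apply: cvgB; first exact: ct.
by apply: cvgM; [exact: cvg_cst|exact: cf].
Qed.

Lemma bump_continuous n : continuous (bump a b c x0 n.+1).
Proof.
move=> x; apply: (@continuous_comp _ _ _ (fun y : R => y - x0)
  (diff2 a (diff2 b (diff2 c (tpow n.+1))))).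
  by apply: cvgB; [exact: cvg_id|exact: cvg_cst].
by do 3!apply: diff2_continuous; exact: tpow_continuous.
Qed.

Let near3 (f g : R -> R) (y : R) :
  (forall z, y - (a + b + c) <= z <= y + (a + b + c) -> f z = g z) ->
  diff2 a (diff2 b (diff2 c f)) y = diff2 a (diff2 b (diff2 c g)) y.
Proof.
move=> fg; apply: diff2_ext; [exact: ltW|move=> u /andP[? ?]].
apply: diff2_ext; [exact: ltW|move=> v /andP[? ?]].
by apply: diff2_ext; [exact: ltW|move=> w /andP[? ?]; apply: fg; apply/andP; split; lra].
Qed.

Let bump_right n (x : R) : x0 + (a + b + c) <= x ->
  bump a b c x0 n x = diff2 a (diff2 b (diff2 c (fun y => y ^+ n / n`!%:R))) (x - x0).
Proof.
move=> h; apply: near3 => z /andP[z1 _]; apply: tpow_right; lra.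
Qed.

Lemma bump_left n (x : R) : x <= x0 - (a + b + c) -> bump a b c x0 n.+1 x = 0.
Proof.
move=> h; rewrite /bump (@near3 _ (fun=> 0)); last first.
  by move=> z /andP[_ z1]; apply: tpow_left; lra.
by rewrite /diff2; ring.
Qed.

(** Right of the support the truncated powers are monomials, and three nested second differences
    annihilate polynomials of degree below 6. *)
Lemma bump_right0 n (x : R) : (0 < n < 6)%N -> x0 + (a + b + c) <= x ->
  bump a b c x0 n x = 0.
Proof.
move=> n6 h; rewrite bump_right//; move: (x - x0) => y; rewrite /diff2.
rewrite -[RHS](mul0r n`!%:R^-1).
case: n n6 => // -[|[|[|[|[|n]]]]] // _; move: (_`!%:R^-1) => k; ring.
Qed.

(** In degree 6 the three differences leave a constant in which [6!] cancels. As the bump of index 6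
    is a primitive of that of index 5, this is the mass of the spline. *)
Lemma bump_right6 (x : R) : x0 + (a + b + c) <= x ->
  bump a b c x0 6 x = a ^+ 2 * b ^+ 2 * c ^+ 2.
Proof.
move=> h; rewrite bump_right//; move: (x - x0) => y; rewrite /diff2.
have -> : (6`! = 720)%N by [].
by field.
Qed.

Lemma hat_left (x : R) : x <= x0 - c -> hat c x0 x = 0.
Proof.
move=> h; rewrite /hat (@diff2_ext _ _ _ (fun=> 0)) ?(ltW c0)//; last first.
  by move=> z /andP[_ z1]; apply: tpow_left; lra.
by rewrite /diff2; ring.
Qed.

Lemma hat_right (x : R) : x0 + c <= x -> hat c x0 x = 0.
Proof.
move=> h; rewrite /hat (@diff2_ext _ _ _ (fun y => y ^+ 1 / 1`!%:R)) ?(ltW c0)//; last first.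
  by move=> z /andP[z1 _]; apply: tpow_right; lra.
by rewrite /diff2; ring.
Qed.

Lemma hat_continuous : continuous (hat c x0).
Proof.
move=> x; apply: (@continuous_comp _ _ _ (fun y : R => y - x0) (diff2 c (tpow 1))).
  by apply: cvgB; [exact: cvg_id|exact: cvg_cst].
by apply: diff2_continuous; exact: tpow_continuous.
Qed.

Let hinge_ge0 (x : R) : 0 <= diff2 c (tpow 1) x.
Proof.
rewrite /diff2 /tpow !expr1 !divr1.
have [] := leP (x + c) 0; have [] := leP (x - c) 0; have [] := leP x 0; move: c0; lra.
Qed.

Lemma hat_ge0 (x : R) : 0 <= hat c x0 x. Proof. exact: hinge_ge0. Qed.

(** Convexity is propagated twice through [diff2_ge0]: the tent [diff2 c (tpow 1)] is nonnegative
    and is the second derivative of [diff2 c (tpow 3)], and the same passage with [b] then [a]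
    reaches index 5. *)
Lemma bump5_ge0 (x : R) : 0 <= bump a b c x0 5 x.
Proof.
have dd n (y : R) : is_derive y 1 (diff2 c (tpow n.+2)) (diff2 c (tpow n.+1) y).
  by apply: is_derive_diff2 => z; exact: is_derive_tpow.
have ddd n (y : R) : is_derive y 1 (diff2 b (diff2 c (tpow n.+2))) (diff2 b (diff2 c (tpow n.+1)) y).
  by apply: is_derive_diff2 => z; exact: dd.
have pos3 (y : R) : 0 <= diff2 b (diff2 c (tpow 3)) y.
  exact: (@diff2_ge0 _ _ _ _ _ _ (ltW b0) (dd 1%N) (dd 0%N)).
exact: (@diff2_ge0 _ _ _ _ _ _ (ltW a0) (ddd 3%N) (ddd 2%N)).
Qed.

Let outer_lt : x0 - (a + b + c) < x0 + (a + b + c).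
Proof. by move: a0 b0 c0; lra. Qed.

Lemma bump5_integral :
  (@lebesgue_measure R).-integrable setT (EFin \o bump a b c x0 5) /\
  \int[@lebesgue_measure R]_x bump a b c x0 5 x = a ^+ 2 * b ^+ 2 * c ^+ 2.
Proof.
have [|fint ->] := Rintegral_compact_primitive outer_lt (@bump_continuous 4)
  (is_derive_bump 4).
  by move=> x [h|h]; [exact: bump_left|exact: bump_right0].
by rewrite bump_right6 ?lexx// bump_left ?lexx// subr0.
Qed.

Lemma hat_integral :
  (@lebesgue_measure R).-integrable setT (EFin \o hat c x0) /\
  \int[@lebesgue_measure R]_x hat c x0 x = c ^+ 2.
Proof.
have lt : x0 - c < x0 + c by move: c0; lra.
have dF (x : R) : is_derive x 1 (fun y => diff2 c (tpow 2) (y - x0)) (hat c x0 x).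
  by apply: is_derive_translate; apply: is_derive_diff2 => z; exact: is_derive_tpow.
have [|fint ->] := Rintegral_compact_primitive lt hat_continuous dF.
  by move=> x [h|h]; [exact: hat_left|exact: hat_right].
split=> //; rewrite /diff2 (@tpow_right _ _ (_ + c)) ?(@tpow_right _ _ (x0 + c - x0));
  try by move: c0; lra.
rewrite (@tpow_right _ _ (x0 + c - x0 - c)); last by move: c0; lra.
rewrite !(@tpow_left _ 1); try by move: c0; lra.
have -> : (2`! = 2)%N by [].
by field.
Qed.

Lemma bump1E (x : R) : bump a b c x0 1 x = diff2 a (diff2 b (hat c x0)) x.
Proof.
have tr (s : R) (f : R -> R) y : diff2 s f (y - x0) = diff2 s (fun z => f (z - x0)) y.
  by rewrite /diff2 ![y + _ - x0]addrAC.
rewrite /bump tr; congr (diff2 a _ x); apply/funext => y.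
by rewrite tr.
Qed.

End bumps.

(** Both sides vanish to first order when the step is 0, so an inequality of second derivatives in
    the step suffices. [P] will be a polynomial minorant. *)
Lemma diff2_compare (R : realType) (f f1 f2 P P1 P2 : R -> R) (x h : R) : 0 <= h ->
  (forall y : R, is_derive y 1 f (f1 y)) -> (forall y : R, is_derive y 1 f1 (f2 y)) ->
  (forall t : R, is_derive t 1 P (P1 t)) -> (forall t : R, is_derive t 1 P1 (P2 t)) ->
  P 0 = 0 -> P1 0 = 0 ->
  (forall t, 0 <= t <= h -> P2 t <= f2 (x + t) + f2 (x - t)) ->
  P h <= diff2 h f x.
Proof.
move=> h0 d1 d2 dP dP1 P0 P10 le2.
pose phi t := f (t + x) + f (x - t) - 2 * f x - P t.
rewrite -subr_ge0 (_ : _ - _ = phi h); last by rewrite /diff2 /phi [h + x]addrC; ring.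
apply: (@second_order_ge0 _ _ (fun t => f1 (t + x) - f1 (x - t) - P1 t)
  (fun t => f2 (t + x) + f2 (x - t) - P2 t)) => //.
- move=> t; have h1 := is_derive_translate (d1 (t + x)).
  have h2 := is_derive_reflect (d1 (x - t)).
  have h3 : is_derive t 1 (fun _ : R => 2 * f x) 0 by exact: is_derive_cst.
  by apply: is_derive_eq; rewrite subr0.
- move=> t; have h1 := is_derive_translate (d2 (t + x)).
  have h2 := is_derive_reflect (d2 (x - t)).
  by apply: is_derive_eq; rewrite opprK.
- by rewrite /phi add0r subr0 P0; ring.
- by rewrite add0r subr0 subrr P10 subr0.
- by move=> t th; rewrite subr_ge0 addrC [t + x]addrC addrC le2.
Qed.

Lemma diff2N (R : realType) (h : R) (f : R -> R) (x : R) :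
  diff2 h (fun y => - f y) x = - diff2 h f x.
Proof. by rewrite /diff2; ring. Qed.

Lemma is_derive_pow (R : realType) (c : R) n (t : R) :
  is_derive t 1 (fun t => c * t ^+ n) (c * (n%:R * t ^+ n.-1)).
Proof.
have dX : is_derive t 1 (fun y : R => y ^+ n) (n%:R * t ^+ n.-1).
  by split; [exact: exprn_derivable|rewrite exp_derive /GRing.scale /= mulr1].
by apply: is_derive_eq; rewrite /GRing.scale.
Qed.

(** Continuity keeps [f2] above [f2 x - eta] near [x]; comparison with the parabola
    [(f2 x - eta) * t ^ 2] at a single small step then bounds [f2 x - eta] by [K]. *)
Lemma second_derive_ge (R : realType) (f f1 f2 : R -> R) (x K : R) :
  (forall y : R, is_derive y 1 f (f1 y)) -> (forall y : R, is_derive y 1 f1 (f2 y)) ->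
  continuous f2 -> (forall r, 0 < r -> diff2 r f x <= K * r ^+ 2) -> f2 x <= K.
Proof.
move=> d1 d2 cf2 hK; apply/ler_addgt0Pr => eta eta0.
have /cvgrPdist_le/(_ eta eta0)/nbhs_ballP[d /= d0 hd] := cf2 x.
have r0 : 0 < d / 2 by rewrite divr_gt0.
rewrite -lerBlDr -(ler_pM2r (exprn_gt0 2 r0)); apply: le_trans (hK _ r0).
pose m := f2 x - eta.
apply: (@diff2_compare _ _ _ _ (fun t => m * t ^+ 2) (fun t => m * (2 * t ^+ 1))
  (fun t => m * 2) _ _ (ltW r0) d1 d2).
- by move=> t; exact: is_derive_pow.
- move=> t; have := is_derive_pow (m * 2) 1 t; rewrite /= expr0 !mulr1.
  by rewrite (_ : (fun t => _) = (fun t => m * (2 * t ^+ 1)))//; apply/funext => s; rewrite mulrA.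
- by rewrite expr0n mulr0.
- by rewrite expr0n !mulr0.
- move=> t /andP[t0 td]; have near y : `|x - y| <= d / 2 -> m <= f2 y.
    move=> xy; have := hd y; rewrite /ball /= => /(_ (le_lt_trans xy _)).
    have dd : d / 2 < d by lra.
    by move=> /(_ dd); rewrite ler_norml => /andP[_]; rewrite /m; lra.
  have := near (x + t); have := near (x - t).
  have -> : x - (x - t) = t by ring.
  have -> : x - (x + t) = - t by ring.
  by rewrite normrN ger0_norm// => /(_ td) + /(_ td); lra.
Qed.

(** No fourth derivative of [f] is at hand. The iterated differences first bound the second
    difference of [f2] from below by [- C * s ^ 2], through [second_derive_ge] in the step [r]. The
    minorant [P] has exactly this bound in its second derivative [2 * f2 x - C * t ^ 2], whence the
    constant [C / 12]. *)
Lemma diff2_taylor_ge (R : realType) (f f1 f2 : R -> R) (x C h : R) :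
  (forall y : R, is_derive y 1 f (f1 y)) -> (forall y : R, is_derive y 1 f1 (f2 y)) ->
  continuous f2 -> 0 <= h ->
  (forall s r, 0 < s -> 0 < r -> - diff2 r (diff2 s f) x <= C * s ^+ 2 * r ^+ 2) ->
  f2 x * h ^+ 2 - C / 12 * h ^+ 4 <= diff2 h f x.
Proof.
move=> d1 d2 cf2 h0 hC.
have lower s : 0 < s -> - (C * s ^+ 2) <= diff2 s f2 x.
  move=> s0; rewrite lerNl.
  have dN (g dg : R -> R) : (forall y : R, is_derive y 1 g (dg y)) ->
      forall y : R, is_derive y 1 (fun z => - diff2 s g z) (- diff2 s dg y).
    by move=> d y; have := is_derive_diff2 s y d; move=> ?; exact: is_deriveN.
  apply: (second_derive_ge (dN _ _ d1) (dN _ _ d2)).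
  - by move=> y; apply: cvgN; exact: diff2_continuous.
  - by move=> r r0; rewrite diff2N; exact: hC.
pose P t := f2 x * t ^+ 2 - C / 12 * t ^+ 4.
apply: (@diff2_compare _ _ _ _ P (fun t => f2 x * (2 * t ^+ 1) - C / 12 * (4 * t ^+ 3))
  (fun t => f2 x * 2 - C * t ^+ 2) _ _ h0 d1 d2).
- move=> t; have p1 := is_derive_pow (f2 x) 2 t; have p2 := is_derive_pow (C / 12) 4 t.
  exact: is_deriveB.
- move=> t; have p1 := is_derive_pow (f2 x * 2) 1 t; have p2 := is_derive_pow (C / 3) 3 t.
  have := is_deriveB p1 p2; rewrite /= expr0 !mulr1 => p.
  rewrite (_ : (fun t => _) = ((fun t => f2 x * 2 * t ^+ 1) - (fun t => C / 3 * t ^+ 3))).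
    by apply: is_derive_eq; field.
  by apply/funext => s; rewrite !fctE; field.
- by rewrite /P !expr0n !mulr0 subrr.
- by rewrite !expr0n !mulr0 subrr.
- move=> t /andP[t0 th]; move: t0; rewrite le_eqVlt => /predU1P[<-|t0].
    by rewrite addr0 subr0 expr0n mulr0 subr0 mulr_natr mulr2n.
  by have := lower t t0; rewrite /diff2; lra.
Qed.

Lemma diff2_taylor (R : realType) (f f1 f2 : R -> R) (x C h : R) :
  (forall y : R, is_derive y 1 f (f1 y)) -> (forall y : R, is_derive y 1 f1 (f2 y)) ->
  continuous f2 -> 0 <= h ->
  (forall s r, 0 < s -> 0 < r -> `|diff2 r (diff2 s f) x| <= C * s ^+ 2 * r ^+ 2) ->
  `|diff2 h f x - f2 x * h ^+ 2| <= C / 12 * h ^+ 4.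
Proof.
move=> d1 d2 cf2 h0 hC.
have lo : f2 x * h ^+ 2 - C / 12 * h ^+ 4 <= diff2 h f x.
  apply: (diff2_taylor_ge d1 d2 cf2 h0) => s r s0 r0.
  by apply: le_trans (hC s r s0 r0); rewrite -normrN ler_norm.
have dN (g dg : R -> R) : (forall y : R, is_derive y 1 g (dg y)) ->
    forall y : R, is_derive y 1 (fun z => - g z) (- dg y).
  by move=> d y; have := d y; move=> ?; exact: is_deriveN.
have cN : continuous (fun z => - f2 z) by move=> z; apply: cvgN; exact: cf2.
have up : - f2 x * h ^+ 2 - C / 12 * h ^+ 4 <= diff2 h (fun z => - f z) x.
  apply: (diff2_taylor_ge (dN _ _ d1) (dN _ _ d2) cN h0) => s r s0 r0.
  rewrite (_ : diff2 s _ = fun z => - diff2 s f z); last by apply/funext => z; exact: diff2N.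
  by rewrite diff2N opprK; apply: le_trans (hC s r s0 r0); exact: ler_norm.
by rewrite diff2N in up; rewrite ler_norml; apply/andP; split; lra.
Qed.

(** * Slices, tensor products and weak derivatives *)

Lemma is_derive_slice (R : realType) (u : R * R -> R) (x y l : R) :
  (is_derive ((x, y) : R * R) ((1, 0) : R * R) u l <-> is_derive x 1 (fun s => u (s, y)) l) /\
  (is_derive ((x, y) : R * R) ((0, 1) : R * R) u l <-> is_derive y 1 (fun s => u (x, s)) l).
Proof.
have e1 : (fun h : R => h^-1 *: (u (h *: ((1, 0) : R * R) + (x, y)) - u (x, y))) =
    (fun h : R => h^-1 *: (u (h *: (1 : R) + x, y) - u (x, y))).
  apply/funext => h; congr (_ *: (u _ - _)).
  by apply: injective_projections => //=; rewrite scaler0 add0r.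
have e2 : (fun h : R => h^-1 *: (u (h *: ((0, 1) : R * R) + (x, y)) - u (x, y))) =
    (fun h : R => h^-1 *: (u (x, h *: (1 : R) + y) - u (x, y))).
  apply/funext => h; congr (_ *: (u _ - _)).
  by apply: injective_projections => //=; rewrite scaler0 add0r.
split; split=> -[d1 d2]; split.
- by move: d1; rewrite /derivable e1.
- by move: d2; rewrite /derive e1.
- by rewrite /derivable e1.
- by rewrite /derive e1.
- by move: d1; rewrite /derivable e2.
- by move: d2; rewrite /derive e2.
- by rewrite /derivable e2.
- by rewrite /derive e2.
Qed.

Lemma is_derive_dx (R : realType) (u : R * R -> R) (x y : R) :
  derivable u (x, y) ((1, 0) : R * R) -> is_derive x 1 (fun s => u (s, y)) (dx u (x, y)).
Proof. by move=> d; apply/(is_derive_slice u x y _).1; split. Qed.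

Lemma is_derive_dy (R : realType) (u : R * R -> R) (x y : R) :
  derivable u (x, y) ((0, 1) : R * R) -> is_derive y 1 (fun s => u (x, s)) (dy u (x, y)).
Proof. by move=> d; apply/(is_derive_slice u x y _).2; split. Qed.

Lemma is_derive_tensor (R : realType) (f g : R -> R) (p : R * R) (l m : R) :
  is_derive p.1 1 f l -> is_derive p.2 1 g m ->
  is_derive p ((1, 0) : R * R) (fun q : R * R => f q.1 * g q.2) (l * g p.2) /\
  is_derive p ((0, 1) : R * R) (fun q : R * R => f q.1 * g q.2) (f p.1 * m).
Proof.
case: p => x y /= df dg; split.
  apply/(is_derive_slice _ x y _).1 => /=.
  by apply: is_derive_eq; rewrite /GRing.scale /= mulr0 add0r mulrC.
apply/(is_derive_slice _ x y _).2 => /=.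
by apply: is_derive_eq; rewrite /GRing.scale.
Qed.

Lemma tensor_continuous (R : realType) (f g : R -> R) :
  continuous f -> continuous g -> continuous (fun p : R * R => f p.1 * g p.2).
Proof.
move=> cf cg p; apply: cvgM.
  by apply: continuous_comp; [exact: cvg_fst|exact: cf].
by apply: continuous_comp; [exact: cvg_snd|exact: cg].
Qed.

(** [f] and [g] are chains of successive derivatives. A partial derivative shifts one chain and
    lowers the order, so the induction runs over arbitrary chains. *)
Lemma Ck_tensor (R : realType) (k : nat) (f g : nat -> R -> R) :
  (forall i (x : R), (i < k)%N -> is_derive x 1 (f i) (f i.+1 x)) ->
  (forall i (x : R), (i < k)%N -> is_derive x 1 (g i) (g i.+1 x)) ->
  (forall i, (i <= k)%N -> continuous (f i)) ->
  (forall i, (i <= k)%N -> continuous (g i)) ->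
  Ck k (fun p : R * R => f 0%N p.1 * g 0%N p.2).
Proof.
elim: k f g => [|k IH] f g df dg cf cg /=.
  by split=> //; apply: tensor_continuous; [exact: cf|exact: cg].
split; first by apply: tensor_continuous; [exact: cf|exact: cg].
have d (p : R * R) := is_derive_tensor (df 0%N p.1 isT) (dg 0%N p.2 isT).
have dxE : dx (fun p : R * R => f 0%N p.1 * g 0%N p.2) = (fun p : R * R => f 1%N p.1 * g 0%N p.2).
  by apply/funext => p; apply: derive_val; exact: (d p).1.
have dyE : dy (fun p : R * R => f 0%N p.1 * g 0%N p.2) = (fun p : R * R => f 0%N p.1 * g 1%N p.2).
  by apply/funext => p; apply: derive_val; exact: (d p).2.
rewrite dxE dyE; split.
- by move=> p; apply: ex_derive; exact: (d p).1.
- by move=> p; apply: ex_derive; exact: (d p).2.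
- apply: (IH (fun i => f i.+1) g) => i.
  + by move=> x ik; exact: df.
  + by move=> x ik; apply: dg; exact: ltnW.
  + by move=> ik; exact: cf.
  + by move=> ik; apply: cg; exact: leqW.
- apply: (IH f (fun i => g i.+1)) => i.
  + by move=> x ik; apply: df; exact: ltnW.
  + by move=> x ik; exact: dg.
  + by move=> ik; apply: cf; exact: leqW.
  + by move=> ik; exact: cg.
Qed.

Lemma iter_dx_tensor (R : realType) (k : nat) (f : nat -> R -> R) (g : R -> R) :
  (forall i (x : R), (i < k)%N -> is_derive x 1 (f i) (f i.+1 x)) ->
  iter k (@dx R) (fun p : R * R => f 0%N p.1 * g p.2) = (fun p => f k p.1 * g p.2).
Proof.
elim: k => [//|k IH] df; rewrite iterS (IH (fun i x ik => df i x (ltnW ik))).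
apply/funext => -[x y]; apply: derive_val; apply/(is_derive_slice _ x y _).1 => /=.
have dk := df k x (ltnSn k).
by apply: is_derive_eq; rewrite /GRing.scale /= mulr0 add0r mulrC.
Qed.

Lemma iter_dy_tensor (R : realType) (k : nat) (f : R -> R) (g : nat -> R -> R) :
  (forall i (x : R), (i < k)%N -> is_derive x 1 (g i) (g i.+1 x)) ->
  iter k (@dy R) (fun p : R * R => f p.1 * g 0%N p.2) = (fun p => f p.1 * g k p.2).
Proof.
elim: k => [//|k IH] dg; rewrite iterS (IH (fun i x ik => dg i x (ltnW ik))).
apply/funext => -[x y]; apply: derive_val; apply/(is_derive_slice _ x y _).2 => /=.
have dk := dg k y (ltnSn k).
by apply: is_derive_eq; rewrite /GRing.scale.
Qed.

Lemma second_diff_x (R : realType) (u : R * R -> R) (s x y : R) :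
  second_diff ((1, 0) : R * R) s u (x, y) = diff2 s (fun z => u (z, y)) x.
Proof.
rewrite /second_diff /diff2; congr (u _ - _ + u _).
  by apply: injective_projections => /=; rewrite ?scaler0 ?addr0// /GRing.scale /= mulr1.
by apply: injective_projections => /=; rewrite ?scaler0 ?subr0// /GRing.scale /= mulr1.
Qed.

Lemma second_diff_y (R : realType) (u : R * R -> R) (s x y : R) :
  second_diff ((0, 1) : R * R) s u (x, y) = diff2 s (fun z => u (x, z)) y.
Proof.
rewrite /second_diff /diff2; congr (u _ - _ + u _).
  by apply: injective_projections => /=; rewrite ?scaler0 ?addr0// /GRing.scale /= mulr1.
by apply: injective_projections => /=; rewrite ?scaler0 ?subr0// /GRing.scale /= mulr1.
Qed.

Lemma diff2Zr (R : realType) (s k : R) (f : R -> R) (x : R) :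
  diff2 s (fun z => f z * k) x = diff2 s f x * k.
Proof. by rewrite /diff2; ring. Qed.

Lemma diff2Zl (R : realType) (s k : R) (f : R -> R) (x : R) :
  diff2 s (fun z => k * f z) x = k * diff2 s f x.
Proof. by rewrite /diff2; ring. Qed.

Section weak_derivative.
Context (R : realType).
Local Notation mu := (@lebesgue_measure R).
Local Notation mu2 := ((@lebesgue_measure R \x @lebesgue_measure R)%E).

Lemma cbox_compactly_supported (A : R) (f : R * R -> R) : cbox A f -> compactly_supported f.
Proof.
move=> [_ sf]; exists (`[- A, A]%classic `*` `[- A, A]%classic).
  by apply: compact_setX; exact: segment_compact.
move=> p h; apply: sf; have [h1|] := ltP A `|p.1|; first by left.
have [h2|] := ltP A `|p.2|; first by right.
by move=> h2 h1; exfalso; apply: h; split; rewrite /= in_itv /= -ler_norml.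
Qed.

Lemma tensor_cbox (f g : R -> R) (x0 y0 a b A : R) :
  continuous f -> continuous g ->
  (forall x, a < `|x - x0| -> f x = 0) -> (forall y, b < `|y - y0| -> g y = 0) ->
  a + `|x0| <= A -> b + `|y0| <= A -> cbox A (fun p => f p.1 * g p.2).
Proof.
move=> cf cg f0 g0 aA bA; split; first exact: tensor_continuous.
have key (z z0 c : R) : c + `|z0| <= A -> A < `|z| -> c < `|z - z0|.
  by move=> h1 h2; have := lerB_dist z z0; lra.
by move=> p [h|h]; [rewrite f0 ?mul0r//|rewrite g0 ?mulr0//]; apply: key h.
Qed.

Lemma bump_out (a b c x0 : R) n (x : R) : 0 < a -> 0 < b -> 0 < c -> (n < 5)%N ->
  a + b + c < `|x - x0| -> bump a b c x0 n.+1 x = 0.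
Proof.
move=> a0 b0 c0 n5; case: (ler0P (x - x0)) => h h2.
  by apply: bump_left => //; lra.
by apply: bump_right0 => //; lra.
Qed.

Lemma hat_out (c x0 x : R) : 0 < c -> c < `|x - x0| -> hat c x0 x = 0.
Proof.
move=> c0; case: (ler0P (x - x0)) => h h2; [apply: hat_left|apply: hat_right] => //; lra.
Qed.

(** The index of [bump] is reversed, so that [i] counts derivatives of the spline [bump a b c x0 5];
    meaningful for [i <= 4]. *)
Let bump_family (a b c x0 : R) (i : nat) : R -> R := bump a b c x0 (5 - i).

Let bump_familyP (a b c x0 : R) i (x : R) : (i < 4)%N ->
  is_derive x 1 (bump_family a b c x0 i) (bump_family a b c x0 i.+1 x).
Proof.
case: i => [|[|[|[|i]]]] h; last by [].
- exact (is_derive_bump a b c x0 3 x).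
- exact (is_derive_bump a b c x0 2 x).
- exact (is_derive_bump a b c x0 1 x).
- exact (is_derive_bump a b c x0 0 x).
Qed.

Let bump_family4 (a b c x0 y : R) :
  bump_family a b c x0 4 y = diff2 a (diff2 b (hat c x0)) y.
Proof. by rewrite /bump_family (_ : (5 - 4)%N = 1%N)// bump1E. Qed.

Let bump_family_continuous (a b c x0 : R) i : (i <= 4)%N -> continuous (bump_family a b c x0 i).
Proof. by case: i => [|[|[|[|[|]]]]] // _; exact: bump_continuous. Qed.

Variables (u g : R * R -> R) (C : R).
Hypotheses (cu : continuous u) (mg : measurable_fun setT g) (C0 : 0 <= C).
Hypothesis gC : {ae mu2, forall p, `|g p| <= C}.

(** Four derivatives of [psi] in the first variable give the second differences of [k] of steps [s]
    and [r]. The cross factor [B] is a full spline and not a tent because test functions must be of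
    class C^4 jointly. The support of [psi] does not shrink with [d]; only its mass matters. *)
Lemma weak_partial_diff_x (s r : R) (p0 : R * R) : 0 < s -> 0 < r ->
  weak_partial 4 0 u g ->
  `|second_diff ((1, 0) : R * R) r (second_diff ((1, 0) : R * R) s u) p0| <=
    C * s ^+ 2 * r ^+ 2.
Proof.
move=> s0 r0 weak.
apply: concentrating_kernel_bound.
  by do 2!apply: second_diff_continuous.
(* The factor [B] has radius [3 * c], so [c = d / 3] keeps the kernel within [d] of [p0]. *)
move=> d d0; have c0 : 0 < d / 3 by rewrite divr_gt0.
set c := d / 3 in c0; have dE : d = c + c + c by rewrite /c; field.
pose B := bump c c c p0.2 5.
pose k (p : R * R) := hat c p0.1 p.1 * B p.2.
pose psi (p : R * R) := bump s r c p0.1 5 p.1 * B p.2.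
pose A := s + r + d + `|p0.1| + `|p0.2|.
have n1 := normr_ge0 p0.1; have n2 := normr_ge0 p0.2.
have cB : continuous B by exact: (bump_continuous (n := 4)).
have Bout y : c + c + c < `|y - p0.2| -> B y = 0 by move=> h; exact: bump_out.
have hout x : c < `|x - p0.1| -> hat c p0.1 x = 0 by move=> h; exact: hat_out.
have bk : cbox A k.
  apply: (tensor_cbox _ cB hout Bout); first exact: hat_continuous.
    by rewrite /A; lra.
  by rewrite /A; lra.
have bpsi : cbox A psi.
  apply: (@tensor_cbox _ _ p0.1 p0.2 (s + r + c) (c + c + c) _ _ cB _ Bout).
  - exact: (bump_continuous (n := 4)).
  - by move=> x h; exact: bump_out.
  - by rewrite /A; lra.
  - by rewrite /A; lra.
have B0 y : 0 <= B y by exact: bump5_ge0.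
have h0 x : 0 <= hat c p0.1 x by exact: hat_ge0.
have [Bint BI] := bump5_integral p0.2 c0 c0 c0.
have [hint hI] := hat_integral p0.1 c0.
have [bint bI] := bump5_integral p0.1 s0 r0 c0.
have kI : \int[mu2]_p k p = c ^+ 2 * (c ^+ 2 * c ^+ 2 * c ^+ 2).
  rewrite plane_tensor_integral// ?hI ?BI//; exact: hat_continuous.
have psiI : \int[mu2]_p psi p = s ^+ 2 * r ^+ 2 * \int[mu2]_p k p.
  rewrite plane_tensor_integral// ?bI ?BI ?kI; first by ring.
    exact: (bump_continuous (n := 4)).
  by move=> x; exact: bump5_ge0.
exists k, A; split=> //.
- by move=> p; rewrite mulr_ge0.
- move=> p [h|h]; rewrite /k; first by rewrite hout ?mul0r//; lra.
  by rewrite Bout ?mulr0//; lra.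
- by rewrite kI !mulr_gt0// exprn_gt0.
- apply: (@weak_second_diff_mean _ A u g psi k _ s r C) => //=; rewrite ?normr1 ?normr0//; try exact: ltW.
  + by move=> p; rewrite mulr_ge0// bump5_ge0.
  + have Ckpsi : Ck (4 + 0) psi.
      apply: (@Ck_tensor R 4 (bump_family s r c p0.1) (bump_family c c c p0.2)).
      * exact: bump_familyP.
      * exact: bump_familyP.
      * exact: bump_family_continuous.
      * exact: bump_family_continuous.
    have := weak psi Ckpsi (cbox_compactly_supported bpsi).
    have -> : (-1) ^+ (4 + 0) = 1 :> R by ring.
    rewrite mul1r => <-.
    rewrite (@iter_dx_tensor R 4 (bump_family s r c p0.1) B (bump_familyP s r c p0.1)).
    apply: eq_Rintegral => -[x y] _; rewrite second_diff_x.
    rewrite (_ : (fun z => second_diff _ r k (z, y)) = fun z => diff2 r (hat c p0.1) z * B y).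
      by rewrite diff2Zr bump_family4.
    by apply/funext => z; rewrite second_diff_x /k /= diff2Zr.
Qed.

Lemma weak_partial_diff_y (s r : R) (p0 : R * R) : 0 < s -> 0 < r ->
  weak_partial 0 4 u g ->
  `|second_diff ((0, 1) : R * R) r (second_diff ((0, 1) : R * R) s u) p0| <=
    C * s ^+ 2 * r ^+ 2.
Proof.
move=> s0 r0 weak.
apply: concentrating_kernel_bound.
  by do 2!apply: second_diff_continuous.
move=> d d0; have c0 : 0 < d / 3 by rewrite divr_gt0.
set c := d / 3 in c0; have dE : d = c + c + c by rewrite /c; field.
pose B := bump c c c p0.1 5.
pose k (p : R * R) := B p.1 * hat c p0.2 p.2.
pose psi (p : R * R) := B p.1 * bump s r c p0.2 5 p.2.
pose A := s + r + d + `|p0.1| + `|p0.2|.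
have n1 := normr_ge0 p0.1; have n2 := normr_ge0 p0.2.
have cB : continuous B by exact: (bump_continuous (n := 4)).
have Bout y : c + c + c < `|y - p0.1| -> B y = 0 by move=> h; exact: bump_out.
have hout x : c < `|x - p0.2| -> hat c p0.2 x = 0 by move=> h; exact: hat_out.
have bk : cbox A k.
  apply: (tensor_cbox cB _ Bout hout); first exact: hat_continuous.
    by rewrite /A; lra.
  by rewrite /A; lra.
have bpsi : cbox A psi.
  apply: (@tensor_cbox _ _ p0.1 p0.2 (c + c + c) (s + r + c) _ cB _ Bout).
  - exact: (bump_continuous (n := 4)).
  - by move=> x h; exact: bump_out.
  - by rewrite /A; lra.
  - by rewrite /A; lra.
have B0 y : 0 <= B y by exact: bump5_ge0.
have h0 x : 0 <= hat c p0.2 x by exact: hat_ge0.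
have [Bint BI] := bump5_integral p0.1 c0 c0 c0.
have [hint hI] := hat_integral p0.2 c0.
have [bint bI] := bump5_integral p0.2 s0 r0 c0.
have kI : \int[mu2]_p k p = c ^+ 2 * c ^+ 2 * c ^+ 2 * c ^+ 2.
  rewrite plane_tensor_integral// ?hI ?BI//; exact: hat_continuous.
have psiI : \int[mu2]_p psi p = s ^+ 2 * r ^+ 2 * \int[mu2]_p k p.
  rewrite plane_tensor_integral// ?bI ?BI ?kI; first by ring.
    exact: (bump_continuous (n := 4)).
  by move=> x; exact: bump5_ge0.
exists k, A; split=> //.
- by move=> p; rewrite mulr_ge0.
- move=> p [h|h]; rewrite /k; last by rewrite hout ?mulr0//; lra.
  by rewrite Bout ?mul0r//; lra.
- by rewrite kI !mulr_gt0// exprn_gt0.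
- apply: (@weak_second_diff_mean _ A u g psi k _ s r C) => //=; rewrite ?normr1 ?normr0//; try exact: ltW.
  + by move=> p; rewrite mulr_ge0// bump5_ge0.
  + have Ckpsi : Ck (0 + 4) psi.
      apply: (@Ck_tensor R 4 (bump_family c c c p0.1) (bump_family s r c p0.2)).
      * exact: bump_familyP.
      * exact: bump_familyP.
      * exact: bump_family_continuous.
      * exact: bump_family_continuous.
    have := weak psi Ckpsi (cbox_compactly_supported bpsi).
    have -> : (-1) ^+ (0 + 4) = 1 :> R by ring.
    rewrite mul1r => <-.
    rewrite (@iter_dy_tensor R 4 B (bump_family s r c p0.2) (bump_familyP s r c p0.2)).
    apply: eq_Rintegral => -[x y] _; rewrite second_diff_y.
    rewrite (_ : (fun z => second_diff _ r k (x, z)) = fun z => B x * diff2 r (hat c p0.2) z).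
      by rewrite diff2Zl -bump_family4.
    by apply/funext => z; rewrite second_diff_y /k /= diff2Zl.
Qed.

End weak_derivative.

Lemma slice_continuous (R : realType) (w : R * R -> R) (x y : R) : continuous w ->
  continuous (fun t => w (t, y)) /\ continuous (fun t => w (x, t)).
Proof.
move=> cw; split=> z.
  have h : (t, y) @[t --> z] --> (nbhs z, nbhs y).
    by apply: cvg_pair; [exact: cvg_id|exact: cvg_cst].
  exact: (@continuous_comp _ _ _ (fun t : R => (t, y)) w z h (cw (z, y))).
have h : (x, t) @[t --> z] --> (nbhs x, nbhs z).
  by apply: cvg_pair; [exact: cvg_cst|exact: cvg_id].
exact: (@continuous_comp _ _ _ (fun t : R => (x, t)) w z h (cw (x, z))).
Qed.

(** Only the two pure fourth derivatives enter, one per direction; each contributes [C / 12 * h ^ 4]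
    before division by [h ^ 2]. *)
Lemma grid_laplacian_consistent (R : realType) (u : R * R -> R) (C h : R) (i j : int) :
  Wkoo_le 4 u C -> Ck 2 u -> 0 < h ->
  `|grid_laplacian h (grid_restrict h u) i j - laplacian u (i%:~R * h, j%:~R * h)| <=
    C / 6 * h ^+ 2.
Proof.
move=> wu [cu [ux uy [_ [uxx _ cuxx _]] [_ [_ uyy _ cuyy]]]] h0.
have {cuxx} cuxx : continuous (dx (dx u)) by case: cuxx.
have {cuyy} cuyy : continuous (dy (dy u)) by case: cuyy.
have [gx [mgx wx Nx]] := wu 4%N 0%N isT; have [gy [mgy wy Ny]] := wu 0%N 4%N isT.
have C0 : 0 <= C by rewrite -lee_fin; apply: le_trans Nx; exact: Lnorm_ge0.
have ax := essential_bound mgx Nx; have ay := essential_bound mgy Ny.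
set x := i%:~R * h; set y := j%:~R * h.
have tx : `|diff2 h (fun z => u (z, y)) x - dx (dx u) (x, y) * h ^+ 2| <= C / 12 * h ^+ 4.
  apply: (@diff2_taylor _ (fun z => u (z, y)) (fun z => dx u (z, y))
    (fun z => dx (dx u) (z, y))); last 2 first.
  - exact: ltW.
  - move=> s r s0 r0.
    have := weak_partial_diff_x cu mgx C0 ax (x, y) s0 r0 wx.
    rewrite second_diff_x.
    rewrite (_ : (fun z => second_diff _ s u (z, y)) = diff2 s (fun z => u (z, y)))//.
    by apply/funext => z; rewrite second_diff_x.
  - by move=> z; exact: is_derive_dx.
  - by move=> z; exact: is_derive_dx.
  - exact: (slice_continuous x y cuxx).1.
have ty : `|diff2 h (fun z => u (x, z)) y - dy (dy u) (x, y) * h ^+ 2| <= C / 12 * h ^+ 4.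
  apply: (@diff2_taylor _ (fun z => u (x, z)) (fun z => dy u (x, z))
    (fun z => dy (dy u) (x, z))); last 2 first.
  - exact: ltW.
  - move=> s r s0 r0.
    have := weak_partial_diff_y cu mgy C0 ay (x, y) s0 r0 wy.
    rewrite second_diff_y.
    rewrite (_ : (fun z => second_diff _ s u (x, z)) = diff2 s (fun z => u (x, z)))//.
    by apply/funext => z; rewrite second_diff_y.
  - by move=> z; exact: is_derive_dy.
  - by move=> z; exact: is_derive_dy.
  - exact: (slice_continuous x y cuyy).2.
have h2 : 0 < h ^+ 2 by rewrite exprn_gt0.
have gE : grid_laplacian h (grid_restrict h u) i j - laplacian u (x, y) =
    ((diff2 h (fun z => u (z, y)) x - dx (dx u) (x, y) * h ^+ 2) +
     (diff2 h (fun z => u (x, z)) y - dy (dy u) (x, y) * h ^+ 2)) / h ^+ 2.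
  have succE (k : int) : (k + 1)%:~R * h = k%:~R * h + h.
    by rewrite rmorphD /= mulrDl mul1r.
  have predE (k : int) : (k - 1)%:~R * h = k%:~R * h - h.
    by rewrite rmorphB /= mulrBl mul1r.
  rewrite /grid_laplacian /grid_restrict (succE i) (succE j) (predE i) (predE j).
  rewrite -/x -/y /laplacian /diff2; move: h2.
  move: (u _) (u _) (u _) (u _) (u _) (dx _ _) (dy _ _) => u1 u2 u3 u4 u5 u6 u7 h2.
  by field; exact: lt0r_neq0.
rewrite gE normrM normfV (gtr0_norm h2) ler_pdivrMr//.
apply: le_trans (ler_normD _ _) _; apply: le_trans (lerD tx ty) _.
by rewrite le_eqVlt; apply/orP; left; apply/eqP; field.
Qed.

(** * The error estimate *)

Lemma omega_kernelE (R : realType) (alpha x : R) :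
  omega (1 - alpha) x = (Gamma (1 - alpha))^-1 * x `^ (- alpha).
Proof. by rewrite /omega mulrC; congr (_ * _ `^ _); ring. Qed.

Section l1_kernel_bounds.
Context (R : realType) (alpha : R) (t : nat -> R) (n : nat).
Hypotheses (alpha01 : 0 < alpha < 1) (tinc : forall k, (k < n)%N -> t k < t k.+1).
Local Notation mu := (@lebesgue_measure R).
Local Notation c := (Gamma (1 - alpha))^-1.
Local Notation a := (l1_kernel alpha t).

Lemma mesh_le k l : (k <= l)%N -> (l <= n)%N -> t k <= t l.
Proof.
elim: l => [|l IH]; first by rewrite leqn0 => /eqP ->.
rewrite leq_eqVlt => /predU1P[->//|]; rewrite ltnS => kl ln.
by apply: le_trans (IH kl (ltnW ln)) _; exact: ltW (tinc ln).
Qed.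

Lemma mesh_lt k l : (k < l)%N -> (l <= n)%N -> t k < t l.
Proof.
move=> kl ln; apply: lt_le_trans (tinc (leq_trans kl ln)) _.
exact: mesh_le.
Qed.

Lemma Gamma_inv_gt0 : 0 < c.
Proof. by rewrite invr_gt0 Gamma_gt0// subr_gt0; case/andP: alpha01. Qed.

Let cell j k : (1 <= k <= j)%N -> (j <= n)%N -> t k.-1 < t k /\ t k <= t j.
Proof.
move=> /andP[k1 kj] jn; split; last exact: mesh_le.
by rewrite -{2}(prednK k1); apply: tinc; rewrite prednK// (leq_trans kj).
Qed.

Lemma l1_kernelE j k : (1 <= k <= j)%N -> (j <= n)%N ->
  a j k = (t k - t k.-1)^-1 * \int[mu]_(s in `]t k.-1, t k[) (c * (t j - s) `^ (- alpha)).
Proof.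
move=> kj jn; have [tk tkj] := cell kj jn.
rewrite /l1_kernel /step; congr (_ * _).
have /integrableP[mW _] := kernel_integrable c alpha01 tk tkj.
rewrite /Rintegral -(integral_itv_bndoo true false mW); congr fine.
by apply: eq_integral => s _; rewrite omega_kernelE.
Qed.

Lemma l1_kernel_ge j k : (1 <= k <= j)%N -> (j <= n)%N ->
  c * (t j - t k.-1) `^ (- alpha) <= a j k.
Proof.
move=> kj jn; have [tk tkj] := cell kj jn.
rewrite l1_kernelE// ler_pdivlMl ?subr_gt0// mulrC.
exact: kernel_integral_ge alpha01 Gamma_inv_gt0 _ _ tk tkj.
Qed.

(** The integrand increases in [s], so its value at the shared node [t k] separates the means over
    the two neighbouring cells. *)
Lemma l1_kernel_mono j k : (1 <= k < j)%N -> (j <= n)%N -> a j k <= a j k.+1.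
Proof.
move=> /andP[k1 kj] jn; have k1j : (1 <= k <= j)%N by rewrite k1 ltnW.
have [tk tkj] := cell k1j jn.
apply: (@le_trans _ _ (c * (t j - t k) `^ (- alpha))).
  rewrite l1_kernelE// ler_pdivrMl ?subr_gt0// mulrC.
  exact: kernel_integral_le alpha01 Gamma_inv_gt0 _ _ tk (mesh_lt kj jn).
by apply: (@l1_kernel_ge j k.+1).
Qed.

Lemma l1_kernel_ge0 j k : (1 <= k <= j)%N -> (j <= n)%N -> 0 <= a j k.
Proof.
move=> kj jn; apply: le_trans (l1_kernel_ge kj jn).
by rewrite mulr_ge0 ?powR_ge0// ltW// Gamma_inv_gt0.
Qed.

Lemma l1_kernel_diag j : (1 <= j <= n)%N ->
  a j j <= c / (1 - alpha) * (t j - t j.-1) `^ (- alpha).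
Proof.
move=> /andP[j1 jn]; have jj : (1 <= j <= j)%N by rewrite j1 leqnn.
have [tj _] := cell jj jn.
have d0 : 0 < t j - t j.-1 by rewrite subr_gt0.
rewrite l1_kernelE// ler_pdivrMl//.
apply: le_trans (kernel_integral_diag alpha01 Gamma_inv_gt0 tj) _.
rewrite powRD ?(gt_eqF d0) ?implybT// powRr1 ?(ltW d0)//.
by rewrite le_eqVlt; apply/orP; left; apply/eqP; ring.
Qed.

End l1_kernel_bounds.

Lemma caputoE (R : realType) (alpha : R) (v : R -> R) (T : R) :
  caputo alpha v T = \int[@lebesgue_measure R]_(s in `]0, T[)
    ((Gamma (1 - alpha))^-1 * (T - s) `^ (- alpha) * derive1 v s).
Proof. by apply: eq_Rintegral => s _; rewrite omega_kernelE. Qed.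

(** * Grid norms and the error estimates *)

Lemma grid_restrict_periodic (R : realType) (L : R) M (u : R * R -> R) :
  (0 < M)%N -> periodic2 L u -> grid_periodic M (grid_restrict (L / M%:R) u).
Proof.
move=> M0 pu i j; have e (k : int) : (k + M%:Z)%:~R * (L / M%:R) = k%:~R * (L / M%:R) + L.
  rewrite rmorphD /= mulrDl; congr (_ + _).
  by rewrite -pmulrn mulrC divfK// pnatr_eq0 -lt0n.
by rewrite /grid_restrict !e; exact: pu.
Qed.

Lemma grid_sum_const (R : realType) M (x : R) :
  \sum_(1 <= i < M.+1) \sum_(1 <= j < M.+1) x = M%:R ^+ 2 * x.
Proof.
rewrite !sumr_const_nat subn1 /=.
by rewrite -(mulr_natr (x *+ M) M) -(mulr_natr x M); ring.
Qed.

Lemma grid_norm_le (R : realType) (L E : R) M (v : int -> int -> R) :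
  (0 < M)%N -> 0 < L -> 0 <= E -> (forall i j, `|v i j| <= E) ->
  grid_norm M (L / M%:R) v <= L * E.
Proof.
move=> M0 L0 E0 vE.
rewrite /grid_norm -[leRHS]ger0_norm ?mulr_ge0 ?(ltW L0)// -sqrtr_sqr.
apply: ler_wsqrtr; rewrite /grid_inner.
have cell i j : v i j * v i j <= E ^+ 2.
  by rewrite -expr2 -real_normK ?num_real// lerXn2r ?nnegrE.
apply: (@le_trans _ _ ((L / M%:R) ^+ 2 * \sum_(1 <= i < M.+1) \sum_(1 <= j < M.+1) E ^+ 2)).
  apply: ler_wpM2l; first exact: sqr_ge0.
  by apply: ler_sum => i _; apply: ler_sum => j _; exact: cell.
rewrite grid_sum_const le_eqVlt; apply/orP; left; apply/eqP.
by field; rewrite pnatr_eq0 -lt0n.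
Qed.

Lemma grid_lp6_sum_le (R : realType) (c h : R) M (v : int -> int -> R) :
  grid_lp M h 6 v <= c ->
  h ^+ 2 * \sum_(1 <= i < M.+1) \sum_(1 <= j < M.+1) v i%:Z j%:Z ^+ 6 <= c ^+ 6.
Proof.
rewrite /grid_lp; set S := h ^+ 2 * _ => Sc.
have -> : h ^+ 2 * \sum_(1 <= i < M.+1) \sum_(1 <= j < M.+1) v i%:Z j%:Z ^+ 6 = S.
  congr (_ * _); apply: eq_bigr => i _; apply: eq_bigr => j _.
  by rewrite -normrX ger0_norm// (@exprM _ _ 2 3) exprn_ge0// sqr_ge0.
have S0 : 0 <= S.
  rewrite mulr_ge0 ?sqr_ge0//; apply: sumr_ge0 => i _; apply: sumr_ge0 => j _.
  exact: exprn_ge0.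
have -> : S = (S `^ 6%:R^-1) ^+ 6.
  by rewrite -powR_mulrn ?powR_ge0// -powRrM mulVf ?powRr1// pnatr_eq0.
by apply: lerXn2r; rewrite ?nnegrE ?powR_ge0// (le_trans _ Sc)// powR_ge0.
Qed.

(* x^2 <= 1 + x^6 turns the l^6 bounds into an l^2 bound. *)
Lemma grid_norm_sub_le (R : realType) (L c0 c1 : R) M (u v : int -> int -> R) :
  (0 < M)%N ->
  grid_lp M (L / M%:R) 6 u <= c1 -> grid_lp M (L / M%:R) 6 v <= c0 ->
  grid_norm M (L / M%:R) (fun i j => u i j - v i j) <=
    Num.sqrt (4 * L ^+ 2 + 2 * c1 ^+ 6 + 2 * c0 ^+ 6).
Proof.
move=> M0 /grid_lp6_sum_le hu /grid_lp6_sum_le hv.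
apply: ler_wsqrtr; rewrite /grid_inner.
set h := L / M%:R in hu hv *.
have L2 : h ^+ 2 * \sum_(1 <= i < M.+1) \sum_(1 <= j < M.+1) (4 : R) = 4 * L ^+ 2.
  rewrite grid_sum_const /h.
  by field; rewrite pnatr_eq0 -lt0n.
have pt (x y : R) : (x - y) * (x - y) <= 4 + 2 * x ^+ 6 + 2 * y ^+ 6.
  have sq (z : R) : z ^+ 2 <= 1 + z ^+ 6.
    rewrite (@exprM _ z 2 3); have := sqr_ge0 z; move: (z ^+ 2) => w w0.
    have [w1|w1] := leP w 1; first by have := exprn_ge0 3 w0; lra.
    have : w <= w ^+ 3 by rewrite ler_eXnr// ltW.
    lra.
  have := sq x; have := sq y; have := sqr_ge0 (x + y); rewrite !expr2; lra.
apply: (@le_trans _ _ (h ^+ 2 * \sum_(1 <= i < M.+1) \sum_(1 <= j < M.+1)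
    (4 + 2 * u i%:Z j%:Z ^+ 6 + 2 * v i%:Z j%:Z ^+ 6))).
  apply: ler_wpM2l; first exact: sqr_ge0.
  by apply: ler_sum => i _; apply: ler_sum => j _; exact: pt.
have -> : \sum_(1 <= i < M.+1) \sum_(1 <= j < M.+1)
    (4 + 2 * u i%:Z j%:Z ^+ 6 + 2 * v i%:Z j%:Z ^+ 6) =
    \sum_(1 <= i < M.+1) \sum_(1 <= j < M.+1) (4 : R) +
    2 * \sum_(1 <= i < M.+1) \sum_(1 <= j < M.+1) u i%:Z j%:Z ^+ 6 +
    2 * \sum_(1 <= i < M.+1) \sum_(1 <= j < M.+1) v i%:Z j%:Z ^+ 6.
  rewrite !mulr_sumr -!big_split /=; apply: eq_bigr => i _.
  by rewrite !mulr_sumr -!big_split.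
by rewrite !mulrDr L2 !(mulrCA _ 2); lra.
Qed.

Lemma grid_laplacianB (R : realType) (h : R) (u v : int -> int -> R) i j :
  grid_laplacian h (fun x y => u x y - v x y) i j =
  grid_laplacian h u i j - grid_laplacian h v i j.
Proof. by rewrite /grid_laplacian; ring. Qed.

Lemma le_bigmax_nat (R : realType) (F : nat -> R) (m n k : nat) : (m <= k < n)%N ->
  F k <= \big[Num.max/0]_(m <= i < n) F i.
Proof. by move=> mk; apply: (@bigmax_sup_seq _ _ _ _ _ k) => //; rewrite mem_index_iota. Qed.

Lemma bigmax_nat_le (R : realType) (F : nat -> R) (m n : nat) (x : R) : 0 <= x ->
  (forall k, (m <= k < n)%N -> F k <= x) -> \big[Num.max/0]_(m <= k < n) F k <= x.
Proof.
move=> x0 Fx; rewrite big_nat_cond; elim/big_rec: _ => // k y; rewrite andbT => mk yx.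
by rewrite ge_max Fx.
Qed.

(** The target right-hand side without [1 / sigma] and [1 / (1 - alpha)]; both factors are at least
    1 and are restored in [mesh_error_le]. *)
Definition mesh_error (R : realType) (alpha sigma h : R) (t : nat -> R) (n : nat) : R :=
  step t 1 `^ sigma +
  \big[Num.max/0]_(2 <= k < n.+1)
    (t k `^ alpha * t k.-1 `^ (sigma - 2) * step t k `^ (2 - alpha)) + h ^+ 2.

Lemma is_derive_derive1 (R : realType) (f : R -> R) (s : R) :
  derivable f s 1 -> is_derive s 1 f (derive1 f s).
Proof. by move=> df; split=> //; rewrite derive1E. Qed.

Section small_steps.
Context (R : realType) (alpha kappa eps sigma L T Creg : R).
Context (Phi0 : R * R -> R) (Phi : R -> R * R -> R).
Hypotheses (alpha01 : 0 < alpha < 1) (kappa0 : 0 < kappa) (sigma01 : 0 < sigma < 1).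
Hypotheses (L0 : 0 < L) (T0 : 0 < T).
Hypothesis (hPhi : allen_cahn_solution alpha kappa eps L T Phi0 Phi).
Hypothesis (hreg : allen_cahn_regular sigma T Creg Phi).

Let al0 : 0 < alpha. Proof. by case/andP: alpha01. Qed.
Let al1 : 0 < 1 - alpha. Proof. by rewrite subr_gt0; case/andP: alpha01. Qed.
Let sg0 : 0 < sigma. Proof. by case/andP: sigma01. Qed.

Lemma Creg_ge0 : 0 <= Creg.
Proof.
have h : 0 < T / 2 < T by move: T0; lra.
have := reg_time hreg (0 : R * R) (isT : (1 <= 1 <= 2)%N) h.
move=> /(le_trans (normr_ge0 _)); rewrite pmulr_lge0//.
by rewrite ltr_pwDl// powR_ge0.
Qed.

(** For [s < T] the constant 1 in the regularity bound is at most
    [T ^ (l - sigma) * s ^ (sigma - l)], so the pure power remains, as the truncation lemmas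
    require. *)
Lemma time_derivative_bound (l : nat) (p : R * R) (s : R) : (1 <= l <= 2)%N -> 0 < s < T ->
  `|derive1n l (fun s => Phi s p) s| <= Creg * (1 + T `^ (l%:R - sigma)) * s `^ (sigma - l%:R).
Proof.
move=> l12 s0T; apply: le_trans (reg_time hreg p l12 s0T) _.
rewrite -mulrA; apply: ler_wpM2l; first exact: Creg_ge0.
rewrite mulrDl mul1r addrC lerD2l.
case/andP: s0T => s0 sT; rewrite -[l%:R - sigma]opprB powRN.
rewrite ler_pdivlMl ?mulr1 ?powR_gt0//.
rewrite -[sigma - _]opprB; apply: ler_powRN => //; last exact: ltW.
rewrite subr_ge0; case/andP: sigma01 => _ s1; apply: le_trans (ltW s1) _.
by rewrite ler1n; case/andP: l12.
Qed.

(** The supersolution is [W = K4 * B * w - G]. The part [- G] reproduces the history sum of the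
    truncation error; what remains, [2 * a j j * G j] with the first-cell and spatial errors, is at
    most a multiple of [B * t j ^ (- alpha)], which the barrier supplies. *)
Lemma small_step_error : exists delta K : R, [/\ 0 < delta, 0 < K &
  forall (M N : nat) (t : nat -> R) (phi : nat -> int -> int -> R),
    (0 < M)%N -> time_mesh T N t ->
    l1_scheme alpha kappa eps L Phi0 M N t phi ->
    forall n, (1 <= n <= N)%N -> (forall k, (1 <= k <= n)%N -> step t k <= delta) ->
    forall x y, `|grid_restrict (L / M%:R) (Phi (t n)) x y - phi n x y| <=
      K * mesh_error alpha sigma (L / M%:R) t n].
Proof.
pose c := (Gamma (1 - alpha))^-1.
have c0 : 0 < c := Gamma_inv_gt0 alpha01.
have [delta0 [mu [delta00 mu0 barrier]]] := l1_op_barrier al0 c0 kappa0.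
(* At this step size the lower bound of the diagonal kernel equals [2 * kappa], strictly above the
   [kappa] that the comparison must absorb. *)
pose delta1 := (2 * kappa / c) `^ (- alpha^-1).
have q0 : 0 < 2 * kappa / c by rewrite divr_gt0// mulr_gt0.
have delta10 : 0 < delta1 by rewrite powR_gt0.
have delta1E : c * delta1 `^ (- alpha) = 2 * kappa.
  rewrite /delta1 -powRrM mulrNN mulVf ?gt_eqF// powRr1 ?ltW//.
  by rewrite mulrC divfK ?gt_eqF.
have Cr0 := Creg_ge0.
pose C1 := Creg * (1 + T `^ (1%:R - sigma)).
pose C2 := Creg * (1 + T `^ (2%:R - sigma)).
have C10 : 0 <= C1 by rewrite mulr_ge0// addr_ge0 ?powR_ge0.
have C20 : 0 <= C2 by rewrite mulr_ge0// addr_ge0 ?powR_ge0.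
pose KT := C1 * c * (2 `^ alpha / sigma + 2 `^ (1 - sigma) / (1 - alpha) +
    (sigma * (1 - alpha))^-1).
have KT0 : 0 <= KT.
  apply: mulr_ge0; first by rewrite mulr_ge0// ltW.
  by rewrite !addr_ge0 ?divr_ge0 ?invr_ge0 ?powR_ge0 ?mulr_ge0// ltW.
(* One factor 2 sits in [G], the other counts the two copies of [a j j * G j]; [c / (1 - alpha)] is
   the constant of the diagonal kernel. *)
pose K2 := 4 * c * C2 / (1 - alpha).
have K20 : 0 <= K2 by rewrite divr_ge0 ?(ltW al1)// mulr_ge0// mulr_ge0// ltW.
pose K3 := kappa * eps ^+ 2 * (Creg / 6).
have K30 : 0 <= K3 by rewrite mulr_ge0 ?divr_ge0// mulr_ge0 ?sqr_ge0// ltW.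
have Ta : 0 <= T `^ alpha by exact: powR_ge0.
(* [2 / c] compensates the [c / 2] of the barrier, and [T ^ alpha] converts the spatial error,
   constant in time, to the decay [t j ^ (- alpha)]. *)
pose K4 := 2 / c * (KT + K2 + K3 * T `^ alpha).
have K40 : 0 <= K4.
  by rewrite mulr_ge0 ?divr_ge0 ?(ltW c0)// !addr_ge0// mulr_ge0.
exists (Num.min delta0 delta1), (K4 * expR (mu * T) + 1); split.
- by rewrite lt_min delta00.
- by rewrite ltr_wpDl// mulr_ge0// expR_ge0.
move=> M N t phi M0 mesh scheme n /andP[n1 nN] small x y.
have t0 := mesh_start mesh.
have tincN := mesh_incr mesh.
have tinc k : (k < n)%N -> t k < t k.+1 by move=> kn; apply: tincN; exact: leq_trans nN.
have tle := mesh_le tinc; have tlt := mesh_lt tinc.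
have tT j : (j <= n)%N -> t j <= T.
  by move=> jn; rewrite -(mesh_end mesh); apply: (mesh_le tincN) => //; exact: leq_trans nN.
have tpos j : (1 <= j <= n)%N -> 0 < t j by move=> /andP[j1 jn]; rewrite -t0 tlt.
set h := L / M%:R; have h0 : 0 < h by rewrite divr_gt0// ltr0n.
pose a := l1_kernel alpha t.
pose w (k : nat) := if k is 0 then 0 else expR (mu * t k).
pose G (k : nat) := if (2 <= k)%N then
  2 * C2 * t k.-1 `^ (sigma - 2) * (t k - t k.-1) ^+ 2 else 0.
have G0 k : 0 <= G k.
  rewrite /G; case: ifP => // _.
  by rewrite mulr_ge0 ?sqr_ge0// mulr_ge0 ?powR_ge0// mulr_ge0.
pose B := mesh_error alpha sigma h t n.
pose Mx := \big[Num.max/0]_(2 <= k < n.+1)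
    (t k `^ alpha * t k.-1 `^ (sigma - 2) * step t k `^ (2 - alpha)).
have Mx0 : 0 <= Mx by exact: bigmax_ge_id.
have BE : B = t 1%N `^ sigma + Mx + h ^+ 2 by rewrite /B /mesh_error /step /= t0 subr0.
have s10 : 0 <= t 1%N `^ sigma by exact: powR_ge0.
have h20 : 0 <= h ^+ 2 by exact: sqr_ge0.
have B0 : 0 <= B by rewrite BE !addr_ge0.
have small0 k : (1 <= k <= n)%N -> t k - t k.-1 <= delta0.
  by move=> kn; apply: le_trans (small k kn) _; rewrite ge_min lexx.
have wbar := barrier a t n t0 tinc small0 (fun j k kj jn => l1_kernel_ge alpha01 tinc kj jn).
pose W k := K4 * B * w k + (-1) * G k.
have diag j : (1 <= j <= n)%N -> kappa < a j j.
  move=> /andP[j1 jn]; have jj : (1 <= j <= j)%N by rewrite j1 leqnn.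
  apply: lt_le_trans (l1_kernel_ge alpha01 tinc jj jn).
  have sj : 0 < t j - t j.-1.
    by rewrite subr_gt0 -{2}(prednK j1); apply: tinc; rewrite prednK.
  have sd : t j - t j.-1 <= delta1.
    apply: le_trans (small j _) _; first by rewrite j1.
    by rewrite ge_min lexx orbT.
  apply: (@lt_le_trans _ _ (c * delta1 `^ (- alpha))).
    by rewrite delta1E; move: kappa0; lra.
  by rewrite ler_pM2l//; apply: ler_powRN => //; exact: ltW.
(* The diagonal kernel is at most of order [step ^ (- alpha)] and [G j] carries [step ^ 2]: up to
   constants the product is bounded by the [j]-th entry of the mesh maximum divided by
   [t j ^ alpha]. *)
have aG j : (1 <= j <= n)%N -> 2 * (a j j * G j) <= K2 * Mx * t j `^ (- alpha).
  move=> /andP[j1 jn]; have rhs0 : 0 <= K2 * Mx * t j `^ (- alpha).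
    by apply: mulr_ge0; [exact: mulr_ge0|exact: powR_ge0].
  rewrite /G; case: ifPn => [j2|_]; last by rewrite !mulr0.
  have jn1 : (1 <= j <= n)%N by rewrite j1.
  have sj : 0 < t j - t j.-1.
    by rewrite subr_gt0 -{2}(prednK j1); apply: tinc; rewrite prednK.
  have tj0 := tpos j jn1.
  have := le_bigmax_nat (fun k => t k `^ alpha * t k.-1 `^ (sigma - 2) * step t k `^ (2 - alpha))
    (m := 2) (n := n.+1) (k := j).
  rewrite j2 ltnS jn => /(_ isT); rewrite -/Mx /step => MxE.
  have P0 : 0 <= t j.-1 `^ (sigma - 2) by exact: powR_ge0.
  apply: (@le_trans _ _ (2 * ((c / (1 - alpha) * (t j - t j.-1) `^ (- alpha)) *
      (2 * C2 * t j.-1 `^ (sigma - 2) * (t j - t j.-1) ^+ 2)))).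
    rewrite ler_pM2l//; apply: ler_wpM2r; last exact: l1_kernel_diag alpha01 tinc _ jn1.
    by have := G0 j; rewrite /G j2.
  have pE : (t j - t j.-1) `^ (2 - alpha) =
      (t j - t j.-1) `^ (- alpha) * (t j - t j.-1) ^+ 2.
    rewrite [2 - alpha]addrC powRD ?(gt_eqF sj) ?implybT//; congr (_ * _).
    by rewrite powR_mulrn// ltW.
  rewrite pE in MxE.
  have tt : t j `^ alpha * t j `^ (- alpha) = 1.
    by rewrite -powRD ?subrr ?powRr0// (gt_eqF tj0) implybT.
  have tja0 : 0 <= t j `^ (- alpha) by exact: powR_ge0.
  have key := ler_wpM2l K20 (ler_wpM2r tja0 MxE).
  rewrite [leRHS](_ : _ = K2 * (Mx * t j `^ (- alpha))); last by ring.
  apply: le_trans key; rewrite le_eqVlt; apply/orP; left; apply/eqP.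
  rewrite -[LHS]mul1r -[X in X * _]tt /K2.
  by field; rewrite gt_eqF.
have super j : (1 <= j <= n)%N ->
    kappa * W j + (KT * t j `^ (- alpha) * t 1%N `^ sigma +
      (a j j * G j + \sum_(1 <= k < j) (a j k.+1 - a j k) * G k) + K3 * h ^+ 2) <=
    l1_op a W j.
  move=> /[dup] jn1 /andP[j1 jn].
  rewrite /W l1_opD !l1_opZ (l1_opE _ G)// {3}/G /= mulr0 subr0.
  have bar := wbar j jn1.
  have aGj := aG j jn1.
  have tj0 := tpos j jn1.
  have tja0 : 0 <= t j `^ (- alpha) by exact: powR_ge0.
  have tTa : 1 <= T `^ alpha * t j `^ (- alpha).
    have <- : t j `^ alpha * t j `^ (- alpha) = 1.
      by rewrite -powRD ?subrr ?powRr0// (gt_eqF tj0) implybT.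
    apply: ler_wpM2r => //; apply: ge0_ler_powR; rewrite ?nnegrE ?(ltW al0) ?(ltW tj0) ?(ltW T0)//.
    exact: tT.
  have wj : w j = expR (mu * t j) by rewrite /w; case: (j) j1.
  have KB0 : 0 <= K4 * B by rewrite mulr_ge0.
  have bar2 := ler_wpM2l KB0 bar.
  have KB : K4 * B * (c / 2 * t j `^ (- alpha)) =
      (KT + K2 + K3 * T `^ alpha) * B * t j `^ (- alpha).
    by rewrite /K4; field; rewrite gt_eqF.
  have e1 : KT * t j `^ (- alpha) * t 1%N `^ sigma <= KT * B * t j `^ (- alpha).
    rewrite -mulrA [_ * t 1%N `^ _]mulrC mulrA ler_wpM2r// ler_wpM2l// BE.
    by move: Mx0 h20; lra.
  have e2 : K2 * Mx * t j `^ (- alpha) <= K2 * B * t j `^ (- alpha).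
    by rewrite ler_wpM2r// ler_wpM2l// BE; move: s10 h20; lra.
  have e3 : K3 * h ^+ 2 <= K3 * T `^ alpha * B * t j `^ (- alpha).
    apply: (@le_trans _ _ (K3 * B)); first by rewrite ler_wpM2l// BE; move: s10 Mx0; lra.
    rewrite [leRHS](_ : _ = K3 * (T `^ alpha * t j `^ (- alpha) * B)); last by ring.
    by rewrite ler_wpM2l// ler_peMl.
  have kG : 0 <= kappa * G j by rewrite mulr_ge0// ltW.
  move: bar2; rewrite mulrDr KB -wj; move: e1 e2 e3 kG aGj.
  move: (l1_op a (fun _ => _) j) => op.
  move: (\sum_(1 <= k < j) _) (K4 * B) (t j `^ (- alpha)) (t 1%N `^ sigma) (a j j * G j)
    (K2 * Mx) => S KB' ta s1 aGG KM.
  by rewrite !mulrDl; lra.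
pose e k x y := grid_restrict h (Phi (t k)) x y - phi k x y.
have tjT j : (1 <= j <= n)%N -> 0 < t j <= T.
  by move=> jn; rewrite tpos// tT//; case/andP: jn.
have bound j : (j <= n)%N -> forall x y, `|e j x y| <= W j.
  elim/ltn_ind: j => -[_ _ x' y'|j IH jn].
    (* The scheme starts from the exact initial values and [W 0 = 0]. *)
    rewrite /e (l1_initial scheme) t0 (ac_initial hPhi) subrr normr0.
    by rewrite /W /w /G /= !mulr0 addr0.
  have jn1 : (1 <= j.+1 <= n)%N by [].
  have jj : (1 <= j.+1 <= j.+1)%N by rewrite leqnn.
  have jN : (1 <= j.+1 <= N)%N by rewrite /= (leq_trans jn).
  pose R_ x y := caputo alpha (fun s => Phi s (x%:~R * h, y%:~R * h)) (t j.+1) -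
    l1_op a (fun k => Phi (t k) (x%:~R * h, y%:~R * h)) j.+1.
  pose rho x y := kappa * eps ^+ 2 * (laplacian (Phi (t j.+1)) (x%:~R * h, y%:~R * h) -
    grid_laplacian h (grid_restrict h (Phi (t j.+1))) x y) - R_ x y.
  apply: (l1_scheme_comparison (h := h) (eps := eps) (a := a) (e := e) (rho := rho)
    M0 (ltn0Sn j) kappa0 (diag _ jn1) _ _ _ _ _ _ (super _ jn1)).
  - by move=> k kj; apply: l1_kernel_mono alpha01 tinc _ _ kj jn.
  - by apply: l1_kernel_ge0 alpha01 tinc _ _ _ jn.
  - move=> i k; rewrite /e.
    have per := ac_periodic hPhi (t := t j.+1).
    have [|g1 g2] := grid_restrict_periodic M0 (per _) i k.
      by have /andP[/ltW -> ->] := tjT _ jn1.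
    have [|p1 p2] := l1_periodic scheme (n := j.+1) _ i k; first exact: leq_trans nN.
    by rewrite /h g1 g2 p1 p2.
  - by [].
  - move=> x' y'; have := l1_equation scheme x' y' jN.
    have := ac_equation hPhi (x'%:~R * h, y'%:~R * h) (tjT _ jn1).
    have -> : l1_op a (fun k => e k x' y') j.+1 =
        l1_op a (fun k => Phi (t k) (x'%:~R * h, y'%:~R * h)) j.+1 -
        l1_op a (fun k => phi k x' y') j.+1.
      rewrite -[X in _ - X]mul1r -mulNr -l1_opZ -l1_opD; apply: eq_bigr => k _.
      by rewrite /e /grid_restrict; ring.
    rewrite -/h -/(l1_op a (fun k => phi k x' y') j.+1) => /= E1 ->.
    rewrite /rho /R_ E1 /e grid_laplacianB {1 2}/grid_restrict.
    by ring.
  - move=> x' y'.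
    have tr : `|R_ x' y'| <= KT * t j.+1 `^ (- alpha) * t 1%N `^ sigma +
      (a j.+1 j.+1 * G j.+1 + \sum_(1 <= k < j.+1) (a j.+1 k.+1 - a j.+1 k) * G k).
      pose v s := Phi s (x'%:~R * h, y'%:~R * h).
      rewrite /R_ caputoE -/c -/v.
      have vc : {within `[0, T], continuous v} by exact: ac_time_continuous hPhi _.
      have d1 (s : R) : 0 < s < T -> is_derive s 1 v (derive1 v s).
        by move=> sT; apply: is_derive_derive1; exact: ac_time_derivable hPhi _ _ sT.
      have d2 (s : R) : 0 < s < T -> is_derive s 1 (derive1 v) (derive1 (derive1 v) s).
        move=> sT; apply: is_derive_derive1.
        by have [] := reg_time_derivable hreg (x'%:~R * h, y'%:~R * h) sT.
      have b1 (s : R) : 0 < s < T -> `|derive1 v s| <= C1 * s `^ (sigma - 1).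
        by move=> sT; apply: (@time_derivative_bound 1 _ s).
      have b2 (s : R) : 0 < s < T -> `|derive1 (derive1 v) s| <= C2 * s `^ (sigma - 2).
        by move=> sT; apply: (@time_derivative_bound 2 _ s).
      have aE k : (1 <= k <= j.+1)%N -> a j.+1 k = (t k - t k.-1)^-1 *
          \int[@lebesgue_measure R]_(s in `]t k.-1, t k[) (c * (t j.+1 - s) `^ (- alpha)).
        by move=> kj; apply: l1_kernelE alpha01 tinc _ _ kj jn.
      have tincj k : (k < j.+1)%N -> t k < t k.+1.
        by move=> kj; apply: tinc; exact: leq_trans jn.
      exact: (l1_truncation alpha01 sigma01 c0 vc d1 d2 b1 b2 (ltn0Sn j) t0 tincj (tT _ jn)
        aE (fun=> erefl)).
    have lc := grid_laplacian_consistent x' y' (reg_space hreg (tjT _ jn1))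
      (ac_space hPhi (tjT _ jn1)) h0.
    apply: le_trans (ler_normB _ _) _; rewrite addrC; apply: lerD; first exact: tr.
    have ke0 : 0 <= kappa * eps ^+ 2 by rewrite mulr_ge0 ?sqr_ge0// ltW.
    rewrite normrM (ger0_norm ke0) distrC /K3 -mulrA.
    exact: ler_wpM2l.
  - by move=> k x' y' kj; apply: IH => //; exact: ltnW (leq_trans kj jn).
apply: le_trans (bound n (leqnn n) x y) _; rewrite /W mulN1r.
have wn : w n <= expR (mu * T).
  rewrite /w; case: (n) n1 nN tT => // m _ _ tT'.
  by rewrite ler_expR ler_pM2l// tT'.
have := ler_wpM2l (mulr_ge0 K40 B0) wn; have := G0 n.
by rewrite -/B mulrDl mul1r; move: B0; lra.
Qed.
End small_steps.

Lemma c3_ge0 (R : realType) (cOmega c0 c1 : R) : 0 <= c3 cOmega c0 c1.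
Proof. by rewrite /c3 addr_ge0 ?powR_ge0. Qed.

Lemma min_ratio_ge0 (R : realType) (T : R) N (t : nat -> R) :
  time_mesh T N t -> 0 <= min_ratio N t.
Proof.
move=> mesh; rewrite /min_ratio big_nat_cond.
elim/big_rec: _ => [//|k x /andP[/andP[k2 kN] _] x0]; rewrite le_min x0 andbT.
have st j : (1 <= j <= N)%N -> 0 <= step t j.
  case: j => // j /andP[_ jN]; rewrite /step /= subr_ge0 ltW//.
  exact: (mesh_incr mesh).
case: k k2 kN => // k k1 kN; rewrite divr_ge0// st//=.
by rewrite -ltnS k1 -ltnS ltnW.
Qed.

Section error_bounds.
Context (R : realType) (alpha kappa eps sigma L T : R).
Context (Phi0 : R * R -> R) (Phi : R -> R * R -> R) (Creg cOmega c0 c1 : R).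
Hypotheses (alpha01 : 0 < alpha < 1) (kappa0 : 0 < kappa) (eps0 : 0 < eps).
Hypotheses (sigma01 : 0 < sigma < 1) (L0 : 0 < L) (T0 : 0 < T).
Hypothesis (hPhi : allen_cahn_solution alpha kappa eps L T Phi0 Phi).
Hypothesis (hreg : allen_cahn_regular sigma T Creg Phi).
Local Notation adm := (admissible alpha kappa eps L T Phi0 Phi cOmega c0 c1).

Let al0 : 0 < alpha. Proof. by case/andP: alpha01. Qed.
Let al1 : 0 < 1 - alpha. Proof. by rewrite subr_gt0; case/andP: alpha01. Qed.
Let sg0 : 0 < sigma. Proof. by case/andP: sigma01. Qed.
Let sg1 : sigma < 1. Proof. by case/andP: sigma01. Qed.

(** A large first step shows in [step t 1 ^ sigma]. For a later one, [step t k <= t k] makes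
    [t k ^ alpha * step t k ^ (2 - alpha)] at least [delta ^ 2], while [t k.-1 <= T] bounds the
    remaining negative power from below. *)
Lemma mesh_error_ge_large_step (delta : R) N t n k h : 0 < delta ->
  time_mesh T N t -> (1 <= k <= n)%N -> (n <= N)%N -> delta < step t k ->
  Num.min (delta `^ sigma) (T `^ (sigma - 2) * delta ^+ 2) <= mesh_error alpha sigma h t n.
Proof.
move=> d0 mesh /andP[k1 kn] nN dk; have tinc := mesh_incr mesh.
have t0 := mesh_start mesh; have tN := mesh_end mesh.
have s0 : 0 < step t k by exact: lt_trans dk.
rewrite /mesh_error; set Mx := \big[_/_]_(_ <= _ < _) _.
have Mx0 : 0 <= Mx by exact: bigmax_ge_id.
have h0 : 0 <= h ^+ 2 by exact: sqr_ge0.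
have s1 : 0 <= step t 1 `^ sigma by exact: powR_ge0.
have [k2|] := leqP 2 k; last first.
  rewrite ltnS => k1'; have {k1' k1}k1 : k = 1%N by apply/eqP; rewrite eqn_leq k1' k1.
  rewrite ge_min; apply/orP; left; rewrite -addrA -[leLHS]addr0; apply: lerD.
    by apply: ge0_ler_powR; rewrite ?nnegrE -?k1 ltW.
  exact: addr_ge0.
rewrite ge_min; apply/orP; right.
have : t k `^ alpha * t k.-1 `^ (sigma - 2) * step t k `^ (2 - alpha) <= Mx.
  by apply: (le_bigmax_nat
    (fun k => t k `^ alpha * t k.-1 `^ (sigma - 2) * step t k `^ (2 - alpha))); rewrite k2.
suff : T `^ (sigma - 2) * delta ^+ 2 <=
    t k `^ alpha * t k.-1 `^ (sigma - 2) * step t k `^ (2 - alpha) by move: h0 s1; lra.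
have kN : (k <= N)%N by exact: leq_trans nN.
have tk10 : 0 < t k.-1.
  by rewrite -t0; apply: (mesh_lt tinc); [rewrite -ltnS prednK|rewrite (leq_trans (leq_pred _))].
have tkT : t k.-1 <= T.
  by rewrite -tN; apply: (mesh_le tinc) => //; rewrite (leq_trans (leq_pred _)).
have sk : step t k <= t k by rewrite /step gerBl ltW.
have -> : t k `^ alpha * t k.-1 `^ (sigma - 2) * step t k `^ (2 - alpha) =
  t k.-1 `^ (sigma - 2) * (t k `^ alpha * step t k `^ (2 - alpha)) by ring.
apply: ler_pM; rewrite ?powR_ge0 ?sqr_ge0//.
  by rewrite -[sigma - 2]opprB ler_powRN// subr_ge0; move: sg1; lra.
apply: (@le_trans _ _ (step t k ^+ 2)); first by apply: lerXn2r; rewrite ?nnegrE ltW.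
rewrite -powR_mulrn ?(ltW s0)// -{1}[2%:R](addrNK alpha) addrC powRD ?(gt_eqF s0) ?implybT//.
apply: ler_wpM2r; first exact: powR_ge0.
by apply: ge0_ler_powR; rewrite ?nnegrE ?(ltW al0) ?(ltW s0)// (le_trans (ltW s0)).
Qed.

Lemma mittag_leffler_mesh_ge M N t phi n : adm M N t phi ->
  (Gamma (1 : R))^-1 <= mittag_leffler alpha
    (2 * kappa * eps^-1 * c3 cOmega c0 c1 * t n `^ alpha / min_ratio N t).
Proof.
move=> ad; apply: mittag_leffler_ge => //.
rewrite divr_ge0 ?(min_ratio_ge0 (adm_mesh ad))//.
rewrite mulr_ge0 ?powR_ge0// mulr_ge0 ?c3_ge0// mulr_ge0 ?invr_ge0 ?(ltW eps0)//.
by rewrite mulr_ge0// ltW.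
Qed.

(** The constant adds the two alternatives: [L * K] for small steps and [A / b0] for a mesh with a
    large step, where the a priori bound [A] meets the lower bound [b0] of the mesh error. Division
    by [e0] brings in the Mittag-Leffler factor. *)
Lemma mesh_error_bound : exists2 C : R, 0 < C & forall M N t phi, adm M N t phi ->
  forall n, (1 <= n <= N)%N ->
    l2_error L Phi M t phi n <= C * mittag_leffler alpha
      (2 * kappa * eps^-1 * c3 cOmega c0 c1 * t n `^ alpha / min_ratio N t) *
      mesh_error alpha sigma (L / M%:R) t n.
Proof.
have [delta [K [d0 K0 small]]] := small_step_error alpha01 kappa0 sigma01 L0 T0 hPhi hreg.
pose e0 := (Gamma (1 : R))^-1.
have e00 : 0 < e0 by rewrite invr_gt0 Gamma_gt0.
pose b0 := Num.min (delta `^ sigma) (T `^ (sigma - 2) * delta ^+ 2).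
have b00 : 0 < b0 by rewrite lt_min powR_gt0//= mulr_gt0 ?powR_gt0 ?exprn_gt0.
pose A := Num.sqrt (4 * L ^+ 2 + 2 * c1 ^+ 6 + 2 * c0 ^+ 6).
have A0 : 0 <= A by exact: sqrtr_ge0.
have LK0 : 0 < L * K by exact: mulr_gt0.
have Ab0 : 0 <= A / b0 by rewrite divr_ge0// ltW.
exists ((L * K + A / b0) / e0); first by rewrite divr_gt0// ltr_wpDr.
move=> M N t phi ad n /andP[n1 nN].
have M0 := adm_grid ad; have mesh := adm_mesh ad.
set E := mittag_leffler _ _; set B := mesh_error _ _ _ _ _.
have E0 : e0 <= E by exact: mittag_leffler_mesh_ge ad.
have B0 : 0 <= B.
  by rewrite !addr_ge0 ?powR_ge0 ?sqr_ge0//; exact: bigmax_ge_id.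
have absorb x : x <= (L * K + A / b0) * B -> x <= (L * K + A / b0) / e0 * E * B.
  move=> /le_trans; apply; apply: ler_wpM2r => //.
  by rewrite -mulrA ler_peMr ?addr_ge0 ?(ltW LK0)// ler_pdivlMl ?mulr1.
apply: absorb; rewrite mulrDl.
case: (pselect (forall k, (1 <= k <= n)%N -> step t k <= delta)) => [sm|lg].
  have h := small M N t phi M0 mesh (adm_scheme ad) n _ sm.
  rewrite n1 nN in h; rewrite -[leLHS]addr0; apply: lerD; last exact: mulr_ge0.
  by rewrite -mulrA; apply: grid_norm_le => //; [rewrite mulr_ge0// ltW|exact: h].
have [k kn dk] : exists2 k, (1 <= k <= n)%N & delta < step t k.
  apply: contrapT => H; apply: lg => k kn; rewrite leNgt; apply/negP => dk.
  by apply: H; exists k.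
have Bb := mesh_error_ge_large_step (L / M%:R) d0 mesh kn nN dk.
have nN1 : (1 <= n <= N)%N by rewrite n1.
rewrite -[leLHS]add0r; apply: lerD; first by rewrite mulr_ge0// ltW.
apply: (@le_trans _ _ A).
  exact: grid_norm_sub_le M0 (adm_c1 ad nN1) (adm_c0 ad nN1).
by rewrite -mulrA ler_peMr// ler_pdivlMl ?mulr1.
Qed.

Lemma mesh_error_le (h : R) t n : mesh_error alpha sigma h t n <=
  step t 1 `^ sigma / sigma + 1 / (1 - alpha) *
    \big[Num.max/0]_(2 <= k < n.+1)
      (t k `^ alpha * t k.-1 `^ (sigma - 2) * step t k `^ (2 - alpha)) + h ^+ 2.
Proof.
rewrite /mesh_error lerD2r; apply: lerD.
  by rewrite ler_peMr ?powR_ge0// invf_ge1// ltW.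
rewrite div1r ler_peMl//; first exact: bigmax_ge_id.
by rewrite invf_ge1//; move: al0; lra.
Qed.

(** Both exponents are lowered to [beta], and surplus powers of [tau] and [t k] are bounded by
    powers of [T]; this uses [beta <= gamma * sigma] in both terms and [beta <= 2 - alpha] in the
    later steps. *)
Lemma graded_mesh_error (gamma Cg : R) : 1 <= gamma -> 0 < Cg ->
  exists2 C : R, 0 < C & forall (h : R) N t n, time_mesh T N t -> graded_mesh gamma Cg N t ->
    (1 <= n <= N)%N ->
    mesh_error alpha sigma h t n <=
      C * (max_step N t `^ Num.min (2 - alpha) (gamma * sigma) + h ^+ 2).
Proof.
move=> g1 Cg0; set beta := Num.min _ _.
have g0 : 0 < gamma by exact: lt_le_trans g1.
have b2 : beta <= 2 - alpha by rewrite ge_min lexx.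
have bg : beta <= gamma * sigma by rewrite ge_min lexx orbT.
have b0 : 0 < beta by rewrite lt_min mulr_gt0// andbT; move: al1; lra.
pose CA := Cg `^ (gamma * sigma) * T `^ (gamma * sigma - beta).
pose CB := Cg `^ (2 - sigma) * Cg `^ beta * T `^ (sigma - beta / gamma).
have CA0 : 0 <= CA by rewrite mulr_ge0 ?powR_ge0.
have CB0 : 0 <= CB by rewrite !mulr_ge0 ?powR_ge0.
exists (CA + CB + 1); first by rewrite ltr_wpDl// addr_ge0.
move=> h N t n mesh [grad quot] /andP[n1 nN]; set tau := max_step N t.
have tinc := mesh_incr mesh; have t0 := mesh_start mesh; have tN := mesh_end mesh.
have N1 : (1 <= N)%N by exact: leq_trans nN.
have steple k : (1 <= k <= N)%N -> step t k <= tau.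
  by move=> kN; apply: (le_bigmax_nat (step t)); rewrite ltnS.
have steppos k : (1 <= k <= N)%N -> 0 < step t k.
  by case: k => // k /= kN; rewrite subr_gt0; exact: tinc.
have tau0 : 0 < tau by apply: lt_le_trans (steple 1%N N1); exact: steppos.
have tpos k : (1 <= k <= N)%N -> 0 < t k.
  by move=> /andP[k1 kN]; rewrite -t0; exact: (mesh_lt tinc).
have tT k : (k <= N)%N -> t k <= T by move=> kN; rewrite -tN; exact: (mesh_le tinc).
have tauT : tau <= T.
  apply: bigmax_nat_le; first exact: ltW.
  move=> k; rewrite ltnS => kN; rewrite /step lerBlDr (le_trans (tT k _))//; first by case/andP: kN.
  rewrite lerDl -t0; apply: (mesh_le tinc) => //.
  by rewrite (leq_trans (leq_pred _))//; case/andP: kN.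
pose tb := tau `^ beta; have tb0 : 0 <= tb by exact: powR_ge0.
have first_step : step t 1 `^ sigma <= CA * tb.
  have t1 : 0 < t 1%N by exact: tpos.
  have s1 : step t 1 = t 1%N by rewrite /step /= t0 subr0.
  (* On the first cell the step equals [t 1], so the grading condition can be solved for [t 1]. *)
  have root : t 1%N `^ gamma^-1 <= Cg * tau.
    have := grad 1%N; rewrite N1 s1 => /(_ isT) g.
    have {g} : t 1%N <= tau * (Cg * t 1%N `^ (1 - gamma^-1)).
      by apply: le_trans g _; rewrite ler_pM2l// ge_min lexx orbT.
    rewrite -{1}[t 1%N]powRr1 ?(ltW t1)// -{1}(subrK gamma^-1 1) powRD ?(gt_eqF t1) ?implybT//.
    rewrite [leRHS](_ : _ = t 1%N `^ (1 - gamma^-1) * (Cg * tau)); last by ring.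
    by rewrite ler_pM2l// powR_gt0.
  rewrite s1 -{1}[sigma]mul1r -(mulVf (lt0r_neq0 g0)) -mulrA powRrM.
  have gs0 : 0 <= gamma * sigma by rewrite mulr_ge0// ltW.
  apply: (@le_trans _ _ ((Cg * tau) `^ (gamma * sigma))).
    by apply: ge0_ler_powR; rewrite ?nnegrE ?powR_ge0 ?gs0 ?mulr_ge0 ?(ltW Cg0) ?(ltW tau0).
  rewrite powRM ?(ltW Cg0) ?(ltW tau0)// /CA -mulrA; apply: ler_wpM2l; first exact: powR_ge0.
  rewrite -{1}(subrK beta (gamma * sigma)) powRD ?(gt_eqF tau0) ?implybT//.
  apply: ler_wpM2r => //; apply: ge0_ler_powR; rewrite ?nnegrE ?subr_ge0 ?(ltW tau0) ?(ltW T0)//.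
have later_steps k : (2 <= k < n.+1)%N ->
    t k `^ alpha * t k.-1 `^ (sigma - 2) * step t k `^ (2 - alpha) <= CB * tb.
  move=> /andP[k2]; rewrite ltnS => kn; have kN : (k <= N)%N by exact: leq_trans nN.
  have k1N : (1 <= k <= N)%N by rewrite kN ltnW.
  have tk := tpos k k1N; have sk := steppos k k1N.
  have tk1 : 0 < t k.-1.
    by apply: tpos; rewrite -ltnS prednK ?k2 ?(leq_trans (leq_pred _))// ltnW.
  have h1 : t k.-1 `^ (sigma - 2) <= Cg `^ (2 - sigma) * t k `^ (sigma - 2).
    have := quot k; rewrite k2 kN => /(_ isT) q.
    have s2 : 0 <= 2 - sigma by move: sg1; lra.
    have -> : Cg `^ (2 - sigma) * t k `^ (sigma - 2) = (t k / Cg) `^ (- (2 - sigma)).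
      rewrite powRM ?invr_ge0 ?(ltW tk) ?(ltW Cg0)// mulrC opprB; congr (_ * _).
      by rewrite -powR_inv1 ?(ltW Cg0)// -powRrM; congr (_ `^ _); ring.
    rewrite -[sigma - 2]opprB; apply: ler_powRN => //; first exact: divr_gt0.
    by rewrite ler_pdivrMr// mulrC.
  (* Only the power [beta] of the step is spent on the grading condition; for the rest,
     [step t k <= t k] suffices. *)
  have h2 : step t k `^ (2 - alpha) <=
      t k `^ (2 - alpha - beta) * (tb * Cg `^ beta * t k `^ ((1 - gamma^-1) * beta)).
    rewrite -{1}(subrK beta (2 - alpha)) powRD ?(gt_eqF sk) ?implybT//.
    apply: ler_pM; rewrite ?powR_ge0//.
      apply: ge0_ler_powR; rewrite ?nnegrE ?(ltW sk) ?subr_ge0 ?(ltW tk)//.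
      by rewrite /step gerBl ltW.
    rewrite powRrM -powRM ?(ltW tau0) ?(ltW Cg0)//.
    rewrite -powRM ?powR_ge0 ?mulr_ge0 ?(ltW tau0) ?(ltW Cg0)//.
    apply: ge0_ler_powR;
      rewrite ?nnegrE ?(ltW b0) ?(ltW sk) ?mulr_ge0 ?powR_ge0 ?(ltW tau0) ?(ltW Cg0)//.
    by apply: le_trans (grad k k1N) _; rewrite -mulrA ler_pM2l// ge_min lexx orbT.
  apply: (@le_trans _ _ (t k `^ alpha * (Cg `^ (2 - sigma) * t k `^ (sigma - 2)) *
      (t k `^ (2 - alpha - beta) * (tb * Cg `^ beta * t k `^ ((1 - gamma^-1) * beta))))).
    by apply: ler_pM; rewrite ?mulr_ge0 ?powR_ge0// ler_wpM2l ?powR_ge0.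
  (* The exponents of [t k] add up to [sigma - beta / gamma], which is nonnegative because
     [beta <= gamma * sigma]. *)
  have merge : t k `^ (sigma - beta / gamma) = t k `^ alpha * t k `^ (sigma - 2) *
      t k `^ (2 - alpha - beta) * t k `^ ((1 - gamma^-1) * beta).
    by rewrite -!powRD ?(gt_eqF tk) ?implybT//; congr (_ `^ _); ring.
  rewrite [leLHS](_ : _ = Cg `^ (2 - sigma) * Cg `^ beta * tb * t k `^ (sigma - beta / gamma));
    last by rewrite merge; ring.
  rewrite /CB [leRHS](_ : _ = Cg `^ (2 - sigma) * Cg `^ beta * tb * T `^ (sigma - beta / gamma));
    last by ring.
  apply: ler_wpM2l; first by rewrite !mulr_ge0 ?powR_ge0.
  apply: ge0_ler_powR; rewrite ?nnegrE ?(ltW tk) ?(ltW T0) ?tT//.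
  by rewrite subr_ge0 ler_pdivrMr// mulrC.
have Mx := bigmax_nat_le (mulr_ge0 CB0 tb0) later_steps.
have h0 : 0 <= h ^+ 2 by exact: sqr_ge0.
rewrite /mesh_error -/tb; apply: le_trans (lerD (lerD first_step Mx) (lexx _)) _.
have AB := mulr_ge0 (addr_ge0 CA0 CB0) h0.
by rewrite mulrDr; move: AB; lra.
Qed.
End error_bounds.

Theorem theorem3p1 (R : realType) (alpha kappa eps sigma L T : R)
    (Phi0 : R * R -> R) (Phi : R -> R * R -> R) (Creg cOmega c0 c1 : R)
    (halpha : 0 < alpha < 1) (hkappa : 0 < kappa) (heps : 0 < eps)
    (hsigma : 0 < sigma < 1) (hL : 0 < L) (hT : 0 < T)
    (hPhi : allen_cahn_solution alpha kappa eps L T Phi0 Phi)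
    (hreg : allen_cahn_regular sigma T Creg Phi)
    (hOmega : discrete_sobolev L cOmega) (hc1 : 0 < c1) :
  let E N t n := mittag_leffler alpha
    (2 * kappa * eps^-1 * c3 cOmega c0 c1 * t n `^ alpha / min_ratio N t) in
  (exists2 C : R, 0 < C &
    forall (M N : nat) (t : nat -> R) (phi : nat -> int -> int -> R),
      admissible alpha kappa eps L T Phi0 Phi cOmega c0 c1 M N t phi ->
      forall n, (1 <= n <= N)%N ->
        l2_error L Phi M t phi n <=
          C * E N t n *
          (step t 1 `^ sigma / sigma +
           1 / (1 - alpha) *
             \big[Num.max/0]_(2 <= k < n.+1)
               (t k `^ alpha * t k.-1 `^ (sigma - 2) *
                step t k `^ (2 - alpha)) +
           (L / M%:R) ^+ 2)) /\
  (forall gamma Cgamma : R, 1 <= gamma -> 0 < Cgamma ->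
    exists2 C : R, 0 < C &
    forall (M N : nat) (t : nat -> R) (phi : nat -> int -> int -> R),
      admissible alpha kappa eps L T Phi0 Phi cOmega c0 c1 M N t phi ->
      graded_mesh gamma Cgamma N t ->
      forall n, (1 <= n <= N)%N ->
        l2_error L Phi M t phi n <=
          C / (sigma * (1 - alpha)) * E N t n *
          (max_step N t `^ Num.min (2 - alpha) (gamma * sigma) +
           (L / M%:R) ^+ 2)) /\
  (forall gamma Cgamma : R, Num.max 1 ((2 - alpha) / sigma) <= gamma ->
    0 < Cgamma ->
    exists2 C : R, 0 < C &
    forall (M N : nat) (t : nat -> R) (phi : nat -> int -> int -> R),
      admissible alpha kappa eps L T Phi0 Phi cOmega c0 c1 M N t phi ->
      graded_mesh gamma Cgamma N t ->
      forall n, (1 <= n <= N)%N ->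
        l2_error L Phi M t phi n <=
          C / (sigma * (1 - alpha)) * E N t n *
          (max_step N t `^ (2 - alpha) + (L / M%:R) ^+ 2)).
Proof.
move=> E; have /andP[al0 al1] := halpha; have /andP[sg0 sg1] := hsigma.
have [C C0 HC] := mesh_error_bound cOmega c0 c1 halpha hkappa heps hsigma hL hT hPhi hreg.
have E0 M N t phi n : admissible alpha kappa eps L T Phi0 Phi cOmega c0 c1 M N t phi ->
    0 <= E N t n.
  move=> ad; apply: le_trans (mittag_leffler_mesh_ge halpha hkappa heps n ad).
  by rewrite invr_ge0 ltW// Gamma_gt0.
split.
  exists C => // M N t phi ad n nN; apply: le_trans (HC M N t phi ad n nN) _.
  apply: ler_wpM2l; last exact: mesh_error_le.
  by rewrite mulr_ge0 ?(ltW C0)// (E0 _ _ _ _ _ ad).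
have graded gamma Cgamma : 1 <= gamma -> 0 < Cgamma -> exists2 C : R, 0 < C &
    forall (M N : nat) (t : nat -> R) (phi : nat -> int -> int -> R),
      admissible alpha kappa eps L T Phi0 Phi cOmega c0 c1 M N t phi ->
      graded_mesh gamma Cgamma N t ->
      forall n, (1 <= n <= N)%N ->
        l2_error L Phi M t phi n <=
          C / (sigma * (1 - alpha)) * E N t n *
          (max_step N t `^ Num.min (2 - alpha) (gamma * sigma) +
           (L / M%:R) ^+ 2).
  move=> g1 Cg0.
  have [D D0 HD] := graded_mesh_error halpha hsigma hT g1 Cg0.
  have q0 : 0 < sigma * (1 - alpha) by rewrite mulr_gt0// subr_gt0.
  (* Dividing by this product therefore only enlarges the right-hand side. *)
  have q1 : sigma * (1 - alpha) <= 1 by rewrite mulr_ile1//; move: al0 al1 sg0 sg1; lra.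
  exists (C * D); first exact: mulr_gt0.
  move=> M N t phi ad gr n nN; apply: le_trans (HC M N t phi ad n nN) _.
  have En := E0 _ _ _ _ n ad.
  apply: (@le_trans _ _ (C * E N t n * (D * (max_step N t `^
      Num.min (2 - alpha) (gamma * sigma) + (L / M%:R) ^+ 2)))).
    apply: ler_wpM2l; first by rewrite mulr_ge0// ltW.
    exact: HD (adm_mesh ad) gr nN.
  rewrite [leLHS](_ : _ = C * D * (E N t n * (max_step N t `^
      Num.min (2 - alpha) (gamma * sigma) + (L / M%:R) ^+ 2))); last by ring.
  rewrite -[leRHS]mulrA; apply: ler_wpM2r.
    by rewrite mulr_ge0// addr_ge0 ?powR_ge0 ?sqr_ge0.
  by rewrite ler_peMr ?invf_ge1// ltW// mulr_gt0.
split=> // gamma Cgamma; rewrite ge_max => /andP[g1 g2] Cg0.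
have [D D0 HD] := graded gamma Cgamma g1 Cg0; exists D => // M N t phi ad gr n nN.
have := HD M N t phi ad gr n nN; rewrite min_l//.
by rewrite -ler_pdivrMr.
Qed.
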